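(* With the notation of the context, fix a framing of $\Lambda_{prim}$ and let $(V_a)_{a\in\Lambda_{prim}}$ be the open covering of $X$. For linearly independent $a,b\in\Lambda_{prim}$ let $$h_{a,b}(w,x)=\prod_{\delta\in F/\mathbb Z\gamma}h_3\left(\frac{w+\delta(x)}{\gamma(x)},\frac{\alpha(x)}{\gamma(x)},\frac{\beta(x)}{\gamma(x)}\right),\quad (w,x)\in V_a\cap V_b,$$ where $\gamma=\gamma_{a,b}$ is the direction vector, $\alpha,\beta\in\Lambda^\vee$ are such that $\alpha(b)=\beta(a)=0$, $\alpha(a)>0$, $\beta(b)>0$, and $F=\{\delta\in\Lambda^\vee:0\le\delta(a)<\alpha(a),\ 0\le\delta(b)<\beta(b)\}$; set $h_{a,a}=1$. Let $(\alpha_1,\alpha_2,\alpha_3)$ be the basis of $\Lambda^\vee$ associated to $a\in\Lambda_{prim}$ by the framing and define for $\mu\in\Lambda^\vee=\mathbb Z^3$ $$h_a(\mu;w,x)=\prod_{j=0}^{\mu(a)-1}h_2\left(\frac{w+j\alpha_1(x)}{\alpha_3(x)},\frac{\alpha_2(x)}{\alpha_3(x)}\right),\quad (w,x)\in V_a,$$ and extend $h_a$ to $ISL_3(\mathbb Z)$ by $h_a((g,\mu);w,x)=h_a(\mu\circ g^{-1};w,x)$. Then the 1-cochain $(h^{0,1},h^{1,0})$ with $h^{0,1}=(h_{a,b})_{a,b}$, $h^{1,0}=(h_a)_{a}$, with values in the sheaf of positive smooth functions, defines an equivariant hermitian structure on the gamma gerbe; i.e., with $\phi$ the cocycle defining the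 gamma gerbe, for all $a,b,c\in\Lambda_{prim}$, $g,g_1,g_2\in ISL_3(\mathbb Z)$: $$h_{a,b}(y)h_{b,a}(y)=1,\quad y\in V_a\cap V_b,$$ $$h_{a,b}(y)h_{b,c}(y)h_{c,a}(y)=|\phi_{a,b,c}(y)|^{-2},\quad y\in V_a\cap V_b\cap V_c,$$ $$h_{g^{-1}a,g^{-1}b}(g^{-1}y)\,h_b(g;y)=|\phi_{a,b}(g;y)|^{2}\,h_a(g;y)\,h_{a,b}(y),\quad y\in V_a\cap V_b,$$ $$h_a(g_1g_2;y)=|\phi_a(g_1,g_2;y)|^{2}\,h_a(g_1;y)\,h_{g_1^{-1}a}(g_2;g_1^{-1}y),\quad y\in V_a.$$
   Context: Functions $h_2,h_3$. For complex variables (with $\mathrm{Im}\,\tau,\mathrm{Im}\,\sigma\ne0$), $$h_2(z,\tau)=\exp\left(-2\pi\frac{(\mathrm{Im}\,z)^2}{\mathrm{Im}\,\tau}+2\pi\,\mathrm{Im}(z-\tau/6)\right),\qquad h_3(z,\tau,\sigma)=\exp\left(-\tfrac{2\pi}3R_3(\mathrm{Im}\,z,\mathrm{Im}\,\tau,\mathrm{Im}\,\sigma)\right),$$ $$R_3(\zeta,t,s)=\frac{\zeta^3}{ts}-\frac32\left(\frac1t+\frac1s\right)\zeta^2+\left(\frac t{2s}+\frac s{2t}+\frac32\right)\zeta-\frac{t+s}4.$$ Lattice and planes. $\Lambda=\mathbb Z^3\subset V=\mathbb Q^3$, $V_{\mathbb C}=\mathbb C^3$, $\Lambda^\vee=\mathrm{Hom}_{\mathbb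 Z}(\Lambda,\mathbb Z)\subset V^*$; $\det$ denotes the standard determinant forms on $V$ and on $V^*$; linear forms are extended $\mathbb C$-linearly to $V_{\mathbb C}$. $\Lambda_{prim}$ is the set of primitive vectors of $\Lambda$. For $a\in\Lambda_{prim}$ let $\Lambda^\vee_+(a)=\{\delta\in\Lambda^\vee:\delta(a)>0\}$, $\Lambda^\vee_-(a)=\{\delta\in\Lambda^\vee:\delta(a)\le 0\}$, and let $H(a)=\{\alpha\in V^*:\alpha(a)=0\}$, oriented so that an ordered basis $(\alpha,\beta)$ of $H(a)$ is oriented iff $\det(\alpha,\beta,\delta)>0$ whenever $\delta(a)>0$. Let $U_a^+$ be the open set of $x\in V_{\mathbb C}$ with $\mathrm{Im}(\alpha(x)\overline{\beta(x)})>0$ for some (equivalently every) oriented basis $(\alpha,\beta)$ of $H(a)$. Gamma functions. For linearly independent $a,b\in\Lambda_{prim}$ the direction vector $\gamma=\gamma_{a,b}$ is the unique primitive element of $\Lambda^\vee$ with $\det(a,b,\cdot)=s\gamma$ for a positive integer $s$. Put $C_{+-}(a,b)=\Lambda^\vee_+(a)\cap\Lambda^\vee_-(b)$, $C_{-+}(a,b)=\Lambda^\vee_-(a)\cap\Lambda^\vee_+(b)$; $\mathbb Z\gamma$ acts on these by translation. For $w\in\mathbb C$, $x\in U_a^+\cap U_b^+$, $$\Gamma_{a,b}(w,x)=\frac{\prod_{\delta\in C_{+-}(a,b)/\mathbb Z\gamma}(1-e^{-2\pi i(\delta(x)-w)/\gamma(x)})}{\prod_{\delta\in C_{-+}(a,b)/\mathbb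 Z\gamma}(1-e^{2\pi i(\delta(x)-w)/\gamma(x)})},\qquad \Gamma_{a,a}=1.$$ (For $b=-a$ the set $U_a^+\cap U_b^+$ is empty.) Framings and $\Delta$. $\theta_0(z,\tau)=\prod_{j\ge0}(1-e^{2\pi i((j+1)\tau-z)})(1-e^{2\pi i(j\tau+z)})$ for $\mathrm{Im}\,\tau>0$. A framing $f$ assigns to each $a\in\Lambda_{prim}$ an oriented $\mathbb Z$-basis $f(a)=(\alpha_1,\alpha_2,\alpha_3)$ of $\Lambda^\vee$ with $\alpha_1(a)=1$, $\alpha_2,\alpha_3\in H(a)$. For $\mu\in\Lambda^\vee$, $w\in\mathbb C$, $x\in U_a^+$ put $\Delta_a(\mu;w,x)=\prod_{j=0}^{\mu(a)-1}\theta_0\left(\frac{w+j\alpha_1(x)}{\alpha_3(x)},\frac{\alpha_2(x)}{\alpha_3(x)}\right)$. All products $\prod_{j=0}^{\mu(a)-1}$ mean $\prod_{-N\le j<\mu(a)}/\prod_{-N\le j<0}$ for $N$ large, so they are defined also for $\mu(a)\le0$. Space, group, covering. $X=\{(w,x)\in\mathbb C\times(\mathbb C^3-\mathbb C\cdot\mathbb R^3)\}/\mathbb C^\times$, $(w,x)\sim(\lambda w,\lambda x)$, i.e. the total space of $O(1)$ over $\mathbb CP^2-\mathbb RP^2$. $G=ISL_3(\mathbb Z)=SL_3(\mathbb Z)\ltimes\Lambda^\vee$ acts by $(g,\mu)\cdot(w,x)=(w-\mu(x),gx)$. For $a\in\Lambda_{prim}$, $V_a=\{(w,x):x\in U_a^+\}/\mathbb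 C^\times$; this is an invariant open covering with $(g,\mu)V_a=V_{ga}$ (elements of $G$ act on $\Lambda_{prim}$ through $SL_3(\mathbb Z)$). Extend $\Delta_a$ to $G$ by $\Delta_a((g,\mu);w,x)=\Delta_a(\mu\circ g^{-1};w,x)$. Gamma gerbe. The gamma gerbe is the equivariant holomorphic gerbe on $X$ given by the 2-cocycle $\phi$ of nowhere vanishing holomorphic functions defined (for the fixed framing) by $\phi_{a,b,c}\Gamma_{a,c}=\Gamma_{a,b}\Gamma_{b,c}$ on $V_a\cap V_b\cap V_c$, $\phi_{a,b}(g;y)\Gamma_{g^{-1}a,g^{-1}b}(g^{-1}y)\Delta_b(g;y)=\Delta_a(g;y)\Gamma_{a,b}(y)$ on $V_a\cap V_b$, $\phi_a(g,h;y)\Delta_a(gh;y)=\Delta_a(g;y)\Delta_{g^{-1}a}(h;g^{-1}y)$ on $V_a$. An equivariant hermitian structure on it is given by positive smooth functions $h_{a,b}$ on $V_a\cap V_b$ and $h_a(g;\cdot)$ on $V_a$ (the norms squared of the trivializing sections of the trivial bundles $L_{a,b}$, $L_a(g)$) for which the structure maps of the gerbe are unitary, i.e. satisfying the four displayed conditions in the claim. *)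

(* Defs.v *)
From HB Require Import structures.
From mathcomp Require Import all_boot all_order all_algebra finmap.
From mathcomp Require Import complex.
From mathcomp Require Import all_classical all_reals all_analysis.
From mathcomp Require Export summability.

Set Implicit Arguments.
Unset Strict Implicit.
Unset Printing Implicit Defensive.

Import Order.TTheory GRing.Theory Num.Theory.
Import numFieldNormedType.Exports.

Local Open Scope classical_set_scope.
Local Open Scope ring_scope.

(* [R[i]] carries the topology and the normed [R[i]]-module structure of the
   field [R[i]] over itself, so that [differentiable] on [R[i]]-modules is
   complex differentiability. *)
HB.instance Definition _ (R : realType) := GRing.ComAlgebra.copy R[i] (R[i])^o.
HB.instance Definition _ (R : realType) := Vector.copy R[i] (R[i])^o.
HB.instance Definition _ (R : realType) := NormedModule.copy R[i] (R[i])^o.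

(* [Re] and [Im] would otherwise denote those of [Num.Theory], with values in
   [R[i]]. *)
Local Notation Re := complex.Re.
Local Notation Im := complex.Im.

Section Lattice.

Definition Lam := 'cV[int]_3.
Definition Dual := 'rV[int]_3.

Definition primitive m n (v : 'M[int]_(m, n)) : bool :=
  \big[gcdn/0%N]_i \big[gcdn/0%N]_j `|v i j|%N == 1%N.

Definition pairing (delta : Dual) (a : Lam) : int := (delta *m a) 0 0.

Definition detL (a b c : Lam) : int := \det (row_mx a (row_mx b c)).

Definition Lplus (a : Lam) : set Dual := [set delta | 0 < pairing delta a].
Definition Lminus (a : Lam) : set Dual := [set delta | pairing delta a <= 0].

Definition toQ m n (v : 'M[int]_(m, n)) : 'M[rat]_(m, n) := map_mx intr v.

Definition lin_indep (a b : Lam) : bool :=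
  row_free (toQ (col_mx a^T b^T)).

(* The row space of [kermx (toQ a)] is the plane H(a). *)
Definition oriented_basis (a : Lam) (alpha beta : 'rV[rat]_3) : Prop :=
  [/\ row_free (col_mx alpha beta),
      (col_mx alpha beta == kermx (toQ a))%MS
    & forall delta : 'rV[rat]_3, 0 < (delta *m toQ a) 0 0 ->
        0 < \det (col_mx alpha (col_mx beta delta))].

Definition is_direction (a b : Lam) (gamma : Dual) : Prop :=
  primitive gamma /\
  exists2 s : int, 0 < s & forall c, detL a b c = s * pairing gamma c.

Definition direction (a b : Lam) : Dual := xget 0 (is_direction a b).

(* The elements of A / Z gamma, as subsets of the dual lattice. *)
Definition orbits (gamma : Dual) (A : set Dual) : set (set Dual) :=
  [set [set delta + gamma *~ k | k in [set: int]] | delta in A].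

(* The rows of [f a] are alpha_1, alpha_2, alpha_3; they form a Z-basis of the
   dual lattice iff the matrix is invertible over [int]. *)
Definition is_framing (f : Lam -> 'M[int]_3) : Prop :=
  forall a, primitive a ->
    [/\ f a \in unitmx, 0 < \det (f a), pairing (row 0 (f a)) a = 1,
        pairing (row 1 (f a)) a = 0 & pairing (row 2 (f a)) a = 0].

End Lattice.

Section Group.

(* Elements [(g, mu)] with [g] in SL_3(Z). The product is the one for which
   [(g, mu) (w, x) = (w - mu x, g x)] is a left action. *)
Definition ISL3_pair : Type := ('M[int]_3 * Dual)%type.

Definition ISL3 : set ISL3_pair := [set g | \det g.1 = 1].

Definition ISL3_mul (g h : ISL3_pair) : ISL3_pair :=
  (g.1 *m h.1, h.2 + g.2 *m h.1).

Definition ISL3_inv (g : ISL3_pair) : ISL3_pair :=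
  (invmx g.1, - (g.2 *m invmx g.1)).

Definition ISL3_actL (g : ISL3_pair) (a : Lam) : Lam := g.1 *m a.

Definition ISL3_shift (g : ISL3_pair) : Dual := g.2 *m invmx g.1.

End Group.

Section ComplexFunctions.
Variable R : realType.
Implicit Types z tau sigma : R[i].

Definition cexp z : R[i] :=
  (expR (Re z))%:C%C * (cos (Im z) +i* sin (Im z))%C.

(* exp (2 pi i z) *)
Definition cexp2pi z : R[i] := cexp ((0 +i* (2 * pi))%C * z).

(* Unconditional (possibly infinite) product over [A]: the limit of the
   products over finite subsets. *)
Definition iprod (I : choiceType) (A : set I) (F : I -> R[i]) : R[i] :=
  lim ((\prod_(i <- J | i \in A) F i) @[J --> @totally I]).

Definition theta0 z tau : R[i] :=
  lim ((\prod_(0 <= j < n)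
         ((1 - cexp2pi (j.+1%:R * tau - z)) * (1 - cexp2pi (j%:R * tau + z))))
       @[n --> \oo]).

Definition h2 z tau : R :=
  expR (- (2 * pi) * (Im z ^+ 2 / Im tau) + 2 * pi * Im (z - tau / 6%:R)).

Definition R3 (zeta t s : R) : R :=
  zeta ^+ 3 / (t * s) - 3 / 2 * (t^-1 + s^-1) * zeta ^+ 2
  + (t / (2 * s) + s / (2 * t) + 3 / 2) * zeta - (t + s) / 4.

Definition h3 z tau sigma : R :=
  expR (- (2 * pi / 3) * R3 (Im z) (Im tau) (Im sigma)).

End ComplexFunctions.

(* The product over 0 <= j < n of F j, read as
   prod_(-N <= j < n) F j / prod_(-N <= j < 0) F j with N large, in reduced
   form: common factors are cancelled, as they may vanish at some points. *)
Section IntegerProducts.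
Variable K : fieldType.
Implicit Types (n : int) (F : int -> K).

Definition zprod_num n F : K :=
  if n is Posz m then \prod_(0 <= j < m) F j%:Z else 1.

Definition zprod_den n F : K :=
  if n is Negz m then \prod_(0 <= j < m.+1) F (- j.+1%:Z) else 1.

Definition zprod n F : K := zprod_num n F / zprod_den n F.

End IntegerProducts.

Section Space.
Variable R : realType.
Local Notation C := R[i].

(* Points [(w, x)] are homogeneous coordinates on X, which is the quotient of
   [Xcone] by the nonzero complex scalars. Subsets of X are given by their
   preimages and functions by scaling invariant functions. *)
Definition hpoint : Type := (C * 'cV[C]_3)%type.

Definition Xcone : set hpoint :=
  [set y | ~ exists (l : C) (r : 'cV[R]_3),
               y.2 = l *: map_mx (fun t : R => t%:C%C) r].

Definition evQ (alpha : 'rV[rat]_3) (x : 'cV[C]_3) : C :=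
  (map_mx ratr alpha *m x) 0 0.

Definition ev (delta : Dual) (x : 'cV[C]_3) : C :=
  (map_mx intr delta *m x) 0 0.

Definition Uplus (a : Lam) : set 'cV[C]_3 :=
  [set x | exists alpha beta, oriented_basis a alpha beta /\
             0 < Im (evQ alpha x * (evQ beta x)^*%C)].

Definition Vcov (a : Lam) : set hpoint := [set y | Xcone y /\ Uplus a y.2].

Definition ISL3_act (g : ISL3_pair) (y : hpoint) : hpoint :=
  (y.1 - ev g.2 y.2, map_mx intr g.1 *m y.2).

Definition scaling_invariant (T : Type) (O : set hpoint) (F : hpoint -> T) :=
  forall (l : C) y, l != 0 -> O y -> F (l *: y) = F y.

Definition nonvanishing_holomorphic (O : set hpoint) (F : hpoint -> C) : Prop :=
  [/\ scaling_invariant O F,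
      forall y, O y -> differentiable F y
    & forall y, O y -> F y != 0].

(* Restriction to the real line through [y] in the direction [v]. *)
Definition along (F : hpoint -> R) (y v : hpoint) : R -> R :=
  fun t => F (y + t%:C%C *: v).

(* [F] is of class C^k on the open set [O], as a function of real variables:
   [F] is continuous and its real directional derivatives are of class
   C^(k-1). *)
Fixpoint class_C (k : nat) (O : set hpoint) (F : hpoint -> R) : Prop :=
  (forall y, O y -> {for y, continuous F}) /\
  if k is k'.+1 then
    forall v : hpoint,
      (forall y, O y -> derivable (along F y v) 0 1) /\
      class_C k' O (fun y => derive1 (along F y v) 0)
  else True.

Definition positive_smooth (O : set hpoint) (F : hpoint -> R) : Prop :=
  [/\ scaling_invariant O F,
      forall k, class_C k O F
    & forall y, O y -> 0 < F y].

(* The factors below only depend on the class of delta modulo Z gamma; they are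
   evaluated at a chosen representative [xget 0 c] of the class [c]. *)
Definition Gamma_num (a b : Lam) (y : hpoint) : C :=
  let gamma := direction a b in
  iprod (orbits gamma (Lplus a `&` Lminus b)) (fun c =>
    1 - cexp2pi (- ((ev (xget 0 c) y.2 - y.1) / ev gamma y.2))).

Definition Gamma_den (a b : Lam) (y : hpoint) : C :=
  let gamma := direction a b in
  iprod (orbits gamma (Lminus a `&` Lplus b)) (fun c =>
    1 - cexp2pi ((ev (xget 0 c) y.2 - y.1) / ev gamma y.2)).

Definition Gamma (a b : Lam) (y : hpoint) : C :=
  if a == b then 1 else Gamma_num a b y / Gamma_den a b y.

Definition Gamma_defined (a b : Lam) (y : hpoint) : Prop :=
  a != b -> Gamma_den a b y != 0.

Section Framed.
Variable f : Lam -> 'M[int]_3.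

Definition theta_factor (a : Lam) (y : hpoint) (j : int) : C :=
  let x := y.2 in
  theta0 ((y.1 + j%:~R * ev (row 0 (f a)) x) / ev (row 2 (f a)) x)
         (ev (row 1 (f a)) x / ev (row 2 (f a)) x).

Definition Delta (a : Lam) (mu : Dual) (y : hpoint) : C :=
  zprod (pairing mu a) (theta_factor a y).

Definition Delta_defined (a : Lam) (mu : Dual) (y : hpoint) : Prop :=
  zprod_den (pairing mu a) (theta_factor a y) != 0.

Definition DeltaG (a : Lam) (g : ISL3_pair) (y : hpoint) : C :=
  Delta a (ISL3_shift g) y.

Definition DeltaG_defined (a : Lam) (g : ISL3_pair) (y : hpoint) : Prop :=
  Delta_defined a (ISL3_shift g) y.

Definition h_a (a : Lam) (mu : Dual) (y : hpoint) : R :=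
  let x := y.2 in
  zprod (pairing mu a) (fun j : int =>
    h2 ((y.1 + j%:~R * ev (row 0 (f a)) x) / ev (row 2 (f a)) x)
       (ev (row 1 (f a)) x / ev (row 2 (f a)) x)).

Definition h10 (a : Lam) (g : ISL3_pair) (y : hpoint) : R :=
  h_a a (ISL3_shift g) y.

End Framed.

(* alpha, beta in the definition of h_(a,b). *)
Definition adapted (a b : Lam) (alpha beta : Dual) : Prop :=
  [/\ pairing alpha b = 0, pairing beta a = 0,
      0 < pairing alpha a & 0 < pairing beta b].

Definition Fset (a b : Lam) (alpha beta : Dual) : set Dual :=
  [set delta | 0 <= pairing delta a < pairing alpha a /\
               0 <= pairing delta b < pairing beta b].

Definition h_ab (a b : Lam) (alpha beta : Dual) (y : hpoint) : R :=
  let gamma := direction a b in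
  let x := y.2 in
  \big[*%R/1]_(c \in orbits gamma (Fset a b alpha beta))
    h3 ((y.1 + ev (xget 0 c) x) / ev gamma x)
       (ev alpha x / ev gamma x) (ev beta x / ev gamma x).

(* [al a b], [be a b] are the chosen alpha, beta. *)
Definition h01 (al be : Lam -> Lam -> Dual) (a b : Lam) (y : hpoint) : R :=
  if a == b then 1 else h_ab a b (al a b) (be a b) y.

Record cochain2 := Cochain2 {
  phi_abc : Lam -> Lam -> Lam -> hpoint -> C;
  phi_ab : Lam -> Lam -> ISL3_pair -> hpoint -> C;
  phi_a : Lam -> ISL3_pair -> ISL3_pair -> hpoint -> C
}.

(* The defining equations are identities between meromorphic functions: they
   are required at the points where no denominator vanishes, a dense subset of
   the domain. This determines the holomorphic functions [phi] there. *)
Record gamma_cocycle (f : Lam -> 'M[int]_3) (phi : cochain2) : Prop := {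
  phi_abc_hol : forall a b c, primitive a -> primitive b -> primitive c ->
    nonvanishing_holomorphic (Vcov a `&` Vcov b `&` Vcov c) (phi_abc phi a b c);
  phi_ab_hol : forall a b g, primitive a -> primitive b -> ISL3 g ->
    nonvanishing_holomorphic (Vcov a `&` Vcov b) (phi_ab phi a b g);
  phi_a_hol : forall a g h, primitive a -> ISL3 g -> ISL3 h ->
    nonvanishing_holomorphic (Vcov a) (phi_a phi a g h);
  phi_abcE : forall a b c, primitive a -> primitive b -> primitive c ->
    forall y, (Vcov a `&` Vcov b `&` Vcov c) y ->
    Gamma_defined a c y -> Gamma_defined a b y -> Gamma_defined b c y ->
    phi_abc phi a b c y * Gamma a c y = Gamma a b y * Gamma b c y;
  phi_abE : forall a b g, primitive a -> primitive b -> ISL3 g ->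
    forall y, (Vcov a `&` Vcov b) y ->
    let g' := ISL3_inv g in
    Gamma_defined (ISL3_actL g' a) (ISL3_actL g' b) (ISL3_act g' y) ->
    DeltaG_defined f b g y -> DeltaG_defined f a g y -> Gamma_defined a b y ->
    phi_ab phi a b g y
      * Gamma (ISL3_actL g' a) (ISL3_actL g' b) (ISL3_act g' y)
      * DeltaG f b g y
    = DeltaG f a g y * Gamma a b y;
  phi_aE : forall a g h, primitive a -> ISL3 g -> ISL3 h ->
    forall y, Vcov a y ->
    let g' := ISL3_inv g in
    DeltaG_defined f a (ISL3_mul g h) y -> DeltaG_defined f a g y ->
    DeltaG_defined f (ISL3_actL g' a) h (ISL3_act g' y) ->
    phi_a phi a g h y * DeltaG f a (ISL3_mul g h) y
    = DeltaG f a g y * DeltaG f (ISL3_actL g' a) h (ISL3_act g' y)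
}.

Record equivariant_hermitian_structure (phi : cochain2)
    (hab : Lam -> Lam -> hpoint -> R)
    (ha : Lam -> ISL3_pair -> hpoint -> R) : Prop := {
  hab_smooth : forall a b, primitive a -> primitive b ->
    positive_smooth (Vcov a `&` Vcov b) (hab a b);
  ha_smooth : forall a g, primitive a -> ISL3 g ->
    positive_smooth (Vcov a) (ha a g);
  hab_inv : forall a b, primitive a -> primitive b ->
    forall y, (Vcov a `&` Vcov b) y -> hab a b y * hab b a y = 1;
  habc : forall a b c, primitive a -> primitive b -> primitive c ->
    forall y, (Vcov a `&` Vcov b `&` Vcov c) y ->
    (hab a b y * hab b c y * hab c a y)%:C%C = `|phi_abc phi a b c y| ^- 2;
  hab_g : forall a b g, primitive a -> primitive b -> ISL3 g ->
    forall y, (Vcov a `&` Vcov b) y ->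
    let g' := ISL3_inv g in
    (hab (ISL3_actL g' a) (ISL3_actL g' b) (ISL3_act g' y) * ha b g y)%:C%C
    = `|phi_ab phi a b g y| ^+ 2 * (ha a g y * hab a b y)%:C%C;
  ha_gg : forall a g1 g2, primitive a -> ISL3 g1 -> ISL3 g2 ->
    forall y, Vcov a y ->
    let g1' := ISL3_inv g1 in
    (ha a (ISL3_mul g1 g2) y)%:C%C
    = `|phi_a phi a g1 g2 y| ^+ 2
      * (ha a g1 y * ha (ISL3_actL g1' a) g2 (ISL3_act g1' y))%:C%C
}.

End Space.

(* Main.v *)
Require Import Defs.
From mathcomp Require Import all_boot all_order all_algebra finmap.
From mathcomp Require Import complex ring lra zify.
From mathcomp Require Import all_classical all_reals all_analysis.

(* In coordinates adapted to a pair (a, b), |Gamma_{a,b}|^2 h_{a,b} is a product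
   over a cone of a rank 2 lattice times a product over a box at its vertex.
   Moving one wall of the cone multiplies it by |theta_0|^2 h_2, and moving the
   vertex by a lattice vector amounts to translating w; this gives the
   transformation law under G at generic w, and at all w by continuity, once
   |theta_0|^2 h_2 is known not to depend on the oriented basis of H(a). The
   quotient of the functions attached to two bases is |phi_a|^2 times the
   exponential of a real quadratic polynomial in w; it is doubly periodic, hence
   constant by the maximum principle, and the distribution relation over the
   2-torsion points shows that the constant is 1. In the same way
   D = |phi_{a,b,c}|^2 h_{a,b} h_{b,c} h_{c,a} is invariant under the lattice by
   the transformation law, hence constant in w, and D(-w) D(w) = 1 by the
   reflection of the cones. *)

Set Implicit Arguments.
Unset Strict Implicit.
Unset Printing Implicit Defensive.

Import Order.TTheory GRing.Theory Num.Theory.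
Import numFieldNormedType.Exports.

Local Open Scope classical_set_scope.
Local Open Scope ring_scope.

Import Normc.

Local Notation Re := complex.Re.
Local Notation Im := complex.Im.

(** * Goursat's theorem *)

(** The cocycle is never computed: neither the modular transformation of theta_0 nor an explicit
    formula for phi_{a,b,c} is used. The hypotheses give [phi] as nowhere vanishing holomorphic
    functions, tied to the gamma and theta products only where these are defined. For fixed x the
    exceptional w lie in the set of all mu(x), a countable subgroup of C that in general has rank 3
    and is not discrete; passing across it therefore rests on countability, not on isolated
    singularities. Since the exponents of h_2 and h_3 are polynomials of degree 2 and 3 in the
    imaginary part of w / gamma(x), the mean value property of entire functions on circles is the
    one fact of complex analysis that is needed, and it is derived here from Goursat's argument. The
    constants left undetermined by it are fixed by exact functional equations; these hold because
    the coefficients in h_2 and R_3 are those of Bernoulli polynomials. *)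

Section Primitives.
Variable R : realType.
Implicit Types (f g F : R -> R).

Lemma is_derive_derive1 F x l : derivable F x 1 -> (F^`())%classic x = l ->
  is_derive x 1 F l.
Proof. by move=> dF <-; apply: DeriveDef => //; rewrite derive1E. Qed.

(** The derivative is claimed only to the right of the base point, so each use starts the integral
    one unit before the interval of interest. *)
Lemma continuous_primitive f (a : R) : continuous f ->
  exists F, forall x, a < x -> is_derive x 1 F (f x).
Proof.
move=> fc.
exists (fun x => \int[lebesgue_measure]_(t in [set` `[a, x]]) f t).
move=> x ax.
have xx1 : x < x + 1 by rewrite ltrDl.
have int : lebesgue_measure.-integrable `[a, x + 1] (EFin \o f).
  apply: (@continuous_compact_integrable R f); first exact: segment_compact.
  exact: continuous_subspaceT.
have [d e] := continuous_FTC1_closed xx1 int ax (fc x).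
exact: is_derive_derive1 d e.
Qed.

Lemma is_derive_segment_continuous F f (a b : R) :
  (forall x, a <= x <= b -> is_derive x 1 F (f x)) ->
  {within `[a, b], continuous F}.
Proof.
move=> dF; apply: derivable_within_continuous => x.
by rewrite in_itv /= => /dF; case.
Qed.

Lemma primitive_eq F G f (a b : R) : a <= b ->
  (forall x, a <= x <= b -> is_derive x 1 F (f x)) ->
  (forall x, a <= x <= b -> is_derive x 1 G (f x)) ->
  F b - F a = G b - G a.
Proof.
move=> ab dF dG.
have dFG x : a <= x <= b -> is_derive x 1 (F - G) (f x - f x).
  by move=> xab; apply: is_deriveB; [exact: dF|exact: dG].
have [||c _] := @MVT_segment R (F - G) (fun x => f x - f x) a b ab.
- by move=> x /itvP h; apply: dFG; rewrite !h.
- exact: (@is_derive_segment_continuous (F - G) (fun x => f x - f x)).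
- by rewrite subrr mul0r !fctE => ?; lra.
Qed.

(** The mean value theorem for [F - G]. It compares integrals over opposite sides of a rectangle,
    [c] being the constant by which the linear parts of the integrands differ; with [G] constant it
    also bounds a mean. *)
Lemma primitive_diff_bound F G f g (a b c M : R) : a <= b ->
  (forall x, a <= x <= b -> is_derive x 1 F (f x)) ->
  (forall x, a <= x <= b -> is_derive x 1 G (g x)) ->
  (forall x, a <= x <= b -> `|f x - g x - c| <= M) ->
  `|(F b - F a) - (G b - G a) - c * (b - a)| <= M * (b - a).
Proof.
move=> ab dF dG fgM.
have dFG x : a <= x <= b -> is_derive x 1 (F - G) (f x - g x).
  by move=> xab; apply: is_deriveB; [exact: dF|exact: dG].
have [||d dab] := @MVT_segment R (F - G) (fun x => f x - g x) a b ab.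
- by move=> x /itvP h; apply: dFG; rewrite !h.
- exact: (@is_derive_segment_continuous (F - G) (fun x => f x - g x)).
rewrite !fctE => E.
have -> : F b - F a - (G b - G a) - c * (b - a) = (f d - g d - c) * (b - a).
  by rewrite mulrBl -E; ring.
rewrite normrM (ger0_norm (x := b - a)) ?subr_ge0//.
by apply: ler_wpM2r; rewrite ?subr_ge0// fgM// !(itvP dab).
Qed.

(** [m * x - F x] is nondecreasing with equal values at both ends, hence constant, and its
    derivative [m - f x] vanishes inside. *)
Lemma primitive_extremal F f (a b m : R) :
  (forall x, a <= x <= b -> is_derive x 1 F (f x)) ->
  (forall x, a <= x <= b -> f x <= m) ->
  F b - F a = m * (b - a) ->
  forall x, a < x < b -> f x = m.
Proof.
move=> dF fm Fab.
pose G := fun x => m * x - F x.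
have dG x : a <= x <= b -> is_derive x 1 G (m - f x).
  move=> xab; have := dF _ xab => ?.
  by apply: is_deriveB => //; apply: is_derive_eq; rewrite /GRing.scale /= mulr1.
have Gmono x y : a <= x -> x <= y -> y <= b -> G x <= G y.
  move=> ax xy yb.
  have [||d dxy] := @MVT_segment R G (fun x => m - f x) x y xy.
  - by move=> z /itvP h; apply: dG; rewrite (le_trans ax) ?h// (le_trans _ yb) ?h.
  - apply: (@is_derive_segment_continuous G (fun x => m - f x)) => z /andP[h k].
    by apply: dG; rewrite (le_trans ax) ?h// (le_trans _ yb) ?k.
  have dab : a <= d <= b.
    by rewrite (le_trans ax) ?(itvP dxy)// (le_trans _ yb) ?(itvP dxy).
  rewrite -subr_ge0 => ->; apply: mulr_ge0; last by rewrite subr_ge0.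
  by rewrite subr_ge0 fm.
have Gab : G b = G a by rewrite /G; move: Fab; lra.
move=> x /andP[ax xb].
have xab : a <= x <= b by rewrite !ltW.
have Gc y : a <= y <= b -> G y = G a.
  move=> /andP[ay yb]; apply/eqP; rewrite eq_le (Gmono a)// andbT -Gab.
  exact: Gmono.
have nG : \near x, cst (G a) x = G x.
  near=> y; rewrite /cst Gc//; apply/andP; split; apply: ltW; near: y.
  - exact: lt_nbhsr.
  - exact: lt_nbhsl.
have d0 : is_derive x 1 G 0.
  by apply: near_eq_is_derive nG _; exact: is_derive_cst.
have := @derive_val _ _ _ _ _ _ _ d0.
rewrite (@derive_val _ _ _ _ _ _ _ (dG _ xab)) => /eqP.
by rewrite subr_eq0 => /eqP.
Unshelve. all: by end_near. Qed.
End Primitives.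

Section Goursat.
Variable R : realType.

Definition ddiff (E : R -> R -> R) (a b c d : R) : R :=
  E b d - E b c - E a d + E a c.

Section Bisection.
Variable E : R -> R -> R.

Let rect : Type := (R * R * (R * R))%type.
Let ddr (r : rect) := `|ddiff E r.1.1 r.1.2 r.2.1 r.2.2|.
Let mid (a b : R) := (a + b) / 2.

Definition bisect (r : rect) : rect :=
  let: (a, b, (c, d)) := r in let m := mid a b in let n := mid c d in
  if ddr r <= 4 * ddr (a, m, (c, n)) then (a, m, (c, n)) else
  if ddr r <= 4 * ddr (a, m, (n, d)) then (a, m, (n, d)) else
  if ddr r <= 4 * ddr (m, b, (c, n)) then (m, b, (c, n)) else (m, b, (n, d)).

(** The double differences of the four quarters add up to that of the rectangle, so one of them
    carries at least a quarter of it; if the first three tests fail it is the fourth, which [bisect]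
    takes by default. *)
Lemma bisect_ddiff r : ddr r <= 4 * ddr (bisect r).
Proof.
case: r => -[a b] [c d]; rewrite /bisect.
case: ifPn => // /negP/negP; rewrite -ltNge => h1.
case: ifPn => // /negP/negP; rewrite -ltNge => h2.
case: ifPn => // /negP/negP; rewrite -ltNge => h3.
rewrite leNgt; apply/negP => h4.
move: h1 h2 h3 h4; rewrite /ddr /ddiff /=.
set m := mid a b; set n := mid c d => h1 h2 h3 h4.
set t1 := (X in 4 * `|X| < _) in h1; set t2 := (X in 4 * `|X| < _) in h2.
set t3 := (X in 4 * `|X| < _) in h3; set t4 := (X in 4 * `|X| < _) in h4.
set t := (X in _ < `|X|) in h1.
have et : t = t1 + t2 + (t3 + t4) by rewrite /t /t1 /t2 /t3 /t4; ring.
have := ler_normD (t1 + t2) (t3 + t4); rewrite -et.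
have := ler_normD t1 t2; have := ler_normD t3 t4.
rewrite -/t in h2 h3 h4.
by lra.
Qed.

Variables (x0 x1 y0 y1 : R).
Hypotheses (x01 : x0 <= x1) (y01 : y0 <= y1).

Let rn n : rect := iter n bisect (x0, x1, (y0, y1)).

Lemma bisect_shape r : r.1.1 <= r.1.2 -> r.2.1 <= r.2.2 ->
  [/\ r.1.1 <= (bisect r).1.1, (bisect r).1.2 <= r.1.2,
      (bisect r).1.2 - (bisect r).1.1 = (r.1.2 - r.1.1) / 2 &
   [/\ r.2.1 <= (bisect r).2.1, (bisect r).2.2 <= r.2.2 &
      (bisect r).2.2 - (bisect r).2.1 = (r.2.2 - r.2.1) / 2]].
Proof.
by case: r => -[a b] [c d] /= ab cd; rewrite /bisect;
  (do 3? [case: ifP => _]); split => /=; rewrite /mid ?(lexx, subrr)//; try lra;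
  split; lra.
Qed.

Lemma rn_shape n :
  [/\ (rn n).1.2 - (rn n).1.1 = (x1 - x0) / 2 ^+ n,
      (rn n).2.2 - (rn n).2.1 = (y1 - y0) / 2 ^+ n,
      ddr (rn 0) <= 4 ^+ n * ddr (rn n) &
      (rn n).1.1 <= (rn n).1.2 /\ (rn n).2.1 <= (rn n).2.2].
Proof.
elim: n => [|n [e1 e2 h [l1 l2]]].
  by split; rewrite ?expr0 ?divr1 ?mul1r.
have [_ _ e1' [_ _ e2']] := bisect_shape l1 l2.
rewrite /rn iterS -/(rn n); split; rewrite ?e1' ?e2' ?e1 ?e2.
- by rewrite exprS invfM; ring.
- by rewrite exprS invfM; ring.
- rewrite (le_trans h)// exprSr -mulrA ler_pM2l ?exprn_gt0//.
  exact: bisect_ddiff.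
- split; rewrite -subr_ge0 ?e1' ?e2' divr_ge0// subr_ge0//.
Qed.

Lemma rn_mono n m : (n <= m)%N ->
  [/\ (rn n).1.1 <= (rn m).1.1, (rn m).1.2 <= (rn n).1.2,
      (rn n).2.1 <= (rn m).2.1 & (rn m).2.2 <= (rn n).2.2].
Proof.
move=> /subnK <-; elim: (m - n)%N => [|k [h1 h2 h3 h4]] //.
have [_ _ _ [l1 l2]] := rn_shape (k + n).
have [k1 k2 _ [k3 k4 _]] := bisect_shape l1 l2.
rewrite addSn /rn iterS -/(rn (k + n)).
by split; [exact: le_trans k1|exact: le_trans h2|exact: le_trans k3|exact: le_trans h4].
Qed.

Lemma nested_point (a b : nat -> R) : (forall n, a n <= b n) ->
  (forall n m, (n <= m)%N -> a n <= a m /\ b m <= b n) ->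
  exists p, forall n, a n <= p <= b n.
Proof.
move=> ab mono.
have abnm n m : a n <= b m.
  have [h1 _] := mono _ _ (leq_maxl n m); have [_ h2] := mono _ _ (leq_maxr n m).
  exact: le_trans h1 (le_trans (ab _) h2).
have ne : range a !=set0 by exists (a 0%N), 0%N.
have hs : has_sup (range a).
  by split => //; exists (b 0%N) => _ [n _ <-].
exists (sup (range a)) => n; apply/andP; split.
  by apply: sup_ubound; [case: hs|exists n].
by apply: ge_sup => // _ [m _ <-].
Qed.

Lemma pow2_small (L e : R) : 0 < e -> exists n, L / 2 ^+ n < e.
Proof.
move=> e0; exists (Num.bound (`|L| / e)).
rewrite ltr_pdivrMr ?exprn_gt0// (le_lt_trans (ler_norm _))// mulrC.
rewrite -ltr_pdivrMr// (lt_trans (archi_boundP _)) ?divr_ge0 ?(ltW e0)//.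
by rewrite -natrX ltr_nat ltn_expl.
Qed.

(** After [n] bisections the double difference is at least [4 ^- n] times the original in absolute
    value, while the local bound at the common point of the nested rectangles allows at most e L^2 /
    4^n, with [L] the half-perimeter; [e] is arbitrary. *)
Lemma ddiff_locally_small_eq0 :
  (forall p q, x0 <= p <= x1 -> y0 <= q <= y1 -> forall e, 0 < e ->
    exists2 dl, 0 < dl & forall a b c d,
      x0 <= a -> a <= p <= b -> b <= x1 -> y0 <= c -> c <= q <= d -> d <= y1 ->
      b - a < dl -> d - c < dl ->
      `|ddiff E a b c d| <= e * (b - a + (d - c)) ^+ 2) ->
  ddiff E x0 x1 y0 y1 = 0.
Proof.
move=> H.
have [|n m nm|p hp] := @nested_point (fun n => (rn n).1.1) (fun n => (rn n).1.2).
- by move=> n; have [_ _ _ []] := rn_shape n.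
- by have [] := rn_mono nm.
have [|n m nm|q hq] := @nested_point (fun n => (rn n).2.1) (fun n => (rn n).2.2).
- by move=> n; have [_ _ _ []] := rn_shape n.
- by have [] := rn_mono nm.
have := H p q (hp 0%N) (hq 0%N) => {}H.
set L := x1 - x0 + (y1 - y0).
have L0 : 0 <= L by rewrite addr_ge0 ?subr_ge0.
suff : forall e, 0 < e -> ddr (rn 0) <= e * L ^+ 2.
  move=> he; apply/eqP; rewrite -normr_eq0 -/(ddr (rn 0)) eq_le normr_ge0 andbT.
  apply/ler_addgt0Pr => e e0; rewrite add0r.
  have L20 : 0 < L ^+ 2 + 1 by rewrite ltr_wpDl ?sqr_ge0.
  apply: le_trans (he (e / (L ^+ 2 + 1)) _) _; first by rewrite divr_gt0.
  by rewrite mulrAC ler_pdivrMr// ler_pM2l// lerDl.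
move=> e /H [dl dl0 {}H].
have [n hn] := pow2_small L dl0.
have [e1 e2 h [l1 l2]] := rn_shape n.
have [m1 m2 m3 m4] := rn_mono (leq0n n).
have sm x : 0 <= x -> x <= L -> x / 2 ^+ n < dl.
  by move=> x0' xL; apply: le_lt_trans hn; rewrite ler_pM2r ?invr_gt0 ?exprn_gt0.
have := H _ _ _ _ m1 (hp n) m2 m3 (hq n) m4.
rewrite e1 e2 => /(_ (sm _ _ _) (sm _ _ _)) h'.
apply: (le_trans h).
rewrite -(ler_pM2l (x := (4 ^+ n)^-1)) ?invr_gt0 ?exprn_gt0// mulKf; last first.
  by rewrite gt_eqF// exprn_gt0.
apply: (le_trans (h' _ _ _ _)); rewrite ?subr_ge0// ?lerDl ?lerDr ?subr_ge0//.
rewrite -mulrDl -/L exprMn exprVn -exprM mulnC exprM.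
have -> : 2 ^+ 2 = 4 :> R by ring.
by rewrite le_eqVlt; apply/orP; left; apply/eqP; rewrite -exprVn; ring.
Qed.

End Bisection.

Definition real_diff (U : R -> R -> R) (p q a b : R) : Prop :=
  forall e, 0 < e -> exists2 dl, 0 < dl & forall h k, `|h| < dl -> `|k| < dl ->
    `|U (p + h) (q + k) - U p q - (a * h + b * k)| <= e * (`|h| + `|k|).

Lemma real_diff_continuousr U p q a b : real_diff U p q a b ->
  {for q, continuous (U p)}.
Proof.
move=> /(_ 1 ltr01) [dl dl0 H].
apply/(@cvgrPdist_le _ R^o) => e e0.
have b0 : 0 < `|b| + 1 by rewrite ltr_wpDl.
near=> y.
have ydl : `|y - q| < Num.min dl (e / (`|b| + 1)).
  near: y; apply: (@cvgr_distC_lt _ _ _ (nbhs q) _ id) => //.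
  by rewrite lt_min dl0 divr_gt0.
move: ydl; rewrite lt_min => /andP[y1 y2].
have := H 0 (y - q); rewrite normr0 addr0 mulr0 !add0r mul1r => h.
have {h} := h dl0 y1; have -> : q + (y - q) = y by ring.
move=> h; rewrite distrC (le_trans (y := `|b * (y - q)| + `|y - q|))//.
  have := ler_normD (U p y - U p q - b * (y - q)) (b * (y - q)).
  by rewrite subrK; lra.
rewrite normrM; have -> : `|b| * `|y - q| + `|y - q| = `|y - q| * (`|b| + 1) by ring.
by rewrite -ler_pdivlMr// ltW.
Unshelve. all: by end_near. Qed.

Lemma real_diff_swap U p q a b : real_diff U p q a b ->
  real_diff (fun y x => U x y) q p b a.
Proof.
move=> H e /H [dl dl0 {}H]; exists dl => // h k hh hk.
by have := H k h hk hh; rewrite (addrC (a * k)) (addrC `|k|).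
Qed.

Lemma real_diff_corner (U : R -> R -> R) (p q al b e dl x y w w' : R) :
  (forall h k, `|h| < dl -> `|k| < dl ->
    `|U (p + h) (q + k) - U p q - (al * h + b * k)| <= e * (`|h| + `|k|)) ->
  0 < e -> `|x - p| <= w -> `|y - q| <= w' -> w < dl -> w' < dl ->
  `|U x y - U p q - (al * (x - p) + b * (y - q))| <= e * (w + w').
Proof.
move=> H e0 xw yw wd wd'.
have := H (x - p) (y - q) (le_lt_trans xw wd) (le_lt_trans yw wd').
have -> : p + (x - p) = x by ring.
have -> : q + (y - q) = y by ring.
move=> h; apply: (le_trans h); rewrite ler_pM2l//; exact: lerD.
Qed.

(* Green's theorem for the form V dx + U dy, closed because dV/dy = dU/dx:
   this is Goursat's argument, with the line integrals expressed by
   primitives so that the integral over the boundary of a rectangle is a double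
   difference. *)
Lemma closed_form_rectangle (U V : R -> R -> R) (A B : R -> R -> R)
    (x0 x1 y0 y1 : R) : x0 <= x1 -> y0 <= y1 ->
  (forall p q, exists a b c, real_diff U p q a b /\ real_diff V p q c a) ->
  (forall y x, x0 <= x -> is_derive x 1 (A y) (V x y)) ->
  (forall x y, y0 <= y -> is_derive y 1 (B x) (U x y)) ->
  (B x1 y1 - B x1 y0) - (B x0 y1 - B x0 y0) =
  (A y1 x1 - A y1 x0) - (A y0 x1 - A y0 x0).
Proof.
move=> x01 y01 dUV dA dB.
suff : ddiff (fun x y => B x y - A y x) x0 x1 y0 y1 = 0.
  by rewrite /ddiff; lra.
apply: ddiff_locally_small_eq0 => // p q hp hq e e0.
have [al [b [c [dU dV]]]] := dUV p q.
have e20 : 0 < e / 2 by rewrite divr_gt0.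
have [d1 d10 H1] := dU _ e20; have [d2 d20 H2] := dV _ e20.
exists (Num.min d1 d2); first by rewrite lt_min d10.
move=> a1 b1 c1 e1 xa /andP[ap pb] bx yc /andP[cq qd] dy.
rewrite !lt_min => /andP[w1 w2] /andP[w1' w2'].
set w := b1 - a1; set w' := e1 - c1.
have ab : a1 <= b1 by apply: le_trans pb.
have cd : c1 <= e1 by apply: le_trans qd.
have dx x : a1 <= x <= b1 -> `|x - p| <= w.
  by move=> /andP[h1 h2]; rewrite ler_norml /w; apply/andP; split; lra.
have dy' y : c1 <= y <= e1 -> `|y - q| <= w'.
  by move=> /andP[h1 h2]; rewrite ler_norml /w'; apply/andP; split; lra.
have hV y x : c1 <= y <= e1 -> a1 <= x <= b1 ->
    `|V x y - V p q - (c * (x - p) + al * (y - q))| <= e / 2 * (w + w').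
  by move=> hy hx; apply: real_diff_corner H2 _ _ _ _ _ => //; auto.
have hU y x : c1 <= y <= e1 -> a1 <= x <= b1 ->
    `|U x y - U p q - (al * (x - p) + b * (y - q))| <= e / 2 * (w + w').
  by move=> hy hx; apply: real_diff_corner H1 _ _ _ _ _ => //; auto.
have c1i : c1 <= c1 <= e1 by rewrite lexx.
have e1i : c1 <= e1 <= e1 by rewrite lexx andbT.
have a1i : a1 <= a1 <= b1 by rewrite lexx.
have b1i : a1 <= b1 <= b1 by rewrite lexx andbT.
(* The linear parts of [V] on the bottom and top sides differ by the constant [- (al * w')], those
   of [U] on the right and left sides by [al * w]; the two contributions cancel. Each comparison
   collects two errors, hence the choice of [e / 2] for one. *)
have KA : `|(A c1 b1 - A c1 a1) - (A e1 b1 - A e1 a1) - (- (al * w')) * w| <=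
    e * (w + w') * w.
  apply: (@primitive_diff_bound R _ _ (fun x => V x c1) (fun x => V x e1)) => //.
  - by move=> x /andP[h _]; apply: dA; exact: le_trans h.
  - by move=> x /andP[h _]; apply: dA; exact: le_trans h.
  - move=> x hx; have := hV _ _ c1i hx; have := hV _ _ e1i hx.
    set X := V x c1; set Y := V x e1; rewrite !ler_norml /w' => /andP[? ?] /andP[? ?].
    by apply/andP; split; lra.
have KB : `|(B b1 e1 - B b1 c1) - (B a1 e1 - B a1 c1) - (al * w) * w'| <=
    e * (w + w') * w'.
  apply: (@primitive_diff_bound R _ _ (U b1) (U a1)) => //.
  - by move=> x /andP[h _]; apply: dB; exact: le_trans h.
  - by move=> x /andP[h _]; apply: dB; exact: le_trans h.
  - move=> y hy; have := hU _ _ hy b1i; have := hU _ _ hy a1i.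
    rewrite !ler_norml /w => /andP[? ?] /andP[? ?].
    by apply/andP; split; lra.
rewrite /ddiff -/w -/w'.
have -> : e * (w + w') ^+ 2 = e * (w + w') * w + e * (w + w') * w' by ring.
apply: le_trans (lerD KA KB); apply: le_trans (ler_normD _ _).
by rewrite le_eqVlt; apply/orP; left; apply/eqP; congr (`|_|); ring.
Qed.

End Goursat.

(** * Modulus and complex differentiability in real terms *)

Section ComplexModulus.
Variable R : realType.
Local Notation C := R[i].
Implicit Types (x y z : C).

Lemma normcE z : `|z| = (normc z)%:C%C.
Proof. by []. Qed.

Lemma normc_sqr z : normc z ^+ 2 = Re z ^+ 2 + Im z ^+ 2.
Proof. by case: z => a b /=; rewrite sqr_sqrtr// addr_ge0 ?sqr_ge0. Qed.

Lemma normc_ge0 z : 0 <= normc z.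
Proof. by case: z => a b; rewrite sqrtr_ge0. Qed.

Lemma normc_gt0 (z : C) : z != 0 -> 0 < normc z.
Proof.
move=> z0; rewrite lt_def normc_ge0 andbT; apply: contra z0 => /eqP/eq0_normc ->.
by [].
Qed.

Lemma Re_le_normc z : `|Re z| <= normc z.
Proof.
case: z => a b /=; rewrite -sqrtr_sqr ler_sqrt ?addr_ge0 ?sqr_ge0//.
by rewrite lerDl sqr_ge0.
Qed.

Lemma Im_le_normc z : `|Im z| <= normc z.
Proof.
case: z => a b /=; rewrite -sqrtr_sqr ler_sqrt ?addr_ge0 ?sqr_ge0//.
by rewrite lerDr sqr_ge0.
Qed.

Lemma normc_real (a : R) : normc a%:C%C = `|a|.
Proof. by rewrite /= expr0n addr0 sqrtr_sqr. Qed.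

Lemma normc_imag (a : R) : normc (0 +i* a)%C = `|a|.
Proof. by rewrite /= expr0n add0r sqrtr_sqr. Qed.

Lemma normc_le_ReIm (a b : R) : normc (a +i* b)%C <= `|a| + `|b|.
Proof.
have -> : (a +i* b)%C = a%:C%C + (0 +i* b)%C by simpc.
by apply: le_trans (le_normcD _ _) _; rewrite normc_real normc_imag.
Qed.

Lemma nbhs_normcP (z : C) (P : set C) : nbhs z P <->
  exists2 d : R, 0 < d & forall w, normc (w - z) < d -> P w.
Proof.
split=> [/nbhs_ballP[e /= e0 eP]|[d d0 dP]].
- have eE : e = (Re e)%:C%C by rewrite RRe_real// gtr0_real.
  exists (Re e); first by rewrite -ltcR -eE.
  move=> w wz; apply: eP; rewrite -ball_normE /ball_/= distrC normcE eE.
  by rewrite ltcR.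
- apply/nbhs_ballP; exists d%:C%C => /=; first by rewrite ltcR.
  by move=> w; rewrite -ball_normE /ball_/= distrC normcE ltcR; exact: dP.
Qed.

Lemma derivable_normc (f : C -> C) z : derivable f z 1 ->
  exists l, forall e : R, 0 < e -> exists2 d : R, 0 < d &
    forall h, normc h < d -> normc (f (z + h) - f z - l * h) <= e * normc h.
Proof.
move=> df; exists ('D_1 f z) => e e0.
have /eqaddoP E := derivable_nbhs df.
have e0' : 0 < e%:C%C by rewrite ltcR.
have /nbhs_normcP[d d0 H] := E _ e0'.
exists d => // h hd; have := H h; rewrite subr0 => /(_ hd) /=.
rewrite !fctE /= !normcE -rmorphM lecR /= /GRing.scale /= mulr1 (addrC h z).
by rewrite opprD addrA (mulrC h).
Qed.

Lemma normc_is_derive (f : C -> C) (z l : C) :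
  (forall e : R, 0 < e -> exists2 d : R, 0 < d &
    forall h : C, normc h < d -> normc (f (z + h) - f z - l * h) <= e * normc h) ->
  is_derive z 1 f l.
Proof.
move=> H.
have K : (fun h => h^-1 *: ((f \o shift z) (h *: 1) - f z)) @ (0 : C)^' --> l.
  apply/cvgrPdist_le => e e0.
  have eE : e = (Re e)%:C%C by rewrite RRe_real// gtr0_real.
  have e0' : 0 < Re e by rewrite -ltcR -eE.
  have [d d0 {}H] := H _ e0'.
  apply/nbhs_normcP; exists d => // h; rewrite subr0 => hd h0.
  rewrite eE normcE lecR /= /GRing.scale /= mulr1 -normcN opprB.
  have -> : h^-1 * (f (h + z) - f z) - l = h^-1 * (f (z + h) - f z - l * h).
    by rewrite (addrC h z) [in RHS]mulrBr [X in _ = _ - X]mulrCA mulVf// mulr1.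
  rewrite normcM normcV mulrC ler_pdivrMr ?H//.
  rewrite lt_def normc_ge0 andbT; apply/negP => /eqP/eq0_normc h0'.
  by rewrite h0' eqxx in h0.
have dE : 'D_1 f z = l by apply/cvg_lim => //; exact: norm_hausdorff.
have df : derivable f z 1 by apply/cvg_ex; exists l.
exact: DeriveDef df dE.
Qed.

Lemma normc_continuous : continuous (@normc R : C -> R).
Proof.
move=> z; apply/(@cvgrPdist_lt _ R^o _ (nbhs z) (nbhs_filter z)) => e e0.
apply/nbhs_normcP; exists e => // w wz /=.
apply: le_lt_trans wz; rewrite -(normcN (w - z)) opprB.
have h1 := le_normcD (z - w) w; have h2 := le_normcD (w - z) z.
rewrite !subrK in h1 h2; move: h2; rewrite -(normcN (w - z)) opprB => h2.
by rewrite ler_norml; apply/andP; split; lra.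
Qed.

Lemma Re_continuous : continuous (@complex.Re R : C -> R).
Proof.
move=> z; apply/(@cvgrPdist_lt _ R^o _ (nbhs z) (nbhs_filter z)) => e e0.
apply/nbhs_normcP; exists e => // w wz /=.
apply: le_lt_trans wz; rewrite -(normcN (w - z)) opprB.
by apply: le_trans (Re_le_normc _); case: (z) (w) => [? ?] [? ?].
Qed.

Lemma Im_continuous : continuous (@complex.Im R : C -> R).
Proof.
move=> z; apply/(@cvgrPdist_lt _ R^o _ (nbhs z) (nbhs_filter z)) => e e0.
apply/nbhs_normcP; exists e => // w wz /=.
apply: le_lt_trans wz; rewrite -(normcN (w - z)) opprB.
by apply: le_trans (Im_le_normc _); case: (z) (w) => [? ?] [? ?].
Qed.

(** If [l] is the derivative, Re g has gradient (Re l, - Im l) and Im g has gradient (Im l, Re l).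
    The repeated [a] is the Cauchy-Riemann equation that makes the form Im g dx + Re g dy closed. *)
Lemma complex_real_diff (g : C -> C) (p q : R) : derivable g (p +i* q)%C 1 ->
  exists a b c : R,
    @real_diff R (fun x y : R => Re (g (x +i* y)%C)) p q a b /\
    @real_diff R (fun x y : R => Im (g (x +i* y)%C)) p q c a.
Proof.
move=> /derivable_normc[l H]; exists (Re l), (- Im l), (Im l).
suff K : forall e : R, 0 < e -> exists2 dl, 0 < dl & forall h k : R,
    `|h| < dl -> `|k| < dl ->
    normc (g ((p + h) +i* (q + k))%C - g (p +i* q)%C - l * (h +i* k)%C)
      <= e * (`|h| + `|k|).
  split=> e /K[dl dl0 {}K]; exists dl => // h k hh hk.
  - apply: le_trans (K h k hh hk); apply: le_trans (Re_le_normc _).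
    case: (g _) (g _) (l) => [? ?] [? ?] [? ?] /=.
    by rewrite le_eqVlt; apply/orP; left; apply/eqP; congr `|_|; ring.
  - apply: le_trans (K h k hh hk); apply: le_trans (Im_le_normc _).
    case: (g _) (g _) (l) => [? ?] [? ?] [? ?] /=.
    by rewrite le_eqVlt; apply/orP; left; apply/eqP; congr `|_|; ring.
move=> e e0; have [d d0 {}H] := H e e0; exists (d / 2); first by rewrite divr_gt0.
move=> h k hd kd.
have hk : normc (h +i* k)%C <= `|h| + `|k| by exact: normc_le_ReIm.
have := H (h +i* k)%C; rewrite (le_lt_trans hk); last by lra.
have -> : (p +i* q)%C + (h +i* k)%C = ((p + h) +i* (q + k))%C by simpc.
by move=> /(_ isT) h'; apply: (le_trans h'); rewrite ler_pM2l.
Qed.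

End ComplexModulus.

(** * The complex exponential *)

Section ComplexExponential.
Variable R : realType.
Local Notation C := R[i].
Implicit Types (x y z : C).

Lemma cexpD z w : cexp (z + w) = cexp z * cexp w :> C.
Proof.
case: z w => [a b] [c d]; rewrite /cexp /= expRD cosD sinD.
by simpc; congr (_ +i* _)%C; ring.
Qed.

Lemma cexp0 : cexp 0 = 1 :> C.
Proof. by rewrite /cexp /= expR0 cos0 sin0 mul1r. Qed.

Lemma normc_cexp z : normc (cexp z) = expR (Re z).
Proof.
rewrite /cexp normcM normc_real ger0_norm ?expR_ge0//=.
by rewrite cos2Dsin2 sqrtr1 mulr1.
Qed.

Lemma cexp_neq0 z : cexp z != 0.
Proof.
apply/eqP => /(congr1 (@normc R)); rewrite normc_cexp normc0 => /eqP.
by rewrite gt_eqF// expR_gt0.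
Qed.

Lemma is_derive_small (f : R -> R) (l : R) : is_derive (0 : R) 1 f l ->
  forall e : R, 0 < e -> exists2 d : R, 0 < d &
    forall h, `|h| < d -> `|f h - f 0 - l * h| <= e * `|h|.
Proof.
move=> [df dl] e e0.
have /eqaddoP E := derivable_nbhs df.
have /nbhs_ballP[d /= d0 H] := E _ e0.
exists d => // h hd; have := H h; rewrite /ball/= sub0r normrN => /(_ hd) /=.
by rewrite !fctE /= /shift /= dl /GRing.scale /= mulr1 addr0 opprD addrA (mulrC h).
Qed.

(** The addition formula reduces the claim to an estimate of [cexp h - 1 - h], which follows from
    the derivatives at 0 of the real exponential, cosine and sine. *)
Lemma is_derive_cexp z : is_derive z 1 (@cexp R) (cexp z).
Proof.
suff K : forall e : R, 0 < e -> exists2 d : R, 0 < d &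
    forall h : C, normc h < d -> normc (cexp h - 1 - h) <= e * normc h.
  apply: normc_is_derive => e e0.
  have n0 : 0 < normc (cexp z) by rewrite normc_cexp expR_gt0.
  have [d d0 {}K] := K (e / normc (cexp z)) (divr_gt0 e0 n0).
  exists d => // h /K; rewrite mulrAC ler_pdivlMr// => K'.
  rewrite cexpD; apply: le_trans K'; rewrite -normcM.
  by rewrite le_eqVlt; apply/orP; left; apply/eqP; congr normc; ring.
move=> e e0.
(* The four error terms [k1] to [k4] are at most 2, 2, 1 and 1 times [e1 * N], hence the 6; the
   bound by 1 serves to get [E <= 2]. *)
pose e1 := Num.min (e / 6) 1.
have e10 : 0 < e1 by rewrite lt_min divr_gt0//=.
have e11 : e1 <= 1 by rewrite ge_min lexx orbT.
have e16 : 6 * e1 <= e by rewrite -ler_pdivlMl// mulrC ge_min lexx.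
have [d1 d10 Hexp] := is_derive_small (is_derive_expR (0 : R)) e10.
have [d2 d20 Hcos] := is_derive_small (is_derive_cos (0 : R)) e10.
have [d3 d30 Hsin] := is_derive_small (is_derive_sin (0 : R)) e10.
pose d := Num.min (Num.min d1 d2) (Num.min d3 (e1 / 2)).
exists d; first by rewrite !lt_min d10 d20 d30 divr_gt0.
case=> a b hd; have a1 := Re_le_normc (a +i* b)%C; have b1 := Im_le_normc (a +i* b)%C.
move: (normc _) hd a1 b1 => N hd /= a1 b1.
move: hd; rewrite !lt_min => /andP[/andP[Nd1 Nd2] /andP[Nd3 Ne1]].
have := Hexp a (le_lt_trans a1 Nd1); have := Hcos b (le_lt_trans b1 Nd2).
have := Hsin b (le_lt_trans b1 Nd3).
rewrite cos0 sin0 oppr0 expR0 mul0r !subr0 !mul1r ?addr0 => hs hc he.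
rewrite /cexp /=; simpc.
set E := expR a in he *; set c := cos b in hc *; set si := sin b in hs *.
have E2 : `|E - 1| <= e1.
  have := ler_normD (E - 1 - a) a; rewrite subrK.
  have : e1 * `|a| <= `|a| by rewrite ler_piMl.
  by lra.
have E3 : `|E| <= 2.
  by have := ler_normD (E - 1) 1; rewrite subrK normr1; lra.
apply: le_trans (normc_le_ReIm _ _) _.
have -> : E * c - 1 - a = E * (c - 1) + (E - 1 - a) by ring.
have -> : E * si - b = E * (si - b) + (E - 1) * b by ring.
have k1 : `|E * (c - 1)| <= 2 * (e1 * N).
  rewrite normrM ler_pM// (le_trans hc)// ler_pM2l//.
have k2 : `|E * (si - b)| <= 2 * (e1 * N).
  rewrite normrM ler_pM// (le_trans hs)// ler_pM2l//.
have k3 : `|(E - 1) * b| <= e1 * N by rewrite normrM ler_pM.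
have k4 : `|E - 1 - a| <= e1 * N by rewrite (le_trans he)// ler_pM2l.
have k5 : 6 * e1 * N <= e * N by rewrite ler_wpM2r// (le_trans _ a1).
have := ler_normD (E * (c - 1)) (E - 1 - a).
have := ler_normD (E * (si - b)) ((E - 1) * b).
by lra.
Qed.

End ComplexExponential.

(** * Maximum principle *)

Section MaximumPrinciple.
Variable R : realType.
Local Notation C := R[i].
Implicit Types (f : C -> C) (w z : C).

Lemma derivable_compC f g z : derivable g z 1 -> derivable f (g z) 1 ->
  derivable (f \o g) z 1.
Proof.
move=> /derivable1_diffP dg /derivable1_diffP df; apply/derivable1_diffP.
exact: (differentiable_comp dg df).
Qed.

Lemma derivable_cexp f z : derivable f z 1 ->
  derivable (fun w => cexp (f w)) z 1.
Proof.
move=> df; have [dc _] := is_derive_cexp (f z).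
exact: (derivable_compC df dc).
Qed.

Lemma derivable_mulC f g z : derivable f z 1 -> derivable g z 1 ->
  derivable (fun w => f w * g w) z 1.
Proof. exact: derivableM. Qed.

Lemma derivable_addC f g z : derivable f z 1 -> derivable g z 1 ->
  derivable (fun w => f w + g w) z 1.
Proof. exact: derivableD. Qed.

Lemma derivable_cstC (c z : C) : derivable (fun=> c) z 1.
Proof. exact: derivable_cst. Qed.

Lemma derivable_idC z : derivable (fun w : C => w) z 1.
Proof. exact: derivable_id. Qed.

Lemma derivable_continuousC f z : derivable f z 1 -> {for z, continuous f}.
Proof. by move=> /derivable1_diffP/differentiable_continuous. Qed.

Lemma continuous_normc f z : {for z, continuous f} ->
  forall e : R, 0 < e -> exists2 d : R, 0 < d &
    forall w, normc (w - z) < d -> normc (f w - f z) < e.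
Proof.
move=> cf e e0; have H : nbhs (f z) [set u | normc (u - f z) < e].
  by apply/nbhs_normcP; exists e.
by have /nbhs_normcP := cf _ H.
Qed.

Lemma polar_form (u : C) (r : R) : 0 < r -> normc u = r ->
  exists t : R, u = cexp (ln r +i* (2 * pi * t))%C.
Proof.
case: u => x y r0 ur.
have h2 : x ^+ 2 + y ^+ 2 = r ^+ 2 by rewrite -ur normc_sqr.
pose a := x / r; pose b := y / r.
have rn : r != 0 by rewrite gt_eqF.
have hab : a ^+ 2 + b ^+ 2 = 1.
  by rewrite /a /b !expr_div_n -mulrDl h2 divff// expf_neq0.
have a1 : -1 <= a <= 1.
  rewrite -ler_norml -(@ler_pXn2r _ 2) ?nnegrE// expr1n real_normK ?num_real//.
  by rewrite -hab lerDl sqr_ge0.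
have ca : cos (acos a) = a by rewrite acosK// in_itv.
have sa : sin (acos a) = `|b|.
  rewrite sin_acos// -sqrtr_sqr; congr Num.sqrt; rewrite -hab; ring.
have ear : a * r = x by rewrite /a divfK.
have ebr : b * r = y by rewrite /b divfK.
have pi0 : 2 * pi != 0 :> R by rewrite mulf_neq0// gt_eqF// pi_gt0.
suff [th [hc hs]] : exists th : R, cos th = a /\ sin th = b.
  exists (th / (2 * pi)); rewrite mulrC divfK// /cexp /= lnK ?posrE//.
  by rewrite hc hs; simpc; rewrite mulrC ear mulrC ebr.
have [b0|b0] := leP 0 b.
  by exists (acos a); rewrite ca sa ger0_norm.
by exists (- acos a); rewrite cosN sinN ca sa ltr0_norm// opprK.
Qed.

Lemma cexp_period z (n : int) : cexp (z + (0 +i* (2 * pi * n%:~R))%C) = cexp z :> C.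
Proof.
rewrite cexpD; suff -> : cexp (0 +i* (2 * pi * n%:~R))%C = 1 :> C by rewrite mulr1.
have P (m : nat) : cexp (0 +i* (2 * pi * m%:R))%C = 1 :> C.
  elim: m => [|m IH]; first by rewrite mulr0 -[LHS]/(cexp 0) cexp0.
  have -> : (0 +i* (2 * pi * m.+1%:R))%C =
      (0 +i* (2 * pi * m%:R))%C + (0 +i* (2 * pi))%C :> C.
    by simpc; rewrite -natr1; congr (_ +i* _)%C; ring.
  rewrite cexpD IH mul1r /cexp /= expR0 mulr_natl cos2pi sin2pi.
  by simpc.
case: n => m; first exact: P.
have := @cexpD R (0 +i* (2 * pi * (Negz m)%:~R))%C (0 +i* (2 * pi * m.+1%:R))%C.
have -> : (0 +i* (2 * pi * (Negz m)%:~R))%C + (0 +i* (2 * pi * m.+1%:R))%C = 0 :> C.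
  rewrite NegzE mulrNz; apply/eqP; rewrite eq_complex /= addr0 eqxx /=.
  by rewrite -pmulrn; apply/eqP; ring.
by rewrite P mulr1 cexp0 => <-.
Qed.

(* Mean value property on circles, read in the coordinate
   w = w0 + exp(2 pi zeta): the mean over the circle of radius exp(2 pi s) is
   the integral over the vertical segment Re zeta = s, which does not depend on
   s by Goursat's theorem and periodicity; let s tend to -oo. *)
Lemma maximum_on_circle f w0 (r : R) : (forall w, derivable f w 1) -> 0 < r ->
  (forall w, normc (w - w0) = r -> Re (f w) <= Re (f w0)) ->
  forall w, normc (w - w0) = r -> Re (f w) = Re (f w0).
Proof.
move=> df r0 fmax w1 w1r.
have [t0 ht0] := polar_form r0 w1r.
(* This puts [t0], the height of [w1], in the middle of the segment from [tau] to [tau + 1]: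
   [primitive_extremal] yields equality only at interior points. *)
pose tau := t0 - 2^-1.
pose g (z : C) := f (w0 + cexp ((2 * pi)%:C%C * z)).
have dg z : derivable g z 1.
  apply: (@derivable_compC f (fun z => w0 + cexp ((2 * pi)%:C%C * z))); last exact: df.
  apply: derivable_addC; first exact: derivable_cstC.
  apply: derivable_cexp; apply: derivable_mulC; first exact: derivable_cstC.
  exact: derivable_idC.
have gper (x y : R) : g (x +i* (y + 1))%C = g (x +i* y)%C.
  rewrite /g; congr (f (w0 + _)).
  rewrite -[RHS](cexp_period _ 1); congr cexp.
  by simpc; congr (_ +i* _)%C; ring.
pose U (x y : R) := Re (g (x +i* y)%C); pose V (x y : R) := Im (g (x +i* y)%C).
have dUV p q : exists a b c, @real_diff R U p q a b /\ @real_diff R V p q c a.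
  by have [a [b [c]]] := complex_real_diff (dg (p +i* q)%C); exists a, b, c.
have cU x : continuous (U x).
  by move=> q; have [a [b [c [+ _]]]] := dUV x q; exact: real_diff_continuousr.
have cV y : continuous (fun x => V x y).
  move=> q; have [a [b [c [_ +]]]] := dUV q y => /real_diff_swap.
  exact: (@real_diff_continuousr R (fun y x => V x y)).
have /choice[B dB] : forall x, exists F, forall y, tau - 1 < y -> is_derive y 1 F (U x y).
  by move=> x; exact: continuous_primitive.
pose M x := B x (tau + 1) - B x tau.
have tau1 : tau <= tau + 1 by rewrite lerDl.
have dB' x y : tau <= y -> is_derive y 1 (B x) (U x y).
  by move=> hy; apply: dB; apply: lt_le_trans hy; rewrite gtrBl.
have Mcst s0 s1 : s0 <= s1 -> M s1 = M s0.
  move=> s01.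
  have /choice[A dA] : forall y, exists F, forall x, s0 - 1 < x ->
      is_derive x 1 F (V x y).
    by move=> y; apply: continuous_primitive; exact: cV.
  have dA' y x : s0 <= x -> is_derive x 1 (A y) (V x y).
    by move=> hx; apply: dA; apply: lt_le_trans hx; rewrite gtrBl.
  have := closed_form_rectangle s01 tau1 dUV dA' dB'.
  rewrite -/(M s1) -/(M s0) => E; apply/eqP; rewrite -subr_eq0 E subr_eq0.
  (* As [g] has period 1 in [y], the integrands on the two horizontal sides coincide. *)
  have dAt x : s0 <= x <= s1 -> is_derive x 1 (A (tau + 1)) (V x tau).
    by move=> /andP[hx _]; have := dA' (tau + 1) x hx; rewrite /V gper; apply.
  have dAb x : s0 <= x <= s1 -> is_derive x 1 (A tau) (V x tau).
    by move=> /andP[hx _]; exact: dA'.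
  by apply/eqP; exact: (primitive_eq s01 dAt dAb).
have pi0 : 0 < 2 * pi :> R by rewrite mulr_gt0// pi_gt0.
have Mlim e : 0 < e -> exists s1 : R, forall s, s <= s1 -> `|M s - Re (f w0)| <= e.
  move=> e0; have [d d0 H] := continuous_normc (derivable_continuousC (df w0)) e0.
  exists (ln (d / 2) / (2 * pi)) => s hs.
  have bd y : tau <= y <= tau + 1 -> `|U s y - 0 - Re (f w0)| <= e.
    move=> _; rewrite subr0 /U /g; set w := w0 + _.
    have : normc (w - w0) < d.
      rewrite /w addrAC subrr add0r normc_cexp; simpc => /=.
      apply: (@le_lt_trans _ _ (expR (ln (d / 2)))).
        by rewrite ler_expR mulrC -ler_pdivlMr.
      by rewrite lnK ?posrE ?divr_gt0// ltr_pdivrMr// ltr_pMr// ltr1n.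
    move=> /H h.
    apply: ltW; apply: le_lt_trans h; apply: le_trans (Re_le_normc _).
    by case: (f w) (f w0) => [? ?] [? ?].
  have := @primitive_diff_bound R (B s) (cst 0) (U s) (cst 0) tau (tau + 1)
    (Re (f w0)) e tau1.
  have -> : tau + 1 - tau = 1 by ring.
  rewrite /cst subrr subr0 !mulr1; apply => //.
    by move=> x /andP[h _]; exact: dB'.
have ME s : M s = Re (f w0).
  apply/eqP; rewrite -subr_eq0 -normr_eq0 eq_le normr_ge0 andbT.
  apply/ler_addgt0Pr => e e0; rewrite add0r.
  have [s1 H] := Mlim e e0.
  have := H (Num.min s s1); rewrite ge_min lexx orbT => /(_ isT).
  by rewrite (@Mcst (Num.min s s1) s)// ge_min lexx.
pose s := ln r / (2 * pi).
have := @primitive_extremal R (B s) (U s) tau (tau + 1) (Re (f w0)) _ _ _ t0.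
have -> : U s t0 = Re (f w1).
  rewrite /U /g; congr (Re (f _)); rewrite -[RHS](subrK w0) addrC ht0; congr (_ + _).
  by congr cexp; simpc; congr (_ +i* _)%C; rewrite /s mulrC divfK// gt_eqF.
apply.
- by move=> x /andP[h _]; exact: dB'.
- move=> x _; apply: fmax; rewrite addrAC subrr add0r normc_cexp; simpc => /=.
  by rewrite /s mulrC divfK ?gt_eqF// lnK.
- by rewrite -/(M s) ME; ring.
- by rewrite /tau; apply/andP; split; lra.
Qed.

End MaximumPrinciple.

(** * Doubly periodic functions of the form |phi|^2 exp P *)

Section DoublyPeriodic.
Variable R : realType.
Local Notation C := R[i].
Implicit Types (f : C -> C) (w z : C).

Lemma periodic_int (T : Type) (D : C -> T) om : (forall w, D (w + om) = D w) ->
  forall (n : int) w, D (w + n%:~R * om) = D w.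
Proof.
move=> H.
have P (n : nat) w : D (w + n%:R * om) = D w.
  elim: n w => [|n IH] w; first by rewrite mul0r addr0.
  by rewrite -natr1 mulrDl mul1r addrA H IH.
case=> n w; first exact: P.
rewrite -(P n.+1 (w + _)); congr D.
by rewrite NegzE mulrNz -pmulrn; ring.
Qed.

Lemma real_complex_continuous : continuous (fun x : R => x%:C%C : C).
Proof.
move=> x A /nbhs_normcP[d d0 H]; apply/nbhs_ballP; exists d => //= y.
rewrite /ball/= => xy; apply: H.
by rewrite -rmorphB normc_real distrC.
Qed.

Lemma parallelogram_coord (om1 om2 w : C) : Im (om1 * om2^*%C) != 0 ->
  exists s t : R, w = s%:C%C * om1 + t%:C%C * om2.
Proof.
case: om1 om2 w => [a b] [c d] [x y]; simpc => /= h.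
have h' : b * c - a * d != 0 by rewrite addrC.
exists ((y * c - x * d) / (b * c - a * d)), ((b * x - a * y) / (b * c - a * d)).
by simpc; congr (_ +i* _)%C; field.
Qed.

Lemma periodic_max (D : C -> R) (om1 om2 : C) : continuous D ->
  (forall w, D (w + om1) = D w) -> (forall w, D (w + om2) = D w) ->
  Im (om1 * om2^*%C) != 0 ->
  exists w0, forall w, D w <= D w0.
Proof.
move=> cD p1 p2 om0.
pose F (p : R * R) := D (p.1%:C%C * om1 + p.2%:C%C * om2).
have cF : continuous F.
  move=> p; apply: (@continuous_comp _ _ _ (fun p : R * R => p.1%:C%C * om1 + p.2%:C%C * om2) D).
    apply: cvgD; apply: cvgMl; apply: (continuous_comp _ (@real_complex_continuous _)).
      exact: cvg_fst.
    exact: cvg_snd.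
  exact: cD.
have [|||p _ H] := @compact_EVT_max _ R F (`[0, 1] `*` `[0, 1]).
- by exists (0, 0); split; rewrite /= in_itv /= lexx ler01.
- by apply: compact_setX; exact: segment_compact.
- exact: continuous_subspaceT.
exists (p.1%:C%C * om1 + p.2%:C%C * om2) => w.
have [s [t ->]] := parallelogram_coord w om0.
rewrite -/(F p).
have -> : D (s%:C%C * om1 + t%:C%C * om2) = F (s - (Num.floor s)%:~R, t - (Num.floor t)%:~R).
  rewrite /F /= !rmorphB /= !rmorph_int.
  rewrite -[RHS](periodic_int p1 (Num.floor s)) -[RHS](periodic_int p2 (Num.floor t)).
  by congr D; ring.
apply: H; rewrite inE; split => /=; rewrite in_itv /=.
  have := floor_itv s; rewrite intrD => /andP[h1 h2].
  by rewrite subr_ge0 h1 /= lerBlDl ltW// addrC.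
have := floor_itv t; rewrite intrD => /andP[h1 h2].
by rewrite subr_ge0 h1 /= lerBlDl ltW// addrC.
Qed.

(* Real polynomials of degree at most 3 in (w, conj w), up to real parts of
   entire functions. *)
Definition cubic (P : C -> R) (c : R) (d : C) : Prop :=
  exists2 Q : C -> C, (forall w, derivable Q w 1) &
    forall w, P w = Re (Q w) + normc w ^+ 2 * (c + Re (d * w)).

(** [c + 2 * Re (d * w)] is a quarter of the Laplacian of [P] at [w], which explains the new
    constant term. The other cross terms of the expansion are real parts of entire functions. *)
Lemma cubic_translate P c d w0 : cubic P c d ->
  cubic (fun w => P (w0 + w)) (c + 2 * Re (d * w0)) d.
Proof.
move=> [Q dQ PE].
pose c' := c + Re (d * w0).
exists (fun w => Q (w0 + w) + ((2 * c')%:C%C * w0^*%C * w +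
  ((normc w0 ^+ 2)%:C%C * (c'%:C%C + d * w) + w0^*%C * d * (w * w)))).
  move=> w; apply: derivable_addC.
    apply: (@derivable_compC _ Q (fun w => w0 + w)); last exact: dQ.
    by apply: derivable_addC; [exact: derivable_cstC|exact: derivable_idC].
  apply: derivable_addC.
    by apply: derivable_mulC; [exact: derivable_cstC|exact: derivable_idC].
  apply: derivable_addC; apply: derivable_mulC.
  - exact: derivable_cstC.
  - apply: derivable_addC; first exact: derivable_cstC.
    by apply: derivable_mulC; [exact: derivable_cstC|exact: derivable_idC].
  - exact: derivable_cstC.
  - by apply: derivable_mulC; exact: derivable_idC.
move=> w; rewrite PE !normc_sqr /c'; move: (Q _) => q.
by clear c' PE; case: q w w0 d => [? ?] [? ?] [? ?] [? ?]; simpc => /=; ring.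
Qed.

Lemma cubicD P c d P' c' d' : cubic P c d -> cubic P' c' d' ->
  cubic (fun w => P w + P' w) (c + c') (d + d').
Proof.
move=> [Q dQ PE] [Q' dQ' PE']; exists (fun w => Q w + Q' w).
  by move=> w; apply: derivable_addC.
move=> w; rewrite PE PE' mulrDl.
by case: (Q w) (Q' w) (d * w) (d' * w) => [? ?] [? ?] [? ?] [? ?] /=; ring.
Qed.

Lemma cubicZ (k : R) P c d : cubic P c d ->
  cubic (fun w => k * P w) (k * c) (k%:C%C * d).
Proof.
move=> [Q dQ PE]; exists (fun w => k%:C%C * Q w).
  by move=> w; apply: derivable_mulC => //; exact: derivable_cstC.
move=> w; rewrite PE -mulrA.
by case: (Q w) (d * w) => [? ?] [? ?]; simpc => /=; ring.
Qed.

Lemma cubic_cst (k : R) : cubic (fun=> k) 0 0.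
Proof.
exists (fun=> k%:C%C); first by move=> w; exact: derivable_cstC.
by move=> w; rewrite mul0r /= addr0 mulr0 addr0.
Qed.

Lemma cubic_Im1 (l : C) : cubic (fun w => Im (l * w)) 0 0.
Proof.
exists (fun w => (0 +i* (-1))%C * (l * w)).
  move=> w; apply: derivable_mulC; first exact: derivable_cstC.
  by apply: derivable_mulC; [exact: derivable_cstC|exact: derivable_idC].
by move=> w; rewrite mul0r; case: l w => [? ?] [? ?]; simpc => /=; ring.
Qed.

Lemma derivable_scalC (l z : C) : derivable (fun w => l * w) z 1.
Proof. by apply: derivable_mulC; [exact: derivable_cstC|exact: derivable_idC]. Qed.

Lemma cubic_Im2 (l : C) : cubic (fun w => Im (l * w) ^+ 2) (normc l ^+ 2 / 2) 0.
Proof.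
exists (fun w => (- 2^-1)%:C%C * ((l * w) * (l * w))).
  move=> w; apply: derivable_mulC; first exact: derivable_cstC.
  by apply: derivable_mulC; exact: derivable_scalC.
by move=> w; rewrite mul0r !normc_sqr; case: l w => [? ?] [? ?]; simpc => /=; field.
Qed.

(** For z = l w one has (Im z)^3 = 3/4 |z|^2 Im z - 1/4 Im(z^3), and Im z = Re(-i z). *)
Lemma cubic_Im3 (l : C) : cubic (fun w => Im (l * w) ^+ 3) 0
  ((3 / 4 * normc l ^+ 2)%:C%C * ((0 +i* (-1))%C * l)).
Proof.
exists (fun w => (0 +i* 4^-1)%C * ((l * w) * ((l * w) * (l * w)))).
  move=> w; apply: derivable_mulC; first exact: derivable_cstC.
  apply: derivable_mulC; first exact: derivable_scalC.
  by apply: derivable_mulC; exact: derivable_scalC.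
by move=> w; rewrite !normc_sqr; case: l w => [? ?] [? ?]; simpc => /=; field.
Qed.

Lemma cubic_ext P P' c d : P =1 P' -> cubic P c d -> cubic P' c d.
Proof. by move=> E [Q dQ PE]; exists Q => // w; rewrite -E. Qed.

Lemma cubic_poly (l : C) (k a0 a1 a2 a3 : R) : exists c d,
  cubic (fun w => let u := Im (l * w) + k in
    a0 + a1 * u + a2 * u ^+ 2 + a3 * u ^+ 3) c d.
Proof.
pose b0 := a0 + a1 * k + a2 * k ^+ 2 + a3 * k ^+ 3.
pose b1 := a1 + 2 * a2 * k + 3 * a3 * k ^+ 2.
pose b2 := a2 + 3 * a3 * k.
have H := cubicD (cubicD (cubicD (cubic_cst b0) (cubicZ b1 (cubic_Im1 l)))
  (cubicZ b2 (cubic_Im2 l))) (cubicZ a3 (cubic_Im3 l)).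
eexists; eexists; apply: cubic_ext H => w /=.
by rewrite /b0 /b1 /b2; ring.
Qed.

Lemma Re_mulJ_le (z w : C) : Re (z * w^*%C) <= normc z * normc w.
Proof.
apply: le_trans (ler_norm _) _; apply: le_trans (Re_le_normc _) _.
rewrite normcM; suff -> : normc w^*%C = normc w by [].
by case: w => a b /=; rewrite sqrrN.
Qed.

Lemma Re_mulJ_self (z : C) : Re (z * z^*%C) = normc z ^+ 2.
Proof. by rewrite normc_sqr; case: z => a b /=; simpc => /=; ring. Qed.

Lemma continuous_addCR (T : topologicalType) (f g : T -> R) : continuous f -> continuous g ->
  continuous (fun x => f x + g x).
Proof.
by move=> cf cg w; exact: (@cvgD _ R^o _ (nbhs w) (nbhs_filter w) f g _ _ (cf w) (cg w)).
Qed.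

Lemma continuous_mulCR (T : topologicalType) (f g : T -> R) : continuous f -> continuous g ->
  continuous (fun x => f x * g x).
Proof.
by move=> cf cg w; exact: (@cvgM R _ (nbhs w) (nbhs_filter w) f g _ _ (cf w) (cg w)).
Qed.

Lemma continuous_compCR (T U V : topologicalType) (g : T -> U) (f : U -> V) :
  continuous g -> continuous f -> continuous (fun x => f (g x)).
Proof. by move=> cg cf w; apply: continuous_comp; [exact: cg|exact: cf]. Qed.

Lemma cubic_continuous P c d : cubic P c d -> continuous P.
Proof.
move=> [Q dQ PE].
have -> : P = (fun w => Re (Q w) + normc w ^+ 2 * (c + Re (d * w))).
  by apply/funext.
apply: continuous_addCR.
  apply: (continuous_compCR (g := Q)); last exact: Re_continuous.
  by move=> w; exact: derivable_continuousC.
apply: continuous_mulCR.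
  by apply: continuous_mulCR; exact: normc_continuous.
apply: continuous_addCR; first exact: cst_continuous.
apply: (continuous_compCR (g := fun w => d * w)); last exact: Re_continuous.
by move=> w; exact/derivable_continuousC/derivable_scalC.
Qed.

Variables (om1 om2 : C).
Hypothesis om_indep : Im (om1 * om2^*%C) != 0.

(** If the Laplacian of [P] were positive at the maximum [w0], then near [w0] the function [D] would
    be |psi|^2, with psi entire, times a factor exceeding 1 on a small circle. Then |psi| would be
    smaller on the circle than at its centre, against the mean value property. *)
Lemma cubic_at_maximum (phi : C -> C) (P D : C -> R) c d w0 :
  (forall w, derivable phi w 1) -> (forall w, phi w != 0) -> cubic P c d ->
  (forall w, D w = normc (phi w) ^+ 2 * expR (P w)) ->
  (forall w, D w <= D w0) -> c + 2 * Re (d * w0) <= 0.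
Proof.
move=> dphi phi0 cP DE Dmax; rewrite leNgt; apply/negP => c0.
have [Q dQ PE] := cubic_translate w0 cP.
set c' := c + _ in c0 PE.
pose psi (w : C) := phi (w0 + w) * cexp (2^-1%:C%C * Q w).
have dpsi w : derivable psi w 1.
  apply: derivable_mulC.
    apply: (@derivable_compC _ phi (fun w => w0 + w)); last exact: dphi.
    by apply: derivable_addC; [exact: derivable_cstC|exact: derivable_idC].
  apply: derivable_cexp; apply: derivable_mulC; last exact: dQ.
  exact: derivable_cstC.
have Dpsi w : D (w0 + w) =
    normc (psi w) ^+ 2 * expR (normc w ^+ 2 * (c' + Re (d * w))).
  rewrite DE PE /psi normcM normc_cexp exprMn -expRM_natl expRD mulrA.
  congr (_ * expR _ * _); by case: (Q w) => a b /=; simpc => /=; field.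
(* Its real part is at most |psi w| |psi 0|, with equality at 0; so a comparison of moduli becomes
   one of real parts. *)
pose f (w : C) := psi w * (psi 0)^*%C.
have df w : derivable f w 1.
  by apply: derivable_mulC; [exact: dpsi|exact: derivable_cstC].
(* Small enough that [normc d * r < c'], so that [c' + Re (d * w)] is positive on the circle. *)
pose r := c' / (2 * (normc d + 1)).
have nd : 0 < normc d + 1 by rewrite ltr_wpDl ?normc_ge0.
have r0 : 0 < r by rewrite divr_gt0// mulr_gt0.
have psi0 : 0 < normc (psi 0).
  by rewrite normc_gt0// mulf_neq0// cexp_neq0.
have psilt w : normc w = r -> normc (psi w) < normc (psi 0).
  move=> wr; rewrite -(@ltr_pXn2r _ 2) ?nnegrE ?normc_ge0//.
  have := Dmax (w0 + w); rewrite -[in D w0](addr0 w0) !Dpsi wr.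
  rewrite normc0 expr0n mul0r expR0 mulr1; apply: lt_le_trans.
  rewrite ltr_pMr; last first.
    rewrite exprn_gt0// normc_gt0// mulf_neq0// cexp_neq0//.
  rewrite expR_gt1 mulr_gt0 ?exprn_gt0//.
  have h1 : `|Re (d * w)| <= normc d * r by rewrite -wr -normcM Re_le_normc.
  have h2 : normc d * r < c'.
    rewrite /r mulrA ltr_pdivrMr ?mulr_gt0// mulrC ltr_pM2l//.
    by have := normc_ge0 d; lra.
  by move: h1; rewrite ler_norml => /andP[h1 _]; lra.
have flt w : normc (w - 0) = r -> Re (f w) < Re (f 0).
  rewrite subr0 => wr; rewrite {2}/f Re_mulJ_self expr2.
  by apply: le_lt_trans (Re_mulJ_le _ _) _; rewrite ltr_pM2r// psilt.
have rr : normc (r%:C%C - 0) = r by rewrite subr0 normc_real gtr0_norm.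
have := @maximum_on_circle R f 0 r df r0 (fun w h => ltW (flt w h)) r%:C%C rr.
by have := flt _ rr; lra.
Qed.

Lemma affine_int_bounded (a b : R) : (forall n : int, a + n%:~R * b <= 0) -> b = 0.
Proof.
move=> H; apply/eqP/negP => /negP b0.
pose n := Num.bound (`|a| / `|b|).
have hn : `|a| < n%:R * `|b|.
  by rewrite -ltr_pdivrMr ?normr_gt0// archi_boundP// divr_ge0.
have [hb|hb] := ltP 0 b.
  have := H n%:Z; rewrite -pmulrn; move: hn; rewrite (gtr0_norm hb).
  by have := ler_norm (- a); rewrite normrN; lra.
have := H (- n%:Z); rewrite mulrNz -pmulrn; move: hn; rewrite (ler0_norm hb).
by have := ler_norm (- a); rewrite normrN; lra.
Qed.

(** Translates of a maximum by multiples of a period are maxima, so the affine function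
    [c + 2 * Re (d * w)] is nonpositive along whole progressions. Hence [Re (d * om) = 0] for both
    periods, and these are independent over the reals. *)
Lemma cubic_at_periodic_maximum (phi : C -> C) (P D : C -> R) c d :
  (forall w, derivable phi w 1) -> (forall w, phi w != 0) -> cubic P c d ->
  (forall w, D w = normc (phi w) ^+ 2 * expR (P w)) ->
  (forall w, D (w + om1) = D w) -> (forall w, D (w + om2) = D w) ->
  exists w0, (forall w, D w <= D w0) /\ d = 0 /\ c <= 0.
Proof.
move=> dphi phi0 cP DE p1 p2.
have cD : continuous D.
  have -> : D = (fun w => normc (phi w) ^+ 2 * expR (P w)) by apply/funext.
  apply: continuous_mulCR.
    have cn : continuous (fun w => normc (phi w)).
      apply: continuous_compCR; last exact: normc_continuous.
      by move=> w; exact: derivable_continuousC.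
    exact: (continuous_mulCR cn cn).
  apply: (continuous_compCR (cubic_continuous cP)).
  exact: continuous_expR.
have [w0 Dmax] := periodic_max cD p1 p2 om_indep.
exists w0; split=> //.
have ReE (u v om : C) (x : R) : c + 2 * Re (u * (v + x%:C%C * om)) =
    c + 2 * Re (u * v) + x * (2 * Re (u * om)).
  by case: u v om => [? ?] [? ?] [? ?]; simpc => /=; ring.
have shift om : (forall w, D (w + om) = D w) -> Re (d * om) = 0.
  move=> p; suff : 2 * Re (d * om) = 0 by lra.
  apply: (@affine_int_bounded (c + 2 * Re (d * w0))) => n.
  have := @cubic_at_maximum phi P D c d (w0 + n%:~R * om) dphi phi0 cP DE.
  rewrite (periodic_int p) => /(_ Dmax); congr (_ <= 0).
  have -> : n%:~R = n%:~R%:C%C :> C by rewrite rmorph_int.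
  exact: ReE.
have h1 := shift _ p1; have h2 := shift _ p2.
have d0 : d = 0.
  clear -h1 h2 om_indep; move: om_indep h1 h2.
  case: d om1 om2 => [x y] [a b] [e f]; simpc => /= /eqP h h1 h2.
  have hx : x * (- (a * f) + b * e) = 0.
    have -> : x * (- (a * f) + b * e) = (x * e - y * f) * b - (x * a - y * b) * f by ring.
    by rewrite h1 h2; ring.
  have hy : y * (- (a * f) + b * e) = 0.
    have -> : y * (- (a * f) + b * e) = (x * e - y * f) * a - (x * a - y * b) * e by ring.
    by rewrite h1 h2; ring.
  move/eqP: hx; move/eqP: hy; rewrite !mulf_eq0.
  by move/eqP/negbTE: h => ->; rewrite !orbF => /eqP -> /eqP ->.
split=> //; have := cubic_at_maximum dphi phi0 cP DE Dmax.
by rewrite d0 mul0r mulr0 addr0.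
Qed.

(* At a maximum of D the Laplacian of P is nonpositive, at a minimum it is
   nonnegative, and by periodicity the affine function Delta P vanishes; then
   D = |psi|^2 with psi entire and the maximum principle applies. *)
Theorem doubly_periodic_constant (phi : C -> C) (P D : C -> R) c d :
  (forall w, derivable phi w 1) -> (forall w, phi w != 0) -> cubic P c d ->
  (forall w, D w = normc (phi w) ^+ 2 * expR (P w)) ->
  (forall w, D (w + om1) = D w) -> (forall w, D (w + om2) = D w) ->
  forall w, D w = D 0.
Proof.
move=> dphi phi0 cP DE p1 p2.
have [w0 [Dmax [d0 c0]]] := cubic_at_periodic_maximum dphi phi0 cP DE p1 p2.
(* A minimum of [D] is a maximum of its inverse, for which [phi] and [P] become [phi^-1] and
   [- P]. *)
have [_ [_ [_ c1]]] : exists w0, (forall w, (D w)^-1 <= (D w0)^-1) /\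
    (-1)%:C%C * d = 0 /\ -1 * c <= 0.
  apply: (@cubic_at_periodic_maximum (fun w => (phi w)^-1) (fun w => -1 * P w)).
  - by move=> w; apply: derivableV.
  - by move=> w; rewrite invr_eq0.
  - exact: cubicZ.
  - by move=> w; rewrite DE mulN1r expRN normcV exprVn invfM.
  - by move=> w; rewrite p1.
  - by move=> w; rewrite p2.
have {c0 c1} c0 : c = 0 by lra.
have [Q dQ PE] := cP; rewrite c0 d0 in PE.
pose psi (w : C) := phi w * cexp (2^-1%:C%C * Q w).
have dpsi w : derivable psi w 1.
  apply: derivable_mulC; first exact: dphi.
  apply: derivable_cexp; apply: derivable_mulC; last exact: dQ.
  exact: derivable_cstC.
have Dpsi w : D w = normc (psi w) ^+ 2.
  rewrite DE PE /psi normcM normc_cexp exprMn -expRM_natl.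
  congr (_ * expR _); by case: (Q w) => a b /=; simpc => /=; field.
pose f (w : C) := psi w * (psi w0)^*%C.
have df w : derivable f w 1.
  by apply: derivable_mulC; [exact: dpsi|exact: derivable_cstC].
have psile w : normc (psi w) <= normc (psi w0).
  by rewrite -(@ler_pXn2r _ 2) ?nnegrE ?normc_ge0// -!Dpsi.
have fle w : Re (f w) <= Re (f w0).
  rewrite {2}/f Re_mulJ_self expr2.
  by apply: le_trans (Re_mulJ_le _ _) _; rewrite ler_wpM2r ?normc_ge0.
suff H w : D w = D w0 by move=> w; rewrite !H.
have [->//|ww0] := eqVneq w w0.
have r0 : 0 < normc (w - w0) by rewrite normc_gt0// subr_eq0.
have E := maximum_on_circle df r0 (fun w _ => fle w) (erefl _).
have := Re_mulJ_le (psi w) (psi w0); rewrite -/(f w) E {1}/f Re_mulJ_self expr2.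
have psi0 : 0 < normc (psi w0) by rewrite normc_gt0// mulf_neq0// cexp_neq0.
rewrite ler_pM2r// => h; rewrite !Dpsi; congr (_ ^+ 2).
by apply/eqP; rewrite eq_le psile h.
Qed.

End DoublyPeriodic.

(** * Unconditional products *)

Section UnconditionalProducts.
Variable R : realType.
Local Notation C := R[i].

(** In all uses [u] is a modulus, so bounded partial sums amount to absolute summability. *)
Definition usum (I : eqType) (A : set I) (u : I -> R) : Prop :=
  exists M, forall J : seq I, uniq J -> (forall i, i \in J -> A i) ->
    \sum_(i <- J) u i <= M.

(** A relational form of [iprod], with duplicate-free lists in place of finite sets. Unions and
    changes of index set are proved in this form; [uprod_iprod] returns to the limit. *)
Definition uprod (I : eqType) (A : set I) (F : I -> C) (l : C) : Prop :=
  forall e : R, 0 < e -> exists2 K : seq I, (forall i, i \in K -> A i) &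
    forall J : seq I, uniq J -> {subset K <= J} -> (forall i, i \in J -> A i) ->
      normc (\prod_(i <- J) F i - l) < e.

Lemma usum_subset (I : eqType) (A B : set I) (u : I -> R) :
  A `<=` B -> usum B u -> usum A u.
Proof. by move=> AB [M H]; exists M => J uJ JA; apply: H => // i /JA/AB. Qed.

Lemma sum_ge0_seq (I : eqType) (u : I -> R) (J : seq I) :
  (forall i, 0 <= u i) -> 0 <= \sum_(i <- J) u i.
Proof. by move=> u0; apply: sumr_ge0. Qed.

Lemma usum_tail (I : eqType) (A : set I) (u : I -> R) : usum A u ->
  forall e, 0 < e -> exists2 K : seq I, uniq K /\ (forall i, i \in K -> A i) &
    forall J : seq I, uniq J -> (forall i, i \in J -> A i) ->
      (forall i, i \in J -> i \notin K) -> \sum_(i <- J) u i <= e.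
Proof.
move=> [M H] e e0.
pose S := [set \sum_(i <- J) u i | J in [set J : seq I | uniq J /\ forall i, i \in J -> A i]].
have S0 : S !=set0 by exists (\sum_(i <- [::]) u i), [::].
have Sub : has_ubound S by exists M => _ [J [uJ JA] <-]; exact: H.
have [_ [K [uK KA] <-] hK] := sup_adherent e0 (conj S0 Sub).
exists K => // J uJ JA JK.
have : \sum_(i <- K ++ J) u i <= sup S.
  apply: sup_ubound => //; exists (K ++ J) => //; split.
    rewrite cat_uniq uK uJ andbT; apply/hasPn => i /JK //.
  by move=> i; rewrite mem_cat => /orP[/KA|/JA].
by rewrite big_cat /=; move: hK; lra.
Qed.

Lemma expR_sub1_le (x : R) : 0 <= x -> x <= 2^-1 -> expR x - 1 <= 2 * x.
Proof.
move=> x0 x1; have := expR_ge1Dx (- x); rewrite expRN => h.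
have h1 : 0 < 1 - x by lra.
have : expR x <= (1 - x)^-1.
  by rewrite -[expR x]invrK lef_pV2// posrE invr_gt0 expR_gt0.
move=> h2; have h3 : (1 - x)^-1 <= 1 + 2 * x.
  rewrite -[leLHS]mul1r ler_pdivrMr//.
  have -> : (1 + 2 * x) * (1 - x) = 1 + x * (1 - 2 * x) by ring.
  by rewrite lerDl mulr_ge0//; lra.
lra.
Qed.

Lemma prod_sub1_bound (I : eqType) (F : I -> C) (J : seq I) :
  normc (\prod_(i <- J) F i - 1) <= expR (\sum_(i <- J) normc (1 - F i)) - 1.
Proof.
elim: J => [|x J IH]; first by rewrite !big_nil subrr normc0 expR0 subrr.
rewrite !big_cons; set Q := \prod_(_ <- _) _ in IH *; set S := \sum_(_ <- _) _ in IH *.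
set u := normc (1 - F x).
have -> : F x * Q - 1 = - ((1 - F x) * (Q - 1)) - (1 - F x) + (Q - 1) by ring.
have h1 := le_normcD (- ((1 - F x) * (Q - 1)) - (1 - F x)) (Q - 1).
have h2 := le_normcD (- ((1 - F x) * (Q - 1))) (- (1 - F x)).
rewrite !normcN normcM -/u in h2.
have u0 : 0 <= u by exact: normc_ge0.
have h3 : u * normc (Q - 1) <= u * (expR S - 1) by rewrite ler_wpM2l.
have h4 : (1 + u) * expR S <= expR (u + S).
  by rewrite expRD ler_wpM2r ?expR_ge0// expR_ge1Dx.
lra.
Qed.

Lemma prod_normc_bound (I : eqType) (F : I -> C) (J : seq I) :
  normc (\prod_(i <- J) F i) <= expR (\sum_(i <- J) normc (1 - F i)).
Proof.
have := prod_sub1_bound F J; have := le_normcD (\prod_(i <- J) F i - 1) 1.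
by rewrite subrK normc1; lra.
Qed.

Lemma prod_split (I : eqType) (F : I -> C) (K J : seq I) : uniq K -> uniq J ->
  {subset K <= J} ->
  \prod_(i <- J) F i = \prod_(i <- K) F i * \prod_(i <- [seq i <- J | i \notin K]) F i.
Proof.
move=> uK uJ KJ; rewrite [LHS](bigID (mem K)) /= big_filter; congr (_ * _).
rewrite -big_filter.
apply: perm_big; apply: uniq_perm => //; first exact: filter_uniq.
by move=> i; rewrite mem_filter; apply: andb_idr => /KJ.
Qed.

(** The factors outside [K] have a product within [e] of 1. The error is thus relative to the finite
    product, which serves both for convergence and, in [uprod_neq0], for a nonzero limit. *)
Lemma uprod_approx (I : eqType) (A : set I) (F : I -> C) :
  usum A (fun i => normc (1 - F i)) -> forall e, 0 < e ->
  exists2 K : seq I, uniq K /\ (forall i, i \in K -> A i) &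
    forall J : seq I, uniq J -> (forall i, i \in J -> A i) -> {subset K <= J} ->
      normc (\prod_(i <- J) F i - \prod_(i <- K) F i) <=
        e * normc (\prod_(i <- K) F i).
Proof.
move=> sA e e0; pose e1 := Num.min (e / 2) 2^-1.
have e10 : 0 < e1 by rewrite lt_min divr_gt0//= invr_gt0.
have [K [uK KA] HK] := usum_tail sA e10.
exists K => // J uJ JA KJ; rewrite (prod_split F uK uJ KJ).
set Q := \prod_(i <- K) _; set T := \prod_(i <- _) _.
have -> : Q * T - Q = (T - 1) * Q by ring.
rewrite normcM ler_wpM2r ?normc_ge0//.
apply: le_trans (prod_sub1_bound _ _) _.
set S := \sum_(_ <- _) _.
have S1 : S <= e1.
  apply: HK; first exact: filter_uniq.
    by move=> i; rewrite mem_filter => /andP[_ /JA].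
  by move=> i; rewrite mem_filter => /andP[].
have S0 : 0 <= S by apply: sum_ge0_seq => i; exact: normc_ge0.
move: S1; rewrite le_min => /andP[S1 S2].
have := expR_sub1_le S0 S2; lra.
Qed.

Lemma uprod_ex (I : choiceType) (A : set I) (F : I -> C) :
  usum A (fun i => normc (1 - F i)) -> exists l, uprod A F l.
Proof.
move=> sA; have [M HM] := sA.
pose p (J : {fset I}) := \prod_(i <- J | i \in A) F i.
have ap e : 0 < e -> exists K : {fset I}, forall J : {fset I},
    {subset K <= J} -> normc (p J - p K) < e.
  move=> e0; pose B := expR M.
  have B0 : 0 < B by exact: expR_gt0.
  have e10 : 0 < e / 2 / B by rewrite !divr_gt0.
  have [K [uK KA] H] := uprod_approx sA e10.
  exists [fset x in K]%fset => J KJ.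
  have pK : p [fset x in K]%fset = \prod_(i <- K) F i.
    rewrite /p -big_filter; apply: perm_big; apply: uniq_perm => //.
      exact/filter_uniq/fset_uniq.
    move=> i; rewrite mem_filter inE /=; apply: andb_idl => /KA.
    by rewrite inE.
  have pJ : p J = \prod_(i <- [seq i <- J | i \in A]) F i by rewrite /p big_filter.
  rewrite pK pJ; apply: le_lt_trans (H _ _ _ _) _.
  - exact/filter_uniq/fset_uniq.
  - by move=> i; rewrite mem_filter => /andP[]; rewrite inE.
  - move=> i iK; rewrite mem_filter; apply/andP; split.
      by apply/asboolP/KA.
    by apply: KJ; rewrite inE.
  apply: (@le_lt_trans _ _ (e / 2 / B * B)); last by rewrite divfK ?gt_eqF//; lra.
  rewrite ler_wpM2l ?(ltW e10)//; apply: le_trans (prod_normc_bound _ _) _.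
  by rewrite ler_expR HM.
(* Completeness is used in [R]; [g] stands for the real and for the imaginary part. *)
have cvgpart (g : C -> R) : (forall z w, `|g z - g w| <= normc (z - w)) ->
    exists l : R, forall e, 0 < e -> exists K : {fset I}, forall J : {fset I},
      {subset K <= J} -> `|g (p J) - l| < e.
  move=> gl.
  have FF : ProperFilter ((fun J => g (p J)) @ (@totally I)).
    exact: (fmap_proper_filter (fun J => g (p J)) (@totally_filter I)).
  have : cauchy ((fun J => g (p J)) @ (@totally I)).
    apply: cauchy_exP => e e0; have [K HK] := ap e e0.
    exists (g (p K)); exists K => // J /= KJ; rewrite /ball/= distrC.
    by apply: le_lt_trans (gl _ _) _; apply: HK; exact/fsubsetP.
  move/cauchy_cvg/cvg_ex => [l /cvgrPdist_lt Hl].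
  exists l => e e0; have [K _ HK] := Hl (@totally_filter I) e e0; exists K => J KJ.
  by rewrite distrC; apply: HK; exact/fsubsetP.
have [l1 H1] := cvgpart (@complex.Re R) (fun z w => ltac:(
  apply: le_trans (Re_le_normc _); by case: z w => [? ?] [? ?])).
have [l2 H2] := cvgpart (@complex.Im R) (fun z w => ltac:(
  apply: le_trans (Im_le_normc _); by case: z w => [? ?] [? ?])).
exists (l1 +i* l2)%C => e e0.
have e20 : 0 < e / 2 by rewrite divr_gt0.
have [K1 HK1] := H1 _ e20; have [K2 HK2] := H2 _ e20.
exists [seq i <- (K1 `|` K2)%fset | i \in A].
  by move=> i; rewrite mem_filter => /andP[]; rewrite inE.
move=> J uJ KJ JA.
pose J' := ((K1 `|` K2) `|` [fset x in J])%fset.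
have pJ : p J' = \prod_(i <- J) F i.
  rewrite /p -big_filter; apply: perm_big; apply: uniq_perm => //.
    exact/filter_uniq/fset_uniq.
  move=> i; rewrite mem_filter !inE /=; apply/idP/idP.
    move=> /andP[iA /orP[/orP[iK|iK]|//]];
      by apply: KJ; rewrite mem_filter !inE iA iK ?orbT.
  by move=> iJ; rewrite iJ orbT andbT; apply/asboolP/JA.
have := HK1 J'; have := HK2 J'; rewrite pJ.
case: (\prod_(i <- J) F i) => a b h2 h1; simpc.
apply: le_lt_trans (normc_le_ReIm _ _) _.
have h1' : `|a - l1| < e / 2.
  by apply: h1 => i iK; rewrite !inE iK.
have h2' : `|b - l2| < e / 2.
  by apply: h2 => i iK; rewrite !inE iK orbT.
by have := ltrD h1' h2'; lra.
Qed.

Lemma uprod_unique (I : eqType) (A : set I) (F : I -> C) l m :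
  uprod A F l -> uprod A F m -> l = m.
Proof.
move=> Hl Hm; apply/eqP; rewrite -subr_eq0; apply/negP => /negP lm0.
have e0 : 0 < normc (l - m) / 2 by rewrite divr_gt0// normc_gt0.
have [K KA HK] := Hl _ e0; have [L LA HL] := Hm _ e0.
have uJ : uniq (undup (K ++ L)) by exact: undup_uniq.
have JA i : i \in undup (K ++ L) -> A i.
  by rewrite mem_undup mem_cat => /orP[/KA|/LA].
have := HK _ uJ _ JA; have := HL _ uJ _ JA.
set P := \prod_(_ <- _) _ => h1 h2.
have {}h1 : normc (P - m) < normc (l - m) / 2.
  by apply: h1 => i iL; rewrite mem_undup mem_cat iL orbT.
have {}h2 : normc (P - l) < normc (l - m) / 2.
  by apply: h2 => i iL; rewrite mem_undup mem_cat iL.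
have := le_normcD (P - m) (- (P - l)); rewrite normcN.
have -> : P - m - (P - l) = l - m by ring.
lra.
Qed.

Lemma uprod_iprod (I : choiceType) (A : set I) (F : I -> C) l :
  uprod A F l -> iprod A F = l.
Proof.
move=> H; apply: (@cvg_lim _ _ _ totally (@totally_filter I)); first exact: norm_hausdorff.
move=> B /nbhs_normcP[e e0 HB]; have [K KA HK] := H e e0.
exists [fset x in K]%fset => // J /= /fsubsetP KJ; apply: HB.
rewrite -big_filter; apply: HK.
- exact/filter_uniq/fset_uniq.
- move=> i iK; rewrite mem_filter; apply/andP; split.
    by apply/asboolP/KA.
  by apply: KJ; rewrite inE.
- by move=> i; rewrite mem_filter => /andP[]; rewrite inE.
Qed.

Lemma uprod_ext (I : eqType) (A : set I) (F G : I -> C) l :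
  (forall i, A i -> F i = G i) -> uprod A F l -> uprod A G l.
Proof.
move=> FG H e /H [K KA HK]; exists K => // J uJ KJ JA.
suff <- : \prod_(i <- J) F i = \prod_(i <- J) G i by exact: HK.
by apply: eq_big_seq => i /JA/FG.
Qed.

Lemma normc_mul_close (x y l m : C) (e : R) : 0 < e -> e <= 1 ->
  normc (x - l) < e -> normc (y - m) < e ->
  normc (x * y - l * m) <= e * (normc l + normc m + 1).
Proof.
move=> e0 e1 xl ym.
have -> : x * y - l * m = (x - l) * (y - m) + ((x - l) * m + l * (y - m)) by ring.
apply: le_trans (le_normcD _ _) _.
have := le_normcD ((x - l) * m) (l * (y - m)); rewrite !normcM => h.
have h1 : normc (x - l) * normc (y - m) <= e * 1.
  by rewrite ler_pM ?normc_ge0 ?ltW// (lt_le_trans ym).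
have h2 : normc (x - l) * normc m <= e * normc m.
  by rewrite ler_wpM2r ?normc_ge0 ?ltW.
have h3 : normc l * normc (y - m) <= normc l * e.
  by rewrite ler_wpM2l ?normc_ge0 ?ltW.
lra.
Qed.

Lemma uprodU (I : choiceType) (A B : set I) (F : I -> C) l m :
  (forall i, A i -> B i -> False) ->
  uprod A F l -> uprod B F m -> uprod (A `|` B) F (l * m).
Proof.
move=> AB HA HB e e0.
pose c := normc l + normc m + 1.
have c0 : 0 < c by rewrite ltr_wpDl// addr_ge0 ?normc_ge0.
pose e1 := Num.min (e / 2 / c) 1.
have e10 : 0 < e1 by rewrite lt_min ltr01 andbT !divr_gt0.
have [K KA HK] := HA _ e10; have [L LB HL] := HB _ e10.
exists (K ++ L).
  by move=> i; rewrite mem_cat => /orP[/KA|/LB]; [left|right].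
move=> J uJ KJ JAB.
have -> : \prod_(i <- J) F i =
    \prod_(i <- [seq i <- J | i \in A]) F i * \prod_(i <- [seq i <- J | i \in B]) F i.
  rewrite (bigID (fun i => i \in A)) /= !big_filter; congr (_ * _).
  rewrite big_seq_cond [RHS]big_seq_cond; apply: eq_bigl => i.
  case iJ : (i \in J) => //=; have := JAB _ iJ.
  move=> AorB; apply/idP/idP => [/negP h|h].
    by case: AorB => [iA|iB]; [case: h; exact: mem_set|exact: mem_set].
  by apply/negP => iA; apply: (AB i); exact: set_mem.
have e11 : e1 <= 1 by rewrite ge_min lexx orbT.
apply: (@le_lt_trans _ _ (e1 * c)).
  apply: normc_mul_close => //.
    apply: HK; first exact: filter_uniq.
      move=> i iK; rewrite mem_filter KJ ?mem_cat ?iK// andbT.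
      exact/mem_set/KA.
    by move=> i; rewrite mem_filter => /andP[/set_mem].
  apply: HL; first exact: filter_uniq.
    move=> i iK; rewrite mem_filter KJ ?mem_cat ?iK ?orbT// andbT.
    exact/mem_set/LB.
  by move=> i; rewrite mem_filter => /andP[/set_mem].
apply: (@le_lt_trans _ _ (e / 2 / c * c)); last by rewrite divfK ?gt_eqF//; lra.
by rewrite ler_wpM2r ?(ltW c0)// ge_min lexx.
Qed.

Lemma uprod_reindex (I' I : eqType) (g : I' -> I) (h : I -> I') (A' : set I')
    (A : set I) (F : I -> C) l :
  (forall i', A' i' -> A (g i')) -> (forall i, A i -> A' (h i)) ->
  (forall i', A' i' -> h (g i') = i') -> (forall i, A i -> g (h i) = i) ->
  uprod A F l -> uprod A' (fun i' => F (g i')) l.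
Proof.
move=> gA hA hg gh H e /H [K KA HK].
exists (map h K); first by move=> _ /mapP[i iK ->]; exact/hA/KA.
move=> J uJ KJ JA; rewrite -(big_map g xpredT F); apply: HK.
- rewrite map_inj_in_uniq// => i j iJ jJ gij.
  by rewrite -(hg i (JA _ iJ)) gij hg//; exact: JA.
- move=> i iK; rewrite -(gh i (KA _ iK)); apply: map_f; apply: KJ.
  exact: map_f.
- by move=> _ /mapP[i iJ ->]; exact/gA/JA.
Qed.

Lemma uprod_neq0 (I : eqType) (A : set I) (F : I -> C) l :
  usum A (fun i => normc (1 - F i)) -> (forall i, A i -> F i != 0) ->
  uprod A F l -> l != 0.
Proof.
move=> sA F0 H.
have h20 : 0 < 2^-1 :> R by rewrite invr_gt0.
have [K [uK KA] HK] := uprod_approx sA h20.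
set c := normc (\prod_(i <- K) F i) in HK.
have c0 : 0 < c.
  rewrite normc_gt0// prodf_seq_neq0; apply/allP => i iK /=.
  exact/F0/KA.
have c20 : 0 < c / 2 by rewrite divr_gt0.
have [L LA HL] := H _ c20; apply/negP => /eqP l0.
have uJ : uniq (undup (K ++ L)) by exact: undup_uniq.
have JA i : i \in undup (K ++ L) -> A i.
  by rewrite mem_undup mem_cat => /orP[/KA|/LA].
have h1 : normc (\prod_(i <- undup (K ++ L)) F i - l) < c / 2.
  by apply: HL => // i iL; rewrite mem_undup mem_cat iL orbT.
have := HK _ uJ JA; set P := \prod_(i <- undup _) _ in h1 * => h2.
have {}h2 : normc (P - \prod_(i <- K) F i) <= 2^-1 * c.
  by apply: h2 => i iL; rewrite mem_undup mem_cat iL.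
rewrite l0 subr0 in h1.
have := le_normcD P (- (P - \prod_(i <- K) F i)); rewrite normcN.
have -> : P - (P - \prod_(i <- K) F i) = \prod_(i <- K) F i by ring.
rewrite -/c; lra.
Qed.

Lemma uprod_nat (F : nat -> C) l : uprod setT F l ->
  forall e : R, 0 < e -> exists N : nat, forall n, (N <= n)%N ->
    normc (\prod_(0 <= j < n) F j - l) < e.
Proof.
move=> H e /H [K _ HK]; exists (\max_(i <- K) i.+1)%N => n hn.
rewrite /index_iota subn0; apply: HK => //; first exact: iota_uniq.
move=> i iK; rewrite mem_iota /= add0n; apply: leq_trans hn.
by rewrite (big_rem i iK) /= leq_max leqnn.
Qed.

(** The injection [g] sends a finite list of indices into a finite square, over which the double
    geometric sum factors. *)
Lemma usum_geometric (I : eqType) (A : set I) (u : I -> R) (g : I -> nat * nat)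
    (c x y : R) : 0 <= c -> 0 <= x < 1 -> 0 <= y < 1 ->
  (forall i j, A i -> A j -> g i = g j -> i = j) ->
  (forall i, A i -> u i <= c * (x ^+ (g i).1 * y ^+ (g i).2)) -> usum A u.
Proof.
move=> c0 /andP[x0 x1] /andP[y0 y1] ginj ub.
have geo (z : R) n : 0 <= z -> z < 1 -> \sum_(0 <= i < n) z ^+ i <= (1 - z)^-1.
  move=> z0 z1; have z10 : 0 < 1 - z by lra.
  rewrite -[leRHS]mul1r ler_pdivlMr// mulrC big_mkord.
  rewrite -(opprB z 1) mulNr -subrX1 opprB gerBl.
  exact: exprn_ge0.
exists (c * ((1 - x)^-1 * (1 - y)^-1)) => J uJ JA.
pose f (p : nat * nat) := x ^+ p.1 * y ^+ p.2.
have f0 p : 0 <= f p by rewrite mulr_ge0// exprn_ge0.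
apply: (@le_trans _ _ (c * \sum_(p <- map g J) f p)).
  rewrite big_map mulr_sumr big_seq [leRHS]big_seq; apply: ler_sum => i /JA.
  exact: ub.
rewrite ler_wpM2l//.
have uJ' : uniq (map g J).
  by rewrite map_inj_in_uniq// => i j /JA iA /JA jA; exact: ginj.
move: (map g J) uJ' => L uL.
pose N := (\max_(p <- L) (maxn p.1 p.2).+1)%N.
have LN p : p \in L -> (p.1 < N)%N /\ (p.2 < N)%N.
  move=> pL; have : ((maxn p.1 p.2).+1 <= N)%N.
    by rewrite /N (big_rem p pL) /= leq_maxl.
  by rewrite gtn_max => /andP[].
apply: (@le_trans _ _ (\sum_(0 <= a < N) \sum_(0 <= b < N) f (a, b))); last first.
  rewrite /f /= -big_distrlr /=; apply: ler_pM; rewrite ?geo//.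
    by apply: sumr_ge0 => i _; exact: exprn_ge0.
  by apply: sumr_ge0 => i _; exact: exprn_ge0.
pose Q := [seq (a, b) | a <- index_iota 0 N, b <- index_iota 0 N].
have -> : \sum_(0 <= a < N) \sum_(0 <= b < N) f (a, b) = \sum_(p <- Q) f p.
  by rewrite big_allpairs.
have -> : \sum_(p <- L) f p = \sum_(p <- [seq p <- Q | p \in L]) f p.
  apply: perm_big; apply: uniq_perm => //.
    by apply: filter_uniq; apply: allpairs_uniq; rewrite ?iota_uniq// => -[? ?] [? ?].
  move=> p; rewrite mem_filter; symmetry; apply: andb_idr => /LN[h1 h2].
  by case: p h1 h2 => a b /= h1 h2; apply: allpairs_f; rewrite mem_index_iota.
rewrite big_filter [leRHS](bigID (mem L)) /= lerDl.
by apply: sumr_ge0.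
Qed.

End UnconditionalProducts.

(** * Theta and gamma products *)

Section CexpTwoPi.
Variable R : realType.
Local Notation C := R[i].
Local Notation e := (@cexp2pi R).

Lemma cexp2piD z w : e (z + w) = e z * e w.
Proof. by rewrite /cexp2pi mulrDr cexpD. Qed.

Lemma cexp2pi0 : e 0 = 1.
Proof. by rewrite /cexp2pi mulr0 cexp0. Qed.

Lemma cexp2pi_int (n : int) : e n%:~R = 1.
Proof.
have -> : n%:~R = n%:~R%:C%C :> C by rewrite rmorph_int.
rewrite /cexp2pi -[RHS](@cexp0 R) -(cexp_period 0 n) add0r; congr cexp.
by simpc.
Qed.

Lemma cexp2piDint z (n : int) : e (z + n%:~R) = e z.
Proof. by rewrite cexp2piD cexp2pi_int mulr1. Qed.

Lemma cexp2piN z : e (- z) = (e z)^-1.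
Proof.
have := cexp2piD z (- z); rewrite subrr cexp2pi0 => h.
have z0 : e z != 0 by exact: cexp_neq0.
by rewrite -[LHS](mulKf z0) -h mulr1.
Qed.

Lemma normc_cexp2pi z : normc (e z) = expR (- (2 * pi) * Im z).
Proof. by rewrite /cexp2pi normc_cexp; case: z => a b; simpc. Qed.

(** The modulus forces [z] to be real. For its fractional part [f], cos(2 pi f) = 1 gives sin(pi f)
    = 0, which is impossible if 0 < f < 1. *)
Lemma cexp2pi_eq1 z : e z = 1 -> exists n : int, z = n%:~R.
Proof.
move=> ez; have := congr1 (@normc R) ez; rewrite normc_cexp2pi normc1.
rewrite -[RHS]expR0 => /expR_inj /eqP; rewrite mulNr oppr_eq0 mulf_eq0.
have pi0 : 2 * pi != 0 :> R by rewrite mulf_neq0// gt_eqF// pi_gt0.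
rewrite (negbTE pi0) /= => /eqP Imz.
exists (Num.floor (Re z)).
pose f := Re z - (Num.floor (Re z))%:~R.
have zE : z = f%:C%C + (Num.floor (Re z))%:~R.
  have -> : (Num.floor (Re z))%:~R = (Num.floor (Re z))%:~R%:C%C :> C by rewrite rmorph_int.
  by move: Imz; rewrite /f; case: (z) => a b /= ->; simpc; rewrite subrK.
have ef : e f%:C%C = 1 by rewrite -ez zE cexp2piDint.
have /andP[f0 f1] : 0 <= f < 1.
  have := floor_itv (Re z); rewrite intrD /f => /andP[h1 h2].
  by rewrite subr_ge0 h1 /= ltrBlDl.
suff f00 : f = 0 by rewrite [LHS]zE f00 add0r.
apply/eqP; rewrite eq_le f0 andbT leNgt; apply/negP => fp.
have : cos (2 * pi * f) = 1.
  move: ef; rewrite /cexp2pi /cexp; simpc => /=; rewrite expR0 mul1r.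
  by move=> /(congr1 (@complex.Re R)).
have -> : 2 * pi * f = (pi * f) *+ 2 by rewrite mulr_natl mulrnAl.
rewrite cos_mulr2n; have := cos2Dsin2 (pi * f).
have s0 : 0 < sin (pi * f) by rewrite sin_gt0_pi// mulr_gt0 ?pi_gt0// gtr_pMr ?pi_gt0.
have : 0 < sin (pi * f) ^+ 2 by rewrite exprn_gt0.
set a := cos _ ^+ 2; set b := sin _ ^+ 2; rewrite mulr2n; lra.
Qed.

End CexpTwoPi.

(** * Bernoulli polynomials behind h2 and h3 *)

Section RealCubic.
Variable R : realType.
Implicit Types (z t s : R).

(** [R3 z t s] is the multiple Bernoulli polynomial B_{2,3}(z | t, s), and the bracket in [h2r] is
    B_{1,2}(z | s). The lemmas below are their classical symmetry, reflection, difference and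
    multiplication formulas; the weights 2 pi / 3 and 2 pi fit because B_{2,3}(z + t) - B_{2,3}(z) =
    3 B_{1,2}(z | s). *)
Definition h3r z t s : R := expR (- (2 * pi / 3) * R3 z t s).
Definition h2r z s : R := expR (- (2 * pi) * (z ^+ 2 / s - z + s / 6)).

Lemma h3E (z t s : R[i]) : h3 z t s = h3r (Im z) (Im t) (Im s).
Proof. by []. Qed.

Lemma h2E (z s : R[i]) : h2 z s = h2r (Im z) (Im s).
Proof.
rewrite /h2 /h2r; congr expR.
have -> : Im (z - s / 6%:R) = Im z - Im s / 6.
  have -> : 6%:R^-1 = (6^-1)%:C%C :> R[i] by rewrite fmorphV rmorph_nat.
  by case: z s => [? ?] [? ?]; simpc => /=; rewrite mulrC.
ring.
Qed.

Lemma h3r_gt0 z t s : 0 < h3r z t s.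
Proof. exact: expR_gt0. Qed.

Lemma h3r_sym z t s : h3r z t s = h3r z s t.
Proof.
rewrite /h3r /R3; congr (expR (_ * _)).
by rewrite (mulrC t s) (addrC t^-1) (addrC (t / _)) (addrC t s).
Qed.

Lemma h3r_opp z t s : t != 0 -> s != 0 -> h3r (- z) (- t) (- s) = (h3r z t s)^-1.
Proof.
move=> t0 s0; rewrite /h3r -expRN; congr expR; rewrite /R3.
by field; rewrite s0 t0.
Qed.

Lemma h3r_reflect z t s : t != 0 -> s != 0 -> h3r (t + s - z) t s = (h3r z t s)^-1.
Proof.
move=> t0 s0; rewrite /h3r -expRN; congr expR; rewrite /R3.
by field; rewrite s0 t0.
Qed.

Lemma h3r_shift z t s : t != 0 -> s != 0 -> h3r (z + t) t s = h3r z t s * h2r z s.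
Proof.
move=> t0 s0; rewrite /h3r /h2r -expRD; congr expR; rewrite /R3.
by field; rewrite s0 t0.
Qed.

(** A Taylor expansion of [R3] in its first variable, summed by the closed forms for the sums of i,
    i^2 and i^3. It serves the multiplication formula [h3r_mult], where [u] is [n%:R * t]. *)
Lemma R3_sum z t u s (n : nat) : u != 0 -> s != 0 ->
  \sum_(0 <= i < n) R3 (z + i%:R * t) u s =
  n%:R * R3 z u s
  + (3 * z ^+ 2 / (u * s) - 3 * (u^-1 + s^-1) * z + (u / (2 * s) + s / (2 * u) + 3 / 2))
    * t * (n%:R * (n%:R - 1) / 2)
  + (3 * z / (u * s) - 3 / 2 * (u^-1 + s^-1)) * t ^+ 2
    * (n%:R * (n%:R - 1) * (2 * n%:R - 1) / 6)
  + t ^+ 3 / (u * s) * (n%:R * (n%:R - 1) / 2) ^+ 2.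
Proof.
move=> u0 s0; elim: n => [|n IH]; first by rewrite big_geq//; ring.
rewrite big_nat_recr//= IH -natr1 /R3.
by field; rewrite u0 s0.
Qed.

Lemma h3r_mult z t s (n : nat) : (0 < n)%N -> t != 0 -> s != 0 ->
  \prod_(0 <= i < n) h3r (z + i%:R * t) (n%:R * t) s = h3r z t s.
Proof.
move=> n0 t0 s0; rewrite /h3r -expR_sum -mulr_sumr; congr (expR (_ * _)).
have n0' : n%:R != 0 :> R by rewrite pnatr_eq0 -lt0n.
rewrite R3_sum ?mulf_neq0// /R3.
by field; rewrite n0' s0 t0.
Qed.

End RealCubic.

(** * The theta function and its norm *)

Section Theta.
Variable R : realType.
Local Notation C := R[i].
Local Notation e := (@cexp2pi R).
Implicit Types z tau : R[i].

Definition theta_norm z tau : R := normc (theta0 z tau) ^+ 2 * h2 z tau.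

Lemma Im_intr (n : int) z : Im (n%:~R * z) = n%:~R * Im z.
Proof.
have -> : n%:~R = n%:~R%:C%C :> C by rewrite rmorph_int.
by case: z => a b; simpc.
Qed.

Lemma ImD z (w : C) : Im (z + w) = Im z + Im w.
Proof. by case: z w => [? ?] [? ?]. Qed.

Lemma ImN z : Im (- z) = - Im z.
Proof. by case: z. Qed.

Lemma cvg_eq_lim (u v : nat -> C) (l m : C) : u @ \oo --> l -> v @ \oo --> m ->
  u =1 v -> l = m.
Proof.
move=> ul vm uv; apply: (cvg_unique (@norm_hausdorff _ _) ul).
by have -> : u = v by exact/funext.
Qed.

Lemma cvg_mulC (u v : nat -> C) (l m : C) : u @ \oo --> l -> v @ \oo --> m ->
  (fun n => u n * v n) @ \oo --> l * m.
Proof.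
move=> ul vm Y /nbhs_normcP[d d0 dY].
pose c := normc l + normc m + 1.
have c0 : 0 < c by rewrite ltr_wpDl// addr_ge0 ?normc_ge0.
pose d1 := Num.min (d / 2 / c) 1.
have d10 : 0 < d1 by rewrite lt_min ltr01 andbT !divr_gt0.
have d11 : d1 <= 1 by rewrite ge_min lexx orbT.
have ball (x : C) : nbhs x [set z | normc (z - x) < d1] by apply/nbhs_normcP; exists d1.
have [N1 _ HN1] := ul _ (ball l); have [N2 _ HN2] := vm _ (ball m).
exists (maxn N1 N2) => // n /=; rewrite geq_max => /andP[n1 n2]; apply: dY.
apply: (@le_lt_trans _ _ (d1 * c)).
  exact: (normc_mul_close d10 d11 (HN1 _ n1) (HN2 _ n2)).
apply: (@le_lt_trans _ _ (d / 2 / c * c)); last by rewrite divfK ?gt_eqF//; lra.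
by rewrite ler_wpM2r ?(ltW c0)// ge_min lexx.
Qed.

(** The q-Pochhammer symbol with base [e tau] and argument [e z]. [theta0] is a product of two of
    them; being unconditional, they can be matched with products over half-lines in a cone. *)
Definition qprod tau z : C := iprod setT (fun j : nat => 1 - e (j%:R * tau + z)).

Section Period.
Variable tau : C.
Hypothesis tau0 : 0 < Im tau.

Lemma usum_qprod z : usum setT (fun j : nat => normc (1 - (1 - e (j%:R * tau + z)))).
Proof.
have pi0 : 0 < 2 * pi :> R by rewrite mulr_gt0// pi_gt0.
(* A single geometric series: the second ratio and the second exponent are 0, and 0 ^ 0 = 1. *)
apply: (@usum_geometric R nat setT _ (fun j => (j, 0%N)) (expR (- (2 * pi) * Im z))
   (expR (- (2 * pi) * Im tau)) 0).
- exact: expR_ge0.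
- by rewrite expR_ge0/= -[ltRHS](@expR0 R) ltr_expR mulNr oppr_lt0 mulr_gt0.
- by rewrite lexx ltr01.
- by move=> i j _ _ [].
- move=> j _; rewrite /fst /snd expr0 mulr1 subKr normc_cexp2pi ImD (_ : j%:R = j%:Z%:~R) ?Im_intr//.
  rewrite -expRM_natl -expRD ler_expR le_eqVlt; apply/orP; left; apply/eqP.
  by rewrite -pmulrn; ring.
Qed.

Lemma uprod_qprod z :
  uprod setT (fun j : nat => 1 - e (j%:R * tau + z)) (qprod tau z).
Proof. by have [l Hl] := uprod_ex (usum_qprod z); rewrite /qprod (uprod_iprod Hl). Qed.

Lemma qprod_cvg z :
  (\prod_(0 <= j < n) (1 - e (j%:R * tau + z))) @[n --> \oo] --> qprod tau z.
Proof.
move=> Y /nbhs_normcP[d d0 dY]; have [N HN] := uprod_nat (uprod_qprod z) d0.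
by exists N => // n /= Nn; apply: dY; exact: HN.
Qed.

Lemma theta0E z : theta0 z tau = qprod tau (tau - z) * qprod tau z.
Proof.
apply: cvg_lim; first exact: norm_hausdorff.
have L := cvg_mulC (@qprod_cvg (tau - z)) (@qprod_cvg z).
have -> : (fun n => \prod_(0 <= j < n) ((1 - e (j.+1%:R * tau - z)) * (1 - e (j%:R * tau + z))))
  = (fun n => \prod_(0 <= j < n) (1 - e (j%:R * tau + (tau - z))) *
      \prod_(0 <= j < n) (1 - e (j%:R * tau + z))); last exact: L.
apply/funext => n; rewrite -big_split /=; apply: eq_bigr => j _; congr ((1 - e _) * _).
by rewrite -natr1; ring.
Qed.

Lemma qprodS z : qprod tau z = (1 - e z) * qprod tau (z + tau).
Proof.
have lim1 := @qprod_cvg z; rewrite -cvg_shiftS /= in lim1.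
apply: (cvg_eq_lim lim1 (cvg_mulC (cvg_cst (1 - e z)) (@qprod_cvg (z + tau)))) => n.
rewrite big_nat_recl//= mul0r add0r; congr (_ * _).
by apply: eq_bigr => j _; congr (1 - e _); rewrite -natr1; ring.
Qed.

Lemma qprodDint z (n : int) : qprod tau (z + n%:~R) = qprod tau z.
Proof. by congr iprod; apply/funext => j; rewrite addrA cexp2piDint. Qed.

Lemma qprod_neq0 z : (forall j : nat, e (j%:R * tau + z) != 1) -> qprod tau z != 0.
Proof.
move=> H; apply: (uprod_neq0 (usum_qprod z) _ (uprod_qprod z)) => j _.
by rewrite subr_eq0 eq_sym.
Qed.

Lemma theta0_neq0 z : (forall j : int, e (j%:~R * tau + z) != 1) -> theta0 z tau != 0.
Proof.
move=> H; rewrite theta0E mulf_neq0// qprod_neq0// => j; last by rewrite pmulrn.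
have := H (- (j%:Z + 1)); apply: contra => /eqP E; apply/eqP.
rewrite -[RHS]invr1 -[in RHS]E -cexp2piN; congr e.
by rewrite rmorphN rmorphD /= -pmulrn; ring.
Qed.

Lemma theta0Dint z (n : int) : theta0 (z + n%:~R) tau = theta0 z tau.
Proof.
rewrite !theta0E qprodDint; congr (_ * _).
by rewrite opprD addrA -rmorphN qprodDint.
Qed.

(* If [e z = 1], both sides vanish and the relation obtained from [qprodS] is
   void. *)
Lemma theta0Dtau z : theta0 (z + tau) tau = - e (- z) * theta0 z tau.
Proof.
have E : theta0 (z + tau) tau * (1 - e z) = (1 - e (- z)) * theta0 z tau.
  rewrite !theta0E (qprodS z) [qprod tau (tau - (z + tau))]qprodS.
  have -> : tau - (z + tau) = - z by ring.
  have -> : - z + tau = tau - z by ring.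
  by ring.
have [ez|ez] := eqVneq (e z) 1.
  have h1 : qprod tau z = 0 by rewrite qprodS ez subrr mul0r.
  have h2 : qprod tau (- z) = 0 by rewrite qprodS cexp2piN ez invr1 subrr mul0r.
  rewrite !theta0E h1 mulr0 mulr0.
  by rewrite (_ : tau - (z + tau) = - z) ?h2 ?mul0r//; ring.
have n0 : 1 - e z != 0 by rewrite subr_eq0 eq_sym.
apply: (mulIf n0); rewrite E.
have -> : 1 - e (- z) = - e (- z) * (1 - e z); last by ring.
by rewrite mulrBr mulr1 mulNr -cexp2piD addNr cexp2pi0; ring.
Qed.

(** Since (1 - e(u))(1 - e(u + 1/2)) = 1 - e(2u), the factors of index n at the first two points
    give the factor of index 2n at [2 * z], those at the other two the factor of index 2n + 1.
    Partial products of length n thus match one of length 2n. *)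
Lemma qprod_dist z :
  qprod tau z * qprod tau (z + 1 / 2) *
  (qprod tau (z + tau / 2) * qprod tau (z + (1 / 2 + tau / 2))) = qprod tau (2 * z).
Proof.
have L := cvg_mulC (cvg_mulC (@qprod_cvg z) (@qprod_cvg (z + 1 / 2)))
  (cvg_mulC (@qprod_cvg (z + tau / 2)) (@qprod_cvg (z + (1 / 2 + tau / 2)))).
have dbl : (fun n => n.*2) @ \oo --> \oo.
  by move=> Y [N _ NY]; exists N => // n /= Nn; apply: NY => /=; lia.
have L2 := cvg_comp _ _ dbl (@qprod_cvg (2 * z)).
apply: (cvg_eq_lim L L2) => n /=.
have eh (u : C) : (1 - e u) * (1 - e (u + 1 / 2)) = 1 - e (2 * u).
  have hh : e (1 / 2) = -1.
    have : (e (1 / 2) - 1) * (e (1 / 2) + 1) = 0.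
      have -> : (e (1 / 2) - 1) * (e (1 / 2) + 1) = e (1 / 2) * e (1 / 2) - 1 by ring.
      rewrite -cexp2piD; have -> : 1 / 2 + 1 / 2 = 1%:~R :> C by field.
      by rewrite cexp2pi_int subrr.
    move/eqP; rewrite mulf_eq0 => /orP[|]; last by rewrite addr_eq0 => /eqP.
    rewrite subr_eq0 => /eqP/cexp2pi_eq1[m] /eqP.
    have n2 : (2 : C) != 0 by rewrite pnatr_eq0.
    rewrite div1r -(inj_eq (mulfI n2)) mulfV// eq_sym -[1]/(1%:~R) -[2]/(2%:~R).
    by rewrite -rmorphM eqr_int => /eqP; lia.
  have -> : 2 * u = u + u by ring.
  by rewrite !cexp2piD hh; ring.
elim: n => [|n IH]; first by rewrite !big_nil; ring.
rewrite doubleS !big_nat_recr//= -{}IH.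
have h1 := eh (n%:R * tau + z); have h2 := eh (n%:R * tau + (z + tau / 2)).
have -> : n.*2%:R * tau + 2 * z = 2 * (n%:R * tau + z) by rewrite -muln2 natrM; ring.
have -> : n.*2.+1%:R * tau + 2 * z = 2 * (n%:R * tau + (z + tau / 2)).
  by rewrite -natr1 -muln2 natrM; field.
rewrite -h1 -h2.
have -> : n%:R * tau + (z + (1 / 2 + tau / 2)) = n%:R * tau + (z + tau / 2) + 1 / 2 by ring.
have -> : n%:R * tau + (z + 1 / 2) = n%:R * tau + z + 1 / 2 by ring.
ring.
Qed.

Lemma theta0_dist z :
  theta0 z tau * theta0 (z + 1 / 2) tau *
  (theta0 (z + tau / 2) tau * theta0 (z + (1 / 2 + tau / 2)) tau) = theta0 (2 * z) tau.
Proof.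
have half : 1 / 2 = 1 / 2 - 1%:~R + 1 :> C by ring.
rewrite !theta0E -(qprod_dist z).
(* The points tau - z - omega, with omega among the four 2-torsion points, are up to integers the
   translates of tau / 2 - z by those same points. *)
have -> : tau - 2 * z = 2 * (tau / 2 - z) by field.
rewrite -qprod_dist.
have -> : tau / 2 - z + tau / 2 = tau - z by field.
have -> : tau / 2 - z + 1 / 2 = tau - (z + (1 / 2 + tau / 2)) + 1%:~R by field.
have -> : tau / 2 - z + (1 / 2 + tau / 2) = tau - (z + 1 / 2) + 1%:~R by field.
have -> : tau / 2 - z = tau - (z + tau / 2) by field.
rewrite !qprodDint; ring.
Qed.

Let tn0 : Im tau != 0. Proof. by rewrite gt_eqF. Qed.

Lemma theta_norm_gt0 z : (forall j : int, e (j%:~R * tau + z) != 1) -> 0 < theta_norm z tau.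
Proof.
by move=> H; rewrite mulr_gt0 ?expR_gt0// exprn_gt0// normc_gt0// theta0_neq0.
Qed.

Lemma theta_normDint z (n : int) : theta_norm (z + n%:~R) tau = theta_norm z tau.
Proof.
rewrite /theta_norm theta0Dint !h2E ImD.
have -> : Im (n%:~R : C) = 0 by rewrite -[n%:~R]mulr1 Im_intr /= mulr0.
by rewrite addr0.
Qed.

Lemma theta_normDtau z : theta_norm (z + tau) tau = theta_norm z tau.
Proof.
rewrite /theta_norm theta0Dtau normcM normcN normc_cexp2pi exprMn -mulrA.
have -> : expR (- (2 * pi) * Im (- z)) ^+ 2 * (normc (theta0 z tau) ^+ 2 * h2 (z + tau) tau)
  = normc (theta0 z tau) ^+ 2 * (expR (- (2 * pi) * Im (- z)) ^+ 2 * h2 (z + tau) tau) by ring.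
congr (_ * _); rewrite !h2E /h2r ImD ImN -expRM_natl -expRD; congr expR.
by field.
Qed.

(** The factors [h2] satisfy the relation of [theta0_dist] exactly: the term [tau / 6] is the one
    that leaves no constant over, and this is what later fixes the normalization. *)
Lemma theta_norm_dist z :
  theta_norm z tau * theta_norm (z + 1 / 2) tau *
  (theta_norm (z + tau / 2) tau * theta_norm (z + (1 / 2 + tau / 2)) tau)
  = theta_norm (2 * z) tau.
Proof.
have Im2 (u : C) : Im (u / 2) = Im u / 2.
  have -> : u / 2 = (2^-1)%:C%C * u by rewrite fmorphV /= rmorph_nat mulrC.
  by case: u => p q; simpc => /=; rewrite mulrC.
have I1 : Im (1 / 2 : C) = 0 by rewrite Im2 /= mul0r.
rewrite /theta_norm -theta0_dist !normcM !exprMn; set n1 := normc _; set n2 := normc _.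
set n3 := normc _; set n4 := normc _.
have : h2 z tau * h2 (z + 1 / 2) tau * (h2 (z + tau / 2) tau *
   h2 (z + (1 / 2 + tau / 2)) tau) = h2 (2 * z) tau.
  rewrite !h2E !ImD I1 !Im2 (_ : 2 = 2%:~R :> C)// Im_intr /h2r -!expRD.
  by congr expR; field.
by move=> <-; ring.
Qed.

End Period.
End Theta.

(** * Cone and box products in rank two *)

Section ConeProducts.
Variable R : realType.
Local Notation C := R[i].
Local Notation e := (@cexp2pi R).

(** For a pair (a, b) with a basis d, be, ga of the dual lattice such that ga is the direction
    vector, d(a) = 1, be(a) = 0, d(b) = r and be(b) = s, let [W], [D], [T] be w, d(x), be(x) divided
    by ga(x). The class of mu = m d + k be modulo Z ga is the pair [i = (m, k)]; then mu(a) = m,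
    mu(b) = [npt r s i], and [zpt W D T i] is (w + mu(x)) / ga(x). *)
Definition zpt (W D T : C) (i : int * int) : C := W + i.1%:~R * D + i.2%:~R * T.
Definition npt (r s : int) (i : int * int) : int := r * i.1 + s * i.2.
Definition cone (r s p q : int) : set (int * int) :=
  [set i | i.1 < p /\ q <= npt r s i].
Definition Gn (r s p q : int) (W D T : C) : C :=
  iprod (cone r s p q) (fun i => 1 - e (zpt W D T i)).
Definition box (r s a b p q : int) : set (int * int) :=
  [set i | p <= i.1 < p + a /\ q <= npt r s i < q + b].
Definition hbox (r s p q : int) (W D T : C) : R :=
  \big[*%R/1]_(i \in box r s s s p q)
    h3 (zpt W D T i) (s%:~R * D - r%:~R * T) T.
(** For [p = q = 0] this is |Gamma_{a,b}|^2 h_{a,b}. The cone taken with [- W] is the negative of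
    the opposite cone, where [i.1 >= p] and [npt r s i < q]; the vertex is variable so that the
    walls can be moved one at a time. *)
Definition hgam (r s p q : int) (W D T : C) : R :=
  hbox r s p q W D T *
  normc (Gn r s p q W D T / Gn r s (1 - p) (1 - q) (- W) D T) ^+ 2.

Lemma zptN W D T i : zpt W D T (- i.1, - i.2) = - zpt (- W) D T i.
Proof. by rewrite /zpt /= !rmorphN /=; ring. Qed.

Lemma absz_natr (n : int) : 0 <= n -> (absz n)%:R = n%:~R :> R.
Proof. by case: n. Qed.

Lemma set_bij_cancel (I J : choiceType) (A : set I) (B : set J) (g : I -> J) (h : J -> I) :
  (forall x, A x -> B (g x)) -> (forall y, B y -> A (h y)) ->
  (forall x, A x -> h (g x) = x) -> (forall y, B y -> g (h y) = y) ->
  set_bij A B g.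
Proof.
move=> gB hA hg gh; split.
- by move=> x; exact: gB.
- move=> x y /set_mem xA /set_mem yA gxy.
  by rewrite -(hg x xA) gxy hg.
- by move=> y yB; exists (h y); [exact: hA|exact: gh].
Qed.

(** The ceiling of (q - r m) / s, that is the lowest point of column [m] in the half-plane
    [q <= npt]. *)
Definition col_start (r s q m : int) : int := - ((r * m - q) %/ s)%Z.

Lemma col_startP (r s q m k : int) : 0 < s -> (q <= npt r s (m, k)) = (col_start r s q m <= k).
Proof.
move=> s0; rewrite /col_start /npt /= lerNl lez_divRL// mulNr; apply/idP/idP; lia.
Qed.

Lemma boxP (r s : int) (n c : nat) (p q : int) (i : int * int) : 0 < s ->
  box r s n (s * c%:Z) p q i <->
  p <= i.1 < p + n%:Z /\ col_start r s q i.1 <= i.2 < col_start r s q i.1 + c%:Z.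
Proof.
case: i => m k s0; rewrite /box /= (col_startP r q m k s0).
have -> : (npt r s (m, k) < q + s * c%:Z) = (k < col_start r s q m + c%:Z).
  have := col_startP r q m (k - c%:Z) s0.
  have -> : (q <= npt r s (m, k - c%:Z)) = ~~ (npt r s (m, k) < q + s * c%:Z).
    by rewrite -leNgt /npt /=; apply/idP/idP; lia.
  by move=> h; apply/negb_inj; rewrite h -leNgt; apply/idP/idP; lia.
by [].
Qed.

Lemma box_seq (r s : int) (n c : nat) (p q : int) : 0 < s ->
  box r s n (s * c%:Z) p q =
  [set` [seq (p + x%:Z, col_start r s q (p + x%:Z) + j%:Z) |
         x <- index_iota 0 n, j <- index_iota 0 c]].
Proof.
move=> s0; apply/seteqP; split=> [[m k] /(boxP _ _ _ _ _ _ s0)/= [h1 h2]|i /=].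
  have -> : (m, k) = (p + (absz (m - p)%R)%:Z,
      col_start r s q (p + (absz (m - p)%R)%:Z) + (absz (k - col_start r s q m)%R)%:Z).
    have -> : p + (absz (m - p)%R)%:Z = m by lia.
    by congr (_, _); lia.
  by apply: allpairs_f; rewrite mem_index_iota; lia.
move=> /allpairsP[[x j] /= []]; rewrite !mem_index_iota => h1 h2 ->.
by apply/boxP => //=; split; lia.
Qed.

Lemma box_prod (r s : int) (n c : nat) (p q : int) (F : int * int -> R) : 0 < s ->
  \big[*%R/1]_(i \in box r s n (s * c%:Z) p q) F i =
  \prod_(0 <= x < n) \prod_(0 <= j < c)
    F (p + x%:Z, col_start r s q (p + x%:Z) + j%:Z).
Proof.
move=> s0; rewrite box_seq// -fsbig_seq.
  by rewrite big_allpairs_dep.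
apply: allpairs_uniq; rewrite ?iota_uniq// => -[x j] [x' j'] _ _ /= [] E1 E2.
have E : x = x' by lia.
by subst x'; congr (_, _); lia.
Qed.

Lemma prod_nat_mul (f : nat -> R) (c n : nat) :
  \prod_(0 <= x < c * n) f x = \prod_(0 <= i < c) \prod_(0 <= x < n) f (i * n + x)%N.
Proof.
elim: c => [|c IH]; first by rewrite mul0n !big_geq.
rewrite big_nat_recr//= -IH mulSn addnC.
rewrite (@big_cat_nat _ _ _ (c * n))//=; last exact: leq_addr.
congr (_ * _); rewrite -{1}(add0n (c * n)%N) big_addn addKn.
by apply: eq_bigr => i _; rewrite addnC.
Qed.

Section Params.
Variables (r s : int) (D T : C).
Hypotheses (s0 : 0 < s) (T0 : 0 < Im T) (A0 : Im (s%:~R * D - r%:~R * T) < 0).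

Let A := Im (s%:~R * D - r%:~R * T) / s%:~R.
Let B := Im T / s%:~R.

Let sR0 : 0 < s%:~R :> R. Proof. by rewrite ltr0z. Qed.

Lemma Im_zpt W i : Im (zpt W D T i) =
  Im W + A * i.1%:~R + B * (npt r s i)%:~R.
Proof.
rewrite /zpt !ImD !Im_intr /A /B ImD ImN !Im_intr /npt rmorphD /= !rmorphM /=.
by field; rewrite gt_eqF.
Qed.

(** By [Im_zpt], Im [zpt] is affine with slope [A < 0] in [i.1] and [B > 0] in [npt r s i], so the
    terms decay geometrically in the distances to the two walls. *)
Lemma usum_cone (p q : int) W :
  usum (cone r s p q) (fun i => normc (1 - (1 - e (zpt W D T i)))).
Proof.
have pi0 : 0 < 2 * pi :> R by rewrite mulr_gt0// pi_gt0.
have Al : A < 0 by rewrite /A pmulr_llt0// invr_gt0.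
have Bg : 0 < B by rewrite /B divr_gt0.
pose x := expR (2 * pi * A); pose y := expR (- (2 * pi) * B).
pose c := expR (- (2 * pi) * (Im W + A * (p - 1)%:~R + B * q%:~R)).
apply: (@usum_geometric R (int * int)%type (cone r s p q) _
  (fun i : int * int => (absz (p - 1 - i.1)%R, absz (npt r s i - q)%R)) c x y).
- exact: expR_ge0.
- by rewrite expR_ge0/= -[ltRHS](@expR0 R) ltr_expR pmulr_rlt0.
- by rewrite expR_ge0/= -[ltRHS](@expR0 R) ltr_expR mulNr oppr_lt0 mulr_gt0.
- move=> [m k] [m' k'] [/= h1 h2] [/= h3 h4] [E1 E2].
  have mm : m = m' by lia.
  subst m'; congr (_, _); move: h2 h4 E2; rewrite /npt /= => h2 h4 E2.
  have : s * k = s * k' by lia.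
  by move/mulfI; apply; rewrite gt_eqF.
- move=> i [h1 h2]; rewrite subKr normc_cexp2pi Im_zpt /=.
  rewrite /c /x /y -!expRM_natl -!expRD ler_expR le_eqVlt; apply/orP; left; apply/eqP.
  have -> : (absz (p - 1 - i.1)%R)%:R = (p - 1 - i.1)%:~R :> R.
    by apply: absz_natr; case: i h1 {h2} => m k h1; rewrite /= in h1 *; lia.
  have -> : (absz (npt r s i - q)%R)%:R = (npt r s i - q)%:~R :> R.
    by apply: absz_natr; rewrite subr_ge0.
  by rewrite !rmorphB /=; ring.
Qed.

Lemma uprod_Gn p q W :
  uprod (cone r s p q) (fun i => 1 - e (zpt W D T i)) (Gn r s p q W D T).
Proof. by have [l Hl] := uprod_ex (usum_cone p q W); rewrite /Gn (uprod_iprod Hl). Qed.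

Definition generic_pt (W : C) : Prop := forall i, e (zpt W D T i) != 1.

Lemma generic_ptN W : generic_pt W -> generic_pt (- W).
Proof.
move=> gW i; have := gW (- i.1, - i.2); rewrite zptN cexp2piN.
by apply: contra => /eqP ->; rewrite invr1.
Qed.

Lemma Gn_neq0 p q W : generic_pt W -> Gn r s p q W D T != 0.
Proof.
move=> gW; apply: (uprod_neq0 (usum_cone p q W) _ (uprod_Gn p q W)) => i _.
by rewrite subr_eq0 eq_sym.
Qed.

(* The products over the half-lines removed from, respectively added to, the two
   cones when the wall m < p moves combine to a theta function. *)
Lemma Gn_step (p q : int) W (k0 : int) : (forall k, (q <= npt r s (p, k)) = (k0 <= k)) ->
  generic_pt W ->
  Gn r s (p + 1) q W D T / Gn r s (1 - (p + 1)) (1 - q) (- W) D T =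
  Gn r s p q W D T / Gn r s (1 - p) (1 - q) (- W) D T
    * theta0 (zpt W D T (p, k0)) T.
Proof.
move=> k0P gW; set z0 := zpt W D T (p, k0).
pose F1 (j : nat) := 1 - e (j%:R * T + z0).
pose F2 (j : nat) := 1 - e (j.+1%:R * T - z0).
pose col1 : set (int * int) := [set i | i.1 = p /\ k0 <= i.2].
pose col2 : set (int * int) := [set i | i.1 = - p /\ 1 - k0 <= i.2].
have sub1 : col1 `<=` cone r s (p + 1) q.
  by move=> [m k] [/= -> h]; split; rewrite /= ?k0P//; lia.
have sub2 : col2 `<=` cone r s (1 - p) (1 - q).
  move=> [m k] [/= -> h]; split => /=; first by lia.
  by have := k0P (- k); rewrite /npt /=; lia.
have [l1 Hl1] := uprod_ex (usum_subset sub1 (usum_cone (p + 1) q W)).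
have [l2 Hl2] := uprod_ex (usum_subset sub2 (usum_cone (1 - p) (1 - q) (- W))).
have E1 : Gn r s (p + 1) q W D T = Gn r s p q W D T * l1.
  apply: uprod_unique (uprod_Gn _ _ _) _.
  have -> : cone r s (p + 1) q = cone r s p q `|` col1.
    apply/seteqP; split=> [[m k] [/= h1 h2]|[m k] [[/= h1 h2]|/sub1//]].
      have [mp|mp] := ltP m p; first by left.
      have {h1 mp} mp : m = p by lia.
      by right; split => //=; rewrite -k0P -mp.
    by split=> //=; lia.
  apply: uprodU => //; last exact: uprod_Gn.
  by move=> [m k] [/= h1 _] [/= h2 _]; lia.
have E2 : Gn r s (1 - p) (1 - q) (- W) D T =
    Gn r s (1 - (p + 1)) (1 - q) (- W) D T * l2.
  apply: uprod_unique (uprod_Gn _ _ _) _.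
  have -> : cone r s (1 - p) (1 - q) = cone r s (1 - (p + 1)) (1 - q) `|` col2.
    apply/seteqP; split=> [[m k] [/= h1 h2]|[m k] [[/= h1 h2]|/sub2//]].
      have [mp|mp] := ltP m (- p); first by left; split => //=; lia.
      have {h1 mp} mp : m = - p by lia.
      right; split => //=; have := k0P (- k).
      by move: h2; rewrite /npt mp /=; lia.
    by split=> //=; lia.
  apply: uprodU => //; last exact: uprod_Gn.
  by move=> [m k] [/= h1 _] [/= h2 _]; lia.
have H1 : uprod setT F1 l1.
  have /(_ _ _ _ _ Hl1) := @uprod_reindex R nat _ (fun j => (p, k0 + j%:Z))
    (fun i => absz (i.2 - k0)%R) setT col1 (fun i => 1 - e (zpt W D T i)) l1.
  move=> H; apply: uprod_ext (H _ _ _ _).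
  - move=> j _; rewrite /F1 /z0 /zpt /= rmorphD /=; congr (1 - e _).
    by rewrite -pmulrn; ring.
  - by move=> j _; split => //=; lia.
  - by [].
  - by move=> j _ /=; lia.
  - by move=> [m k] [/= -> h]; congr (_, _); lia.
have H2 : uprod setT F2 l2.
  have /(_ _ _ _ _ Hl2) := @uprod_reindex R nat _ (fun j => (- p, 1 - k0 + j%:Z))
    (fun i => absz (i.2 - (1 - k0))%R) setT col2 (fun i => 1 - e (zpt (- W) D T i)) l2.
  move=> H; apply: uprod_ext (H _ _ _ _).
  - move=> j _; rewrite /F2 /z0 /zpt /= !rmorphD /= !rmorphN /=; congr (1 - e _).
    by rewrite -natr1 -pmulrn; ring.
  - by move=> j _; split => //=; lia.
  - by [].
  - by move=> j _ /=; lia.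
  - by move=> [m k] [/= -> h]; congr (_, _); lia.
have l20 : l2 != 0.
  have := Gn_neq0 (1 - p) (1 - q) (generic_ptN gW).
  by rewrite E2 mulf_eq0 negb_or => /andP[].
have -> : theta0 z0 T = l2 * l1.
  rewrite theta0E//; congr (_ * _); last exact: uprod_unique (uprod_qprod T0 _) H1.
  apply: uprod_unique (uprod_qprod T0 _) (uprod_ext _ H2) => j _.
  by rewrite /F2 -natr1; congr (1 - e _); ring.
rewrite E1 E2 invfM; set x := Gn _ _ _ _ _ _ _; set y := (Gn _ _ _ _ _ _ _)^-1.
have -> : x * (y / l2) * (l2 * l1) = x * l1 * y * (l2^-1 * l2) by ring.
by rewrite mulVf// mulr1.
Qed.

Let t := s%:~R * D - r%:~R * T.

Let tI0 : Im t != 0. Proof. by rewrite lt_eqF. Qed.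
Let TI0 : Im T != 0. Proof. by rewrite gt_eqF. Qed.

Let box1E' p q : box r s s s p q = box r s (absz s)%:Z (s * 1%:Z) p q.
Proof. by rewrite mulr1 gez0_abs// ltW. Qed.

Lemma zpt_shift W i : zpt W D T (i.1 + s, i.2 - r) = zpt W D T i + t.
Proof. by rewrite /zpt /t /= rmorphD rmorphB /=; ring. Qed.

Lemma col_start_shift q m : col_start r s q (m + s) = col_start r s q m - r.
Proof.
rewrite /col_start; have -> : r * (m + s) - q = r * s + (r * m - q) by ring.
by rewrite divzMDl ?gt_eqF//; ring.
Qed.

(** The box loses column [p] and gains column [p + s]. This is column [p] translated by [(s, - r)],
    which adds [t] to [zpt], so the quotient is given by the difference formula [h3r_shift]. *)
Lemma hbox_step (p q : int) W :
  hbox r s (p + 1) q W D T =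
  hbox r s p q W D T * h2 (zpt W D T (p, col_start r s q p)) T.
Proof.
rewrite /hbox !box1E' !box_prod//; set z0 := zpt W D T _.
pose f (m : int) := h3 (zpt W D T (m, col_start r s q m)) t T.
have fE m : \prod_(0 <= j < 1) h3 (zpt W D T (m, col_start r s q m + j%:Z))
    (s%:~R * D - r%:~R * T) T = f m.
  by rewrite big_nat1 addr0.
under eq_bigr do rewrite fE.
under [in RHS]eq_bigr do rewrite fE.
have -> : absz s = (absz s).-1.+1 by rewrite prednK// absz_gt0 gt_eqF.
set n := (absz s).-1.
rewrite big_nat_recr//= [in RHS]big_nat_recl//= addr0.
have -> : p + 1 + n%:Z = p + s by rewrite /n; lia.
have -> : f (p + s) = f p * h2 z0 T.
  rewrite /f col_start_shift (zpt_shift W (p, col_start r s q p)) -/z0 h2E !h3E ImD.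
  by rewrite h3r_shift.
under eq_bigr do rewrite -addrA -intS.
rewrite mulrCA mulrA; congr (_ * _ * _).
Qed.

Lemma hbox_neq0 p q W : hbox r s p q W D T != 0.
Proof.
rewrite /hbox box1E' box_prod//; rewrite gt_eqF//; apply: prodr_gt0 => x _.
by apply: prodr_gt0 => j _; exact: h3r_gt0.
Qed.

(** This point reflection turns [zpt] into [t + T - zpt], and R3 is odd about half the sum of its
    periods. It maps the box at [(p, q)] onto the box at [(1 - p, 1 - q)]. *)
Lemma h3_reflect W i : h3 (zpt (- W) D T (s - i.1, 1 - r - i.2)) t T =
  (h3 (zpt W D T i) t T)^-1.
Proof.
have -> : zpt (- W) D T (s - i.1, 1 - r - i.2) = t + T - zpt W D T i.
  by rewrite /zpt /t /= !rmorphB /=; ring.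
have := h3r_reflect (Im (zpt W D T i)) tI0 TI0.
by rewrite -ImN -!ImD.
Qed.

Lemma hbox_reflect p q W :
  hbox r s (1 - p) (1 - q) (- W) D T = (hbox r s p q W D T)^-1.
Proof.
have bij : set_bij (box r s s s p q) (box r s s s (1 - p) (1 - q))
    (fun i => (s - i.1, 1 - r - i.2)).
  apply: (@set_bij_cancel _ _ _ _ _ (fun i => (s - i.1, 1 - r - i.2))) => -[m k];
    rewrite /box /npt /=; try (by move=> _; congr (_, _); lia).
    by move=> [h1 h2]; split; lia.
  by move=> [h1 h2]; split; lia.
rewrite /hbox (reindex_fsbig _ _ _ _ bij) box1E' !box_prod//.
rewrite -prodfV; apply: eq_bigr => x _; rewrite -prodfV; apply: eq_bigr => j _.
exact: h3_reflect.
Qed.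

Theorem hgam_step (p q : int) W : generic_pt W ->
  hgam r s (p + 1) q W D T =
  hgam r s p q W D T * theta_norm (zpt W D T (p, col_start r s q p)) T.
Proof.
move=> gW; rewrite /hgam hbox_step (Gn_step (k0 := col_start r s q p))//; last first.
  by move=> k; exact: col_startP.
by rewrite normcM exprMn /theta_norm; ring.
Qed.

Theorem hgam_reflect (p q : int) W : generic_pt W ->
  hgam r s (1 - p) (1 - q) (- W) D T = (hgam r s p q W D T)^-1.
Proof.
move=> gW; rewrite /hgam hbox_reflect !opprK.
have -> : 1 - (1 - p) = p by ring.
have -> : 1 - (1 - q) = q by ring.
rewrite [RHS]invfM; congr (_ * _).
by rewrite -exprVn -normcV invf_div.
Qed.

Lemma hgam_neq0 p q W : generic_pt W -> hgam r s p q W D T != 0.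
Proof.
move=> gW; rewrite mulf_neq0 ?hbox_neq0// expf_neq0//.
rewrite gt_eqF// normc_gt0// mulf_neq0 ?invr_eq0 ?Gn_neq0//.
exact: generic_ptN.
Qed.

Lemma h3_mult (z : C) (c : nat) (u v : C) : (0 < c)%N -> Im u != 0 -> Im v != 0 ->
  \prod_(0 <= i < c) h3 (z + i%:R * u) (c%:R * u) v = h3 z u v.
Proof.
move=> c0 u0 v0; rewrite h3E -(h3r_mult (Im z) c0 u0 v0).
by apply: eq_bigr => i _; rewrite h3E ImD !pmulrn !Im_intr.
Qed.

Lemma h3_sym (z u v : C) : h3 z u v = h3 z v u.
Proof. by rewrite !h3E h3r_sym. Qed.

(** The multiplication formula in each of the two periods. This is why h_{a,b} does not depend on
    alpha and beta, which enter only through the multiples [c] and [c']. *)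
Lemma hbox_mult (c c' : nat) W : (0 < c)%N -> (0 < c')%N ->
  \big[*%R/1]_(i \in box r s (s * c%:Z) (s * c'%:Z) 0 0)
    h3 (zpt W D T i) (c%:R * t) (c'%:R * T) = hbox r s 0 0 W D T.
Proof.
move=> c0 c'0.
have cR0 : Im (c%:R * t) != 0.
  by rewrite pmulrn Im_intr mulf_neq0// intr_eq0; lia.
pose g (m : int) := zpt W D T (m, col_start r s 0 m).
have gE (m : int) (j : nat) : zpt W D T (m, col_start r s 0 m + j%:Z) = g m + j%:R * T.
  by rewrite /g /zpt /= rmorphD /= -pmulrn; ring.
have gS (m : int) (i : nat) : g (m + s * i%:Z) = g m + i%:R * t.
  elim: i => [|i IH]; first by rewrite mulr0 !addr0 mul0r addr0.
  have -> : m + s * i.+1%:Z = (m + s * i%:Z) + s by rewrite intS; ring.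
  rewrite /g col_start_shift (zpt_shift W (m + s * i%:Z, col_start r s 0 (m + s * i%:Z))).
  by rewrite -/(g (m + s * i%:Z)) -/(g m) IH -natr1; ring.
have inner (m : int) : \prod_(0 <= j < c')
    h3 (zpt W D T (m, col_start r s 0 m + j%:Z)) (c%:R * t) (c'%:R * T) =
    h3 (g m) (c%:R * t) T.
  rewrite h3_sym -(h3_mult (g m) c'0 TI0 cR0); apply: eq_big_nat => j _.
  by rewrite h3_sym gE.
have sE : s * c%:Z = (c * absz s)%N%:Z by rewrite PoszM gez0_abs ?(ltW s0)// mulrC.
rewrite /hbox box1E' sE !box_prod//.
under eq_bigr do rewrite inner.
rewrite prod_nat_mul exchange_big_nat /=.
apply: eq_big_nat => x _.
rewrite big_nat1 addr0 -/(g _) -(h3_mult _ c0 tI0 TI0).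
apply: eq_big_nat => i _; rewrite -gS.
have -> : 0 + (i * absz s + x)%N%:Z = 0 + x%:Z + s * i%:Z :> int; last by [].
by rewrite PoszD PoszM gez0_abs ?(ltW s0)//; ring.
Qed.

End Params.

Section Swap.
Variables (r s u v : int) (D T : C).
Hypotheses (s0 : 0 < s) (T0 : 0 < Im T) (A0 : Im (s%:~R * D - r%:~R * T) < 0)
  (bezout : u * r + v * s = 1).

(** The coordinates of the pair (b, a) in the basis u d + v be, s d - r be, - ga; the signs come
    from dividing by - ga(x). The map [sw] is the corresponding unimodular change of indices. *)
Let D' := - (u%:~R * D + v%:~R * T).
Let T' := - (s%:~R * D - r%:~R * T).

Let sw (i : int * int) : int * int := (npt r s i, v * i.1 - u * i.2).
Let ws (i : int * int) : int * int := (npt u s i, v * i.1 - r * i.2).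

Let swK i : ws (sw i) = i.
Proof.
case: i => m k; rewrite /ws /sw /npt /=; congr (_, _).
  have -> : u * (r * m + s * k) + s * (v * m - u * k) = (u * r + v * s) * m by ring.
  by rewrite bezout mul1r.
have -> : v * (r * m + s * k) - r * (v * m - u * k) = (u * r + v * s) * k by ring.
by rewrite bezout mul1r.
Qed.

Let wsK i : sw (ws i) = i.
Proof.
case: i => m k; rewrite /ws /sw /npt /=; congr (_, _).
  have -> : r * (u * m + s * k) + s * (v * m - r * k) = (u * r + v * s) * m by ring.
  by rewrite bezout mul1r.
have -> : v * (u * m + s * k) - u * (v * m - r * k) = (u * r + v * s) * k by ring.
by rewrite bezout mul1r.
Qed.

Let npt_sw i : npt u s (sw i) = i.1.
Proof. by rewrite -[RHS]/(i.1) -[in RHS](swK i). Qed.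

Let zpt_sw W i : zpt (- W) D' T' (sw i) = - zpt W D T i.
Proof.
have E (x y : int) : (x%:~R : C) * y%:~R = (x * y)%:~R by rewrite rmorphM.
case: i => m k; rewrite /zpt /sw /npt /D' /T' /=.
rewrite !(rmorphB, rmorphD, rmorphM) /=.
have b : u%:~R * r%:~R + v%:~R * s%:~R = 1 :> C.
  by rewrite -!rmorphM -rmorphD bezout.
have -> : - W + (r%:~R * m%:~R + s%:~R * k%:~R) * - (u%:~R * D + v%:~R * T) +
   (v%:~R * m%:~R - u%:~R * k%:~R) * - (s%:~R * D - r%:~R * T) =
   - (W + (u%:~R * r%:~R + v%:~R * s%:~R) * (m%:~R * D + k%:~R * T)) :> C by ring.
by rewrite b mul1r addrA.
Qed.

Lemma swap_T0 : 0 < Im T'.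
Proof. by rewrite ImN oppr_gt0. Qed.

Let swap_tE : s%:~R * D' - u%:~R * T' = - T.
Proof.
have b : u%:~R * r%:~R + v%:~R * s%:~R = 1 :> C.
  by rewrite -!rmorphM -rmorphD bezout.
have -> : s%:~R * D' - u%:~R * T' = - ((u%:~R * r%:~R + v%:~R * s%:~R) * T).
  by rewrite /D' /T'; ring.
by rewrite b mul1r.
Qed.

Lemma swap_A0 : Im (s%:~R * D' - u%:~R * T') < 0.
Proof. by rewrite swap_tE ImN oppr_lt0. Qed.

(** The numerator of Gamma_{b,a} is the denominator of Gamma_{a,b}: in the swapped coordinates the
    walls exchange their roles, and the indices change sign. *)
Lemma Gn_swap p q W : Gn u s q p (- W) D' T' = Gn r s (1 - p) (1 - q) (- W) D T.
Proof.
apply: uprod_unique (uprod_Gn s0 swap_T0 swap_A0 _ _ _) _.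
pose g (i : int * int) : int * int := (- (ws i).1, - (ws i).2).
pose h (i : int * int) := sw (- i.1, - i.2).
have := @uprod_reindex R (int * int)%type (int * int)%type g h
  (cone u s q p) (cone r s (1 - p) (1 - q)) (fun i => 1 - e (zpt (- W) D T i)).
move=> /(_ _ _ _ _ _ (uprod_Gn s0 T0 A0 _ _ _)) H.
apply: uprod_ext (H _ _ _ _).
- move=> i _; rewrite /g zptN opprK -zpt_sw wsK //.
- move=> i [h1 h2]; split; rewrite /g /=; first by rewrite -/(npt u s i); lia.
  have -> : npt r s (- (ws i).1, - (ws i).2) = - npt r s (ws i) by rewrite /npt /=; ring.
  have -> : npt r s (ws i) = i.1 by rewrite -[in RHS](wsK i).
  by case: i h1 {h2} => m k h1; rewrite /= in h1 *; lia.
- move=> i [h1 h2]; split; rewrite /h /=.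
    have -> : npt r s (- i.1, - i.2) = - npt r s i by rewrite /npt /=; ring.
    by lia.
  by rewrite npt_sw; case: i h1 {h2} => m k h1; rewrite /= in h1 *; lia.
- move=> i _; rewrite /g /h /= !opprK; have -> : ((ws i).1, (ws i).2) = ws i by case: (ws i).
  exact: wsK.
- by move=> i _; rewrite /g /h swK /= !opprK; case: i.
Qed.

Lemma hbox_swap p q W : hbox u s q p (- W) D' T' = (hbox r s p q W D T)^-1.
Proof.
have bij : set_bij (box r s s s p q) (box u s s s q p) sw.
  apply: (@set_bij_cancel _ _ _ _ _ ws) => //.
    by move=> i [h1 h2]; split; rewrite ?npt_sw.
  move=> i [h1 h2]; split => //.
  by have -> : npt r s (ws i) = i.1 by rewrite -[in RHS](wsK i).
rewrite /hbox (reindex_fsbig _ _ _ _ bij).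
have -> : box r s s s p q = box r s (absz s)%:Z (s * 1%:Z) p q.
  by rewrite mulr1 gez0_abs// ltW.
rewrite !box_prod//.
rewrite -prodfV; apply: eq_bigr => x _; rewrite -prodfV; apply: eq_bigr => j _.
rewrite zpt_sw swap_tE /T' h3_sym !h3E !ImN h3r_opp //.
  by rewrite lt_eqF.
by rewrite gt_eqF.
Qed.

(** Through this inversion a step of the wall [q] follows from a step of the wall [p] for the pair
    (b, a). *)
Theorem hgam_swap p q W : hgam u s q p (- W) D' T' = (hgam r s p q W D T)^-1.
Proof.
rewrite /hgam hbox_swap [RHS]invfM; congr (_ * _).
rewrite -exprVn -normcV invf_div Gn_swap.
have := Gn_swap (1 - p) (1 - q) (- W); rewrite !opprK => ->.
have -> : 1 - (1 - p) = p by ring.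
by have -> : 1 - (1 - q) = q by ring.
Qed.

End Swap.
End ConeProducts.

Section ConeShift.
Variable R : realType.
Local Notation C := R[i].
Local Notation e := (@cexp2pi R).
Variables (r s : int) (D T : C).

Lemma zpt_add W (i : int * int) p k :
  zpt W D T (i.1 + p, i.2 + k) = zpt (W + p%:~R * D + k%:~R * T) D T i.
Proof. by rewrite /zpt /= !rmorphD /=; ring. Qed.

Lemma npt_add (i : int * int) p k : npt r s (i.1 + p, i.2 + k) = npt r s i + npt r s (p, k).
Proof. by rewrite /npt /=; ring. Qed.

Lemma hbox_shift (p q p' k : int) W :
  hbox r s (p + p') (q + npt r s (p', k)) W D T =
  hbox r s p q (W + p'%:~R * D + k%:~R * T) D T.
Proof.
rewrite /hbox; have bij : set_bij (box r s s s p q)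
    (box r s s s (p + p') (q + npt r s (p', k))) (fun i => (i.1 + p', i.2 + k)).
  apply: (@set_bij_cancel _ _ _ _ _ (fun i => (i.1 - p', i.2 - k))).
  - by move=> [m k'] [/= h1 h2]; have /= := npt_add (m, k') p' k; split => /=; lia.
  - move=> [m k'] [/= h1 h2]; split => /=; first by lia.
    by have := npt_add (m - p', k' - k) p' k; rewrite /= !subrK; lia.
  - by move=> [m k'] _ /=; rewrite !addrK.
  - by move=> [m k'] _ /=; rewrite !subrK.
by rewrite (reindex_fsbig _ _ _ _ bij); apply: eq_fsbigr => i _; rewrite zpt_add.
Qed.

Lemma zpt_int W (n : int) i : zpt (W + n%:~R) D T i = zpt W D T i + n%:~R.
Proof. by rewrite /zpt; ring. Qed.

Lemma Gn_int p q W (n : int) : Gn r s p q (W + n%:~R) D T = Gn r s p q W D T.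
Proof. by congr iprod; apply/funext => i; rewrite zpt_int cexp2piDint. Qed.

Lemma hbox_int p q W (n : int) : hbox r s p q (W + n%:~R) D T = hbox r s p q W D T.
Proof.
apply: eq_fsbigr => i _; rewrite zpt_int !h3E ImD.
by have -> : Im (n%:~R : C) = 0; rewrite ?addr0// -[n%:~R]mulr1 Im_intr /= mulr0.
Qed.

Lemma hgam_int p q W (n : int) : hgam r s p q (W + n%:~R) D T = hgam r s p q W D T.
Proof. by rewrite /hgam hbox_int Gn_int opprD -rmorphN Gn_int. Qed.

Hypotheses (s0 : 0 < s) (T0 : 0 < Im T) (A0 : Im (s%:~R * D - r%:~R * T) < 0).

Lemma Gn_shift (p q p' k : int) W :
  Gn r s (p + p') (q + npt r s (p', k)) W D T =
  Gn r s p q (W + p'%:~R * D + k%:~R * T) D T.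
Proof.
apply: uprod_unique (uprod_Gn s0 T0 A0 _ _ _).
have U := uprod_Gn s0 T0 A0 (p + p') (q + npt r s (p', k)) W.
have := @uprod_reindex R (int * int)%type (int * int)%type
  (fun i => (i.1 + p', i.2 + k)) (fun i => (i.1 - p', i.2 - k))
  (cone r s p q) (cone r s (p + p') (q + npt r s (p', k)))
  (fun i => 1 - e (zpt W D T i)) _ _ _ _ _ U.
move=> H; apply: uprod_ext (H _ _ _ _).
- by move=> i _; rewrite zpt_add.
- by move=> [m k'] [/= h1 h2]; have /= := npt_add (m, k') p' k; split => /=; lia.
- move=> [m k'] [/= h1 h2]; split => /=; first by lia.
  by have := npt_add (m - p', k' - k) p' k; rewrite /= !subrK; lia.
- by move=> [m k'] _ /=; rewrite !addrK.
- by move=> [m k'] _ /=; rewrite !subrK.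
Qed.

(** Translating the indices by [(p, k)] moves the vertex from 0 to [(p, npt r s (p, k))] and is
    absorbed into [W]; the cone of the denominator is translated by [(- p, - k)]. *)
Lemma hgam_shift (p k : int) W :
  hgam r s p (npt r s (p, k)) W D T = hgam r s 0 0 (W + p%:~R * D + k%:~R * T) D T.
Proof.
rewrite /hgam; have := hbox_shift 0 0 p k W; rewrite !add0r => ->.
have := Gn_shift 0 0 p k W; rewrite !add0r => ->.
have := Gn_shift 1 1 (- p) (- k) (- W).
have -> : npt r s (- p, - k) = - npt r s (p, k) by rewrite /npt /=; ring.
move=> ->; rewrite !subr0 !rmorphN /=.
by have -> : - W + - p%:~R * D + - k%:~R * T = - (W + p%:~R * D + k%:~R * T) by ring.
Qed.

End ConeShift.

(** * Lattice geometry *)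

Section Coordinates.

Definition o0 : 'I_3 := @Ordinal 3 0 isT.
Definition o1 : 'I_3 := @Ordinal 3 1 isT.
Definition o2 : 'I_3 := @Ordinal 3 2 isT.

Lemma big3 (T : Type) (idx : T) (op : Monoid.law idx) (F : 'I_3 -> T) :
  \big[op/idx]_(i < 3) F i = op (F o0) (op (F o1) (F o2)).
Proof.
rewrite !big_ord_recl big_ord0 Monoid.mulm1.
by congr (op (F _) (op (F _) (F _))); apply: val_inj.
Qed.

Lemma ord3P (P : 'I_3 -> Prop) : P o0 -> P o1 -> P o2 -> forall i, P i.
Proof.
move=> h0 h1 h2 [[|[|[|n]]] hn] //.
- by rewrite (_ : Ordinal hn = o0)//; apply: val_inj.
- by rewrite (_ : Ordinal hn = o1)//; apply: val_inj.
- by rewrite (_ : Ordinal hn = o2)//; apply: val_inj.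
Qed.

Lemma row3P (K : Type) (u v : 'rV[K]_3) :
  u 0 o0 = v 0 o0 -> u 0 o1 = v 0 o1 -> u 0 o2 = v 0 o2 -> u = v.
Proof. by move=> *; apply/rowP; exact: ord3P. Qed.

Lemma mulmx_row_col (K : comNzRingType) (u : 'rV[K]_3) (v : 'cV[K]_3) :
  (u *m v) 0 0 = u 0 o0 * v o0 0 + u 0 o1 * v o1 0 + u 0 o2 * v o2 0.
Proof. by rewrite mxE big3 /= addrA. Qed.

Lemma pairingE (d : Dual) (a : Lam) :
  pairing d a = d 0 o0 * a o0 0 + d 0 o1 * a o1 0 + d 0 o2 * a o2 0.
Proof. exact: mulmx_row_col. Qed.

Lemma pairingDl (d d' : Dual) a : pairing (d + d') a = pairing d a + pairing d' a.
Proof. by rewrite /pairing mulmxDl mxE. Qed.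

Lemma pairingZl (n : int) (d : Dual) a : pairing (n *: d) a = n * pairing d a.
Proof. by rewrite /pairing -scalemxAl mxE. Qed.

Lemma pairingNl (d : Dual) a : pairing (- d) a = - pairing d a.
Proof. by rewrite /pairing mulNmx mxE. Qed.

Lemma pairing0l a : pairing 0 a = 0.
Proof. by rewrite /pairing mul0mx mxE. Qed.

Lemma pairing_mulmx (d : Dual) (g : 'M[int]_3) (a : Lam) :
  pairing (d *m g) a = pairing d (g *m a).
Proof. by rewrite /pairing mulmxA. Qed.

Definition det3 (K : comNzRingType) (u v w : 'rV[K]_3) : K :=
  u 0 o0 * (v 0 o1 * w 0 o2 - v 0 o2 * w 0 o1)
  - u 0 o1 * (v 0 o0 * w 0 o2 - v 0 o2 * w 0 o0)
  + u 0 o2 * (v 0 o0 * w 0 o1 - v 0 o1 * w 0 o0).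

Lemma det_mx33 (K : comNzRingType) (M : 'M[K]_3) :
  \det M = det3 (row o0 M) (row o1 M) (row o2 M).
Proof.
pose m (i j : nat) := M (inord i) (inord j).
have E i j : M i j = m i j by rewrite /m !inord_val.
rewrite (expand_det_row _ ord0) !big_ord_recl big_ord0 /cofactor.
rewrite !(expand_det_row _ ord0) !big_ord_recl !big_ord0 /cofactor !det_mx11.
by rewrite /det3 !mxE !E /= /bump /= !add1n !addn0; ring.
Qed.

Lemma primitiveP (v : Dual) : reflect (exists u : Lam, pairing v u = 1) (primitive v).
Proof.
have E : \big[gcdn/0%N]_i \big[gcdn/0%N]_j `|v i j|%N =
    gcdn `|v 0 o0| (gcdn `|v 0 o1| `|v 0 o2|).
  by rewrite big_ord1 big3.
rewrite /primitive E; apply: (iffP eqP) => [H|[u]].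
- have [x [y xy]] := Bezoutz (v 0 o1) (v 0 o2).
  have [z [w zw]] := Bezoutz (v 0 o0) (gcdz (v 0 o1) (v 0 o2)).
  exists (\col_i (if i == o0 then z else if i == o1 then w * x else w * y)).
  rewrite pairingE !mxE /=.
  have : gcdz (v 0 o0) (gcdz (v 0 o1) (v 0 o2)) = 1.
    by rewrite /gcdz /= H.
  by rewrite -zw -xy => <-; ring.
- rewrite pairingE => h; apply/eqP; rewrite -dvdn1.
  set g := gcdn _ _.
  have d0 : v 0 o0 \in dvdz g%:Z by rewrite dvdzE /= dvdn_gcdl.
  have d1 : v 0 o1 \in dvdz g%:Z.
    by rewrite dvdzE /= (dvdn_trans (dvdn_gcdr _ _))// dvdn_gcdl.
  have d2 : v 0 o2 \in dvdz g%:Z.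
    by rewrite dvdzE /= (dvdn_trans (dvdn_gcdr _ _))// dvdn_gcdr.
  suff : 1 \in dvdz g%:Z by rewrite dvdzE.
  by rewrite -h !rpredD// dvdz_mulr.
Qed.

Lemma primitive_trmx m n (v : 'M[int]_(m, n)) : primitive v^T = primitive v.
Proof.
rewrite /primitive exchange_big /=; congr (_ == _).
by apply: eq_bigr => i _; apply: eq_bigr => j _; rewrite mxE.
Qed.

Lemma primitive_colP (a : Lam) : reflect (exists u : Dual, pairing u a = 1) (primitive a).
Proof.
rewrite -primitive_trmx; apply: (iffP (primitiveP _)) => -[u h];
  exists u^T; rewrite -h !pairingE !mxE; ring.
Qed.

(** The kind of basis that a framing attaches to [a]. In coordinates [a] is the cross product of
    [be] and [ga], see [basis_atE]. *)
Record basis_at (a : Lam) (d be ga : Dual) : Prop := BasisAt {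
  basis_det : det3 d be ga = 1;
  basis_d : pairing d a = 1;
  basis_be : pairing be a = 0;
  basis_ga : pairing ga a = 0
}.

Definition cross (K : comNzRingType) (u v : 'rV[K]_3) (i : 'I_3) : K :=
  if i == o0 then u 0 o1 * v 0 o2 - u 0 o2 * v 0 o1 else
  if i == o1 then u 0 o2 * v 0 o0 - u 0 o0 * v 0 o2 else
  u 0 o0 * v 0 o1 - u 0 o1 * v 0 o0.

(** Cramer's rule for recovering [a] from the values of three forms. *)
Lemma det3_expand (d be ga : Dual) (a : Lam) (i : 'I_3) :
  det3 d be ga * a i 0 = cross be ga i * pairing d a
    + cross ga d i * pairing be a + cross d be i * pairing ga a.
Proof.
by rewrite !pairingE; elim/ord3P: i; rewrite /cross /det3 /=; ring.
Qed.

Section BasisAt.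
Variables (a : Lam) (d be ga : Dual).
Hypothesis B : basis_at a d be ga.

Lemma basis_atE i : a i 0 = cross be ga i.
Proof.
rewrite -[LHS]mul1r -(basis_det B) det3_expand (basis_d B) (basis_be B) (basis_ga B).
by ring.
Qed.

Lemma basis_coord (mu : Dual) : exists k l : int,
  mu = pairing mu a *: d + k *: be + l *: ga.
Proof.
exists (\sum_i mu 0 i * cross ga d i), (\sum_i mu 0 i * cross d be i).
rewrite pairingE !basis_atE !big3 /=.
have H (x : int) : x = det3 d be ga * x by rewrite (basis_det B) mul1r.
by apply: row3P; rewrite !mxE [LHS]H /cross /det3 /=; ring.
Qed.

Lemma basis_expand (b : Lam) i :
  b i 0 = cross be ga i * pairing d b + cross ga d i * pairing be b
    + cross d be i * pairing ga b.
Proof. by rewrite -det3_expand (basis_det B) mul1r. Qed.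

Lemma basis_primitive_ga : primitive ga.
Proof.
apply/primitiveP; exists (\col_i cross d be i).
by rewrite pairingE !mxE -(basis_det B) /cross /det3 /=; ring.
Qed.

End BasisAt.

(** A normal form for a pair: [ga] is the direction vector and [s] the positive integer with det(a,
    b, .) = s gamma, see [frame_direction]. *)
Record frame (a b : Lam) (d be ga : Dual) (r s : int) : Prop := Frame {
  frame_basis : basis_at a d be ga;
  frame_db : pairing d b = r;
  frame_beb : pairing be b = s;
  frame_gab : pairing ga b = 0;
  frame_s0 : 0 < s
}.

Lemma detLE (a b c : Lam) :
  detL a b c = (a o1 0 * b o2 0 - a o2 0 * b o1 0) * c o0 0
    + (a o2 0 * b o0 0 - a o0 0 * b o2 0) * c o1 0
    + (a o0 0 * b o1 0 - a o1 0 * b o0 0) * c o2 0.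
Proof.
rewrite /detL -det_tr det_mx33.
have e0 : row o0 (row_mx a (row_mx b c))^T = a^T.
  apply/rowP => i; rewrite [LHS]mxE [LHS]mxE; have -> : o0 = lshift 2 ord0 :> 'I_(1 + 2) by apply: val_inj.
  by rewrite row_mxEl mxE.
have e1 : row o1 (row_mx a (row_mx b c))^T = b^T.
  apply/rowP => i; rewrite [LHS]mxE [LHS]mxE.
  have -> : o1 = rshift 1 (lshift 1 ord0) :> 'I_(1 + (1 + 1)) by apply: val_inj.
  by rewrite row_mxEr row_mxEl mxE.
have e2 : row o2 (row_mx a (row_mx b c))^T = c^T.
  apply/rowP => i; rewrite [LHS]mxE [LHS]mxE.
  have -> : o2 = rshift 1 (rshift 1 ord0) :> 'I_(1 + (1 + 1)) by apply: val_inj.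
  by rewrite row_mxEr row_mxEr mxE.
by rewrite e0 e1 e2 /det3 !mxE; ring.
Qed.

Lemma direction_uniq a b ga ga' : is_direction a b ga -> is_direction a b ga' -> ga = ga'.
Proof.
move=> [/primitiveP[u hu] [s s0 H]] [/primitiveP[u' hu'] [s' s'0 H']].
have E c : s * pairing ga c = s' * pairing ga' c by rewrite -H -H'.
have ss' : s = s'.
  have h1 := E u; have h2 := E u'; rewrite hu hu' !mulr1 in h1 h2.
  apply/eqP; rewrite eq_le; apply/andP; split.
    have p0 : 0 < pairing ga u'.
      by rewrite -(pmulr_rgt0 _ s0) h2.
    by nia.
  have p0 : 0 < pairing ga' u by rewrite -(pmulr_rgt0 _ s'0) -h1.
  by nia.
rewrite -ss' in E.
have {}E c : pairing ga c = pairing ga' c by apply: (mulfI (lt0r_neq0 s0)).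
have e (i : 'I_3) : ga 0 i = ga' 0 i.
  have := E (delta_mx i 0); rewrite !pairingE !mxE.
  by elim/ord3P: i => /=; rewrite !(mulr0, mulr1, addr0, add0r).
by apply: row3P; exact: e.
Qed.

Lemma directionP a b ga : is_direction a b ga -> direction a b = ga.
Proof.
move=> H; have D := xgetPex 0 (ex_intro _ ga H); exact: direction_uniq D H.
Qed.

Section Frame.
Variables (a b : Lam) (d be ga : Dual) (r s : int).
Hypothesis F : frame a b d be ga r s.
Let B := frame_basis F.

Lemma frame_direction : direction a b = ga.
Proof.
apply: directionP; split; first exact: basis_primitive_ga B.
exists s; first exact: frame_s0 F.
move=> c; rewrite detLE !(basis_atE B) !(basis_expand B b) [pairing ga c]pairingE.
rewrite (frame_db F) (frame_beb F) (frame_gab F).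
have H (x : int) : s * x = s * x * det3 d be ga by rewrite (basis_det B) mulr1.
by rewrite [RHS]H /det3 /cross /=; ring.
Qed.

Lemma frame_pairing_b m k l :
  pairing (m *: d + k *: be + l *: ga) b = npt r s (m, k).
Proof.
rewrite !pairingDl !pairingZl (frame_db F) (frame_beb F) (frame_gab F) /npt /=.
by ring.
Qed.

Lemma frame_pairing_a m k l : pairing (m *: d + k *: be + l *: ga) a = m.
Proof.
rewrite !pairingDl !pairingZl (basis_d B) (basis_be B) (basis_ga B).
by ring.
Qed.

Lemma frame_coord (mu : Dual) : exists k l : int,
  mu = pairing mu a *: d + k *: be + l *: ga /\
  npt r s (pairing mu a, k) = pairing mu b.
Proof.
have [k [l E]] := basis_coord B mu; exists k, l; split => //.
by rewrite [in RHS]E frame_pairing_b.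
Qed.

Lemma frame_bezout : primitive b -> exists u v, u * r + v * s = 1.
Proof.
move=> /primitive_colP[mu hmu]; have [k [l [_ E]]] := frame_coord mu.
by exists (pairing mu a), k; rewrite -hmu -E /npt /=; ring.
Qed.

Lemma frame_swap u v : u * r + v * s = 1 ->
  frame b a (u *: d + v *: be) (s *: d - r *: be) (- ga) u s.
Proof.
move=> uv; split; last exact: frame_s0 F.
- split.
  + have -> : det3 (u *: d + v *: be) (s *: d - r *: be) (- ga) =
       (u * r + v * s) * det3 d be ga by rewrite /det3 !mxE; ring.
    by rewrite uv (basis_det B).
  + by rewrite pairingDl !pairingZl (frame_db F) (frame_beb F).
  + by rewrite pairingDl pairingNl !pairingZl (frame_db F) (frame_beb F); ring.
  + by rewrite pairingNl (frame_gab F) oppr0.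
- by rewrite pairingDl !pairingZl (basis_d B) (basis_be B); ring.
- by rewrite pairingDl pairingNl !pairingZl (basis_d B) (basis_be B); ring.
- by rewrite pairingNl (basis_ga B) oppr0.
Qed.

Lemma frame_lin_indep : lin_indep a b.
Proof.
apply: inj_row_free => v; rewrite /toQ map_col_mx -!map_trmx.
rewrite -(hsubmxK (v : 'rV[rat]_(1 + 1))) mul_row_col.
set x := lsubmx _; set y := rsubmx _ => E.
have {}E i : x 0 0 * (a i 0)%:~R + y 0 0 * (b i 0)%:~R = 0.
  have := congr1 (fun M : 'rV[rat]_3 => M 0 i) E.
  by rewrite !mxE !big_ord1 !mxE.
have pr (mu : Dual) : x 0 0 * (pairing mu a)%:~R + y 0 0 * (pairing mu b)%:~R = 0.
  rewrite !pairingE !rmorphD !rmorphM /=.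
  have := (E o0, E o1, E o2) => -[[h0 h1] h2].
  have -> : x 0 0 * ((mu 0 o0)%:~R * (a o0 0)%:~R + (mu 0 o1)%:~R * (a o1 0)%:~R +
     (mu 0 o2)%:~R * (a o2 0)%:~R) + y 0 0 * ((mu 0 o0)%:~R * (b o0 0)%:~R +
     (mu 0 o1)%:~R * (b o1 0)%:~R + (mu 0 o2)%:~R * (b o2 0)%:~R) =
     (mu 0 o0)%:~R * (x 0 0 * (a o0 0)%:~R + y 0 0 * (b o0 0)%:~R) +
     (mu 0 o1)%:~R * (x 0 0 * (a o1 0)%:~R + y 0 0 * (b o1 0)%:~R) +
     (mu 0 o2)%:~R * (x 0 0 * (a o2 0)%:~R + y 0 0 * (b o2 0)%:~R) :> rat by ring.
  by rewrite h0 h1 h2 !mulr0 !addr0.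
have := pr be; rewrite (basis_be B) (frame_beb F) mulr0 add0r => /eqP.
rewrite mulf_eq0 intr_eq0 (gt_eqF (frame_s0 F)) orbF => /eqP y0.
have := pr d; rewrite (basis_d B) y0 mul0r addr0 mulr1 => x0.
apply/rowP => i; rewrite !mxE; case: splitP => j _; rewrite (ord1 j).
  by rewrite -[RHS]x0.
by rewrite -[RHS]y0.
Qed.

End Frame.

(** Bezout for the values of [be] and [ga] at [b] gives a unimodular change of basis in H(a) after
    which the second form takes their gcd at [b] and the third vanishes there. *)
Lemma frame_exists (a b : Lam) (d be ga : Dual) : basis_at a d be ga ->
  (pairing be b != 0) || (pairing ga b != 0) ->
  exists be' ga' s, frame a b d be' ga' (pairing d b) s.
Proof.
move=> B; set y := pairing be b; set z := pairing ga b => yz.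
have g0 : gcdz y z != 0 by rewrite gcdz_eq0 negb_and.
have [u [v uv]] := Bezoutz y z.
have /dvdzP[y' hy'] := dvdz_gcdl y z; have /dvdzP[z' hz'] := dvdz_gcdr y z.
have b1 : u * y' + v * z' = 1.
  apply: (mulIf g0); rewrite mul1r -[RHS]uv.
  have -> : (u * y' + v * z') * gcdz y z = u * (y' * gcdz y z) + v * (z' * gcdz y z) by ring.
  by rewrite -hy' -hz'.
exists (u *: be + v *: ga), (- z' *: be + y' *: ga), (gcdz y z); split.
- split.
  + have -> : det3 d (u *: be + v *: ga) (- z' *: be + y' *: ga) =
      (u * y' + v * z') * det3 d be ga by rewrite /det3 !mxE; ring.
    by rewrite b1 (basis_det B).
  + exact: basis_d B.
  + by rewrite pairingDl !pairingZl (basis_be B) (basis_ga B); ring.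
  + by rewrite pairingDl !pairingZl (basis_be B) (basis_ga B); ring.
- by [].
- by rewrite pairingDl !pairingZl -/y -/z.
- rewrite pairingDl !pairingZl -/y -/z.
  set g := gcdz y z in hy' hz'; rewrite {1}hy' {1}hz'; ring.
- by rewrite lt_def g0 /=.
Qed.

End Coordinates.

Lemma basis_at_mulmx a d be ga (g : 'M[int]_3) : \det g = 1 -> basis_at a d be ga ->
  basis_at (g *m a) (d *m invmx g) (be *m invmx g) (ga *m invmx g).
Proof.
move=> dg B; have gu : g \in unitmx by rewrite unitmxE dg unitr1.
split; try by rewrite pairing_mulmx mulKmx//; case: B.
have -> : det3 (d *m invmx g) (be *m invmx g) (ga *m invmx g) =
   det3 d be ga * \det (invmx g).
  rewrite det_mx33 !rowE /det3 !mxE !big3 /= !mxE /=; ring.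
by rewrite (basis_det B) det_inv dg invr1 mulr1.
Qed.

(** * Evaluation of forms and the sets V_a *)

Section Evaluation.
Variable R : realType.
Local Notation C := R[i].
Implicit Types (x : 'cV[C]_3) (mu : Dual).

Lemma evE mu x : ev mu x = (mu 0 o0)%:~R * x o0 0 + (mu 0 o1)%:~R * x o1 0
  + (mu 0 o2)%:~R * x o2 0.
Proof. by rewrite /ev mulmx_row_col !mxE. Qed.

Lemma evD mu nu x : ev (mu + nu) x = ev mu x + ev nu x.
Proof. by rewrite !evE !mxE !rmorphD /=; ring. Qed.

Lemma evZ (n : int) mu x : ev (n *: mu) x = n%:~R * ev mu x.
Proof. by rewrite !evE !mxE !rmorphM /=; ring. Qed.

Lemma evN mu x : ev (- mu) x = - ev mu x.
Proof. by rewrite !evE !mxE !rmorphN /=; ring. Qed.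

Lemma ev0 x : ev 0 x = 0.
Proof. by rewrite !evE !mxE; ring. Qed.

Lemma ev_mulmx mu (g : 'M[int]_3) x : ev (mu *m g) x = ev mu (map_mx intr g *m x).
Proof. by rewrite /ev map_mxM mulmxA. Qed.

Lemma ev_scale mu (l : C) x : ev mu (l *: x) = l * ev mu x.
Proof. by rewrite !evE !mxE; ring. Qed.

(** The components of the cross product of Im x and Re x. Its pairing with [a], called [vol a x],
    equals Im(be(x) conj(ga(x))) for every basis [be], [ga] as in [basis_at], so U_a^+ becomes the
    condition [0 < vol a x], linear in [a]. *)
Definition minor x (i : 'I_3) : R :=
  if i == o0 then Im (x o1 0 * (x o2 0)^*%C) else
  if i == o1 then Im (x o2 0 * (x o0 0)^*%C) else Im (x o0 0 * (x o1 0)^*%C).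

Definition vol (a : Lam) x : R :=
  (a o0 0)%:~R * minor x o0 + (a o1 0)%:~R * minor x o1 + (a o2 0)%:~R * minor x o2.

Lemma Im_comb_conj (u0 u1 u2 v0 v1 v2 : R) x :
  Im ((u0%:C%C * x o0 0 + u1%:C%C * x o1 0 + u2%:C%C * x o2 0) *
      (v0%:C%C * x o0 0 + v1%:C%C * x o1 0 + v2%:C%C * x o2 0)^*%C) =
  (u1 * v2 - u2 * v1) * minor x o0 + (u2 * v0 - u0 * v2) * minor x o1
  + (u0 * v1 - u1 * v0) * minor x o2.
Proof.
rewrite /minor /=; case: (x o0 0) (x o1 0) (x o2 0) => [a b] [c d] [e f].
by simpc => /=; ring.
Qed.

Lemma intr_complex (n : int) : n%:~R = n%:~R%:C%C :> C.
Proof. by rewrite rmorph_int. Qed.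

Lemma Im_ev_conj mu nu x : Im (ev mu x * (ev nu x)^*%C) =
  (cross mu nu o0)%:~R * minor x o0 + (cross mu nu o1)%:~R * minor x o1
  + (cross mu nu o2)%:~R * minor x o2.
Proof.
by rewrite !evE !intr_complex Im_comb_conj /cross /= !(rmorphB, rmorphM).
Qed.

Lemma vol_basis a d be ga x : basis_at a d be ga ->
  Im (ev be x * (ev ga x)^*%C) = vol a x.
Proof. by move=> B; rewrite Im_ev_conj /vol !(basis_atE B). Qed.

(** [s *: d - r *: be] and [ga] form a negatively oriented basis of H(b); the sign yields the decay
    [frame_A0] in the cone products. *)
Lemma vol_frame a b d be ga r s x : frame a b d be ga r s ->
  Im (ev (s *: d - r *: be) x * (ev ga x)^*%C) = - vol b x.
Proof.
move=> F; rewrite Im_ev_conj /vol !(basis_expand (frame_basis F) b).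
rewrite (frame_db F) (frame_beb F) (frame_gab F).
by rewrite /cross /= !mxE !(rmorphB, rmorphM, rmorphD, rmorphN) /=; ring.
Qed.

Lemma volZ (n : int) (a : Lam) x : vol (n *: a) x = n%:~R * vol a x.
Proof. by rewrite /vol !mxE !rmorphM /=; ring. Qed.

Lemma vol_mulmx (g : 'M[int]_3) (a : Lam) x d be ga : \det g = 1 ->
  basis_at a d be ga ->
  vol (g *m a) (map_mx intr g *m x) = vol a x.
Proof.
move=> dg B; rewrite -(vol_basis _ (basis_at_mulmx dg B)) -(vol_basis x B).
by rewrite -!ev_mulmx !mulmxKV// unitmxE dg unitr1.
Qed.

Lemma Im_ratio (u v : C) : Im (u / v) = Im (u * v^*%C) / normc v ^+ 2.
Proof. by rewrite normc_sqr; case: u v => [a b] [c d]; simpc => /=; ring. Qed.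

Lemma normc_Im_neq0 (u v : C) : Im (u * v^*%C) != 0 -> v != 0.
Proof. by apply: contra => /eqP ->; rewrite conjc0 mulr0. Qed.

Section FramePositivity.
Variables (a b : Lam) (d be ga : Dual) (r s : int) (x : 'cV[C]_3).
Hypothesis F : frame a b d be ga r s.
Hypotheses (va : 0 < vol a x) (vb : 0 < vol b x).

Lemma frame_ga_neq0 : ev ga x != 0.
Proof. by apply: (@normc_Im_neq0 (ev be x)); rewrite (vol_basis x (frame_basis F)) gt_eqF. Qed.

Lemma frame_T0 : 0 < Im (ev be x / ev ga x).
Proof.
rewrite Im_ratio (vol_basis x (frame_basis F)) divr_gt0// exprn_gt0//.
exact/normc_gt0/frame_ga_neq0.
Qed.

Lemma frame_A0 :
  Im (s%:~R * (ev d x / ev ga x) - r%:~R * (ev be x / ev ga x)) < 0.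
Proof.
rewrite !mulrA -mulrBl.
have -> : s%:~R * ev d x - r%:~R * ev be x = ev (s *: d - r *: be) x.
  by rewrite evD evN !evZ.
rewrite Im_ratio (vol_frame x F) mulNr oppr_lt0 divr_gt0// exprn_gt0//.
exact/normc_gt0/frame_ga_neq0.
Qed.

End FramePositivity.

Lemma framing_basis f a : is_framing f -> primitive a ->
  basis_at a (row 0 (f a)) (row 1 (f a)) (row (2 : 'I_3) (f a)).
Proof.
move=> Hf pa; have [u dpos h0 h1 h2] := Hf a pa.
have E0 : 0 = o0 :> 'I_3 by apply: val_inj.
have E1 : 1 = o1 :> 'I_3 by apply: val_inj.
have E2 : 2 = o2 :> 'I_3 by apply: val_inj.
split => //.
rewrite [in row 0 _]E0 [in row 1 _]E1 [in row 2 _]E2 -det_mx33.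
by move: u dpos; rewrite unitmxE; case: (\det _) => [[|[|n]]|n].
Qed.

Lemma pairing_toQ (mu : Dual) (a : Lam) :
  toQ mu *m toQ a = ((pairing mu a)%:~R)%:M :> 'M[rat]_1.
Proof. by rewrite [LHS]mx11_scalar -map_mxM mxE. Qed.

Lemma det_col3 (u v w : 'rV[rat]_3) : \det (col_mx u (col_mx v w)) = det3 u v w.
Proof.
have e0 : row o0 (col_mx u (col_mx v w)) = u.
  apply/rowP => i; rewrite [LHS]mxE.
  have -> : o0 = lshift (1 + 1) (ord0 : 'I_1) :> 'I_(1 + (1 + 1)) by apply: val_inj.
  exact: (col_mxEu u (col_mx v w)).
have e1 : row o1 (col_mx u (col_mx v w)) = v.
  apply/rowP => i; rewrite [LHS]mxE.
  have -> : o1 = rshift 1 (lshift 1 (ord0 : 'I_1)) :> 'I_(1 + (1 + 1)) by apply: val_inj.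
  exact: etrans (col_mxEd u (col_mx v w) _ _) (col_mxEu v w _ _).
have e2 : row o2 (col_mx u (col_mx v w)) = w.
  apply/rowP => i; rewrite [LHS]mxE.
  have -> : o2 = rshift 1 (rshift 1 (ord0 : 'I_1)) :> 'I_(1 + (1 + 1)) by apply: val_inj.
  exact: etrans (col_mxEd u (col_mx v w) _ _) (col_mxEd v w _ _).
by apply: etrans (det_mx33 (col_mx u (col_mx v w))) _; rewrite e0 e1 e2.
Qed.

Lemma evQE (al : 'rV[rat]_3) x :
  evQ al x = (ratr (al 0 o0))%:C%C * x o0 0 + (ratr (al 0 o1))%:C%C * x o1 0
  + (ratr (al 0 o2))%:C%C * x o2 0.
Proof.
have E (q : rat) : ratr q = (ratr q)%:C%C :> C by rewrite fmorph_rat.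
by rewrite /evQ mulmx_row_col !mxE !E.
Qed.

Lemma evQ_toQ (mu : Dual) x : evQ (toQ mu) x = ev mu x.
Proof. by rewrite evQE evE !mxE !ratr_int !intr_complex. Qed.

(** The cross product of [al] and [bt] is a multiple of [a], and testing the orientation on the form
    [a^T] shows the multiple to be positive: it is [Dt / n2], with [n2] the squared length of
    [a]. *)
Lemma oriented_vol_gt0 a x al bt : (exists mu, pairing mu a = 1) ->
  oriented_basis a al bt -> 0 < Im (evQ al x * (evQ bt x)^*%C) -> 0 < vol a x.
Proof.
move=> [mu hmu] [_ ker odet] pos.
have al0 : (al *m toQ a) = 0.
  apply/sub_kermxP; apply: submx_trans (_ : (al <= col_mx al bt)%MS) _.
    by apply/submxP; exists (row_mx 1%:M 0); rewrite mul_row_col mul1mx mul0mx addr0.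
  by case/andP: ker.
have bt0 : (bt *m toQ a) = 0.
  apply/sub_kermxP; apply: submx_trans (_ : (bt <= col_mx al bt)%MS) _.
    by apply/submxP; exists (row_mx 0 1%:M); rewrite mul_row_col mul1mx mul0mx add0r.
  by case/andP: ker.
have h1 := congr1 (fun M : 'M[rat]_1 => M 0 0) al0.
have h2 := congr1 (fun M : 'M[rat]_1 => M 0 0) bt0.
rewrite /= mulmx_row_col [RHS]mxE in h1; rewrite /= mulmx_row_col [RHS]mxE in h2.
pose q i : rat := toQ a i 0.
pose n2 := q o0 ^+ 2 + q o1 ^+ 2 + q o2 ^+ 2.
have n20 : 0 < n2.
  rewrite lt_def !addr_ge0 ?sqr_ge0// andbT; apply/negP => /eqP n2z.
  have qz i : q i = 0.
    apply/eqP; rewrite -sqrf_eq0; move: n2z; rewrite /n2.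
    have := sqr_ge0 (q o0); have := sqr_ge0 (q o1); have := sqr_ge0 (q o2).
    by elim/ord3P: i => *; apply/eqP; lra.
  have /eqP := congr1 (fun n : int => n%:~R : rat) hmu.
  rewrite pairingE !rmorphD !rmorphM /=.
  have qE i : (a i 0)%:~R = q i :> rat by rewrite /q mxE.
  by rewrite !qE !qz !mulr0 !addr0 eq_sym oner_eq0.
pose Dt := cross al bt o0 * q o0 + cross al bt o1 * q o1 + cross al bt o2 * q o2.
have Dt0 : 0 < Dt.
  have := odet (toQ a)^T; rewrite det_col3 mulmx_row_col !(mxE, trmxK) => H.
  have -> : Dt = det3 al bt (toQ a)^T.
    by rewrite /Dt /det3 /cross /= !mxE /q /= !mxE; ring.
  by apply: H; move: n20; rewrite /n2 /q !mxE !expr2.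
have crE i : cross al bt i * n2 = Dt * q i.
  have K (A B : rat) : al 0 o0 * q o0 + al 0 o1 * q o1 + al 0 o2 * q o2 = A ->
      bt 0 o0 * q o0 + bt 0 o1 * q o1 + bt 0 o2 * q o2 = B ->
      A = 0 -> B = 0 -> cross al bt i * n2 = Dt * q i.
    move=> EA EB A0 B0.
    pose w (j : 'I_3) := bt 0 j * A - al 0 j * B.
    have w0 j : w j = 0 by rewrite /w A0 B0; ring.
    have : cross al bt i * n2 - Dt * q i =
        (if i == o0 then q o1 * w o2 - q o2 * w o1 else
         if i == o1 then q o2 * w o0 - q o0 * w o2 else q o0 * w o1 - q o1 * w o0).
      by rewrite /w -EA -EB /n2 /Dt /cross; elim/ord3P: i => /=; ring.
    rewrite !w0 !mulr0 subrr !if_same => /eqP; rewrite subr_eq0 => /eqP //.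
  exact: (K _ _ erefl erefl h1 h2).
have E : ratr n2 * Im (evQ al x * (evQ bt x)^*%C) = ratr Dt * vol a x.
  rewrite !evQE Im_comb_conj.
  have crR i : ratr n2 * ratr (cross al bt i) = ratr Dt * (a i 0)%:~R :> R.
    have -> : (a i 0)%:~R = ratr (q i) :> R by rewrite /q mxE ratr_int.
    by rewrite -!rmorphM mulrC crE.
  have cE : [/\ ratr (al 0 o1) * ratr (bt 0 o2) - ratr (al 0 o2) * ratr (bt 0 o1) =
        ratr (cross al bt o0) :> R,
      ratr (al 0 o2) * ratr (bt 0 o0) - ratr (al 0 o0) * ratr (bt 0 o2) =
        ratr (cross al bt o1) :> R &
      ratr (al 0 o0) * ratr (bt 0 o1) - ratr (al 0 o1) * ratr (bt 0 o0) =
        ratr (cross al bt o2) :> R].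
    by rewrite /cross /= !(rmorphB, rmorphM).
  have [e0 e1 e2] := cE; rewrite e0 e1 e2 /vol.
  have c0 := crR o0; have c1 := crR o1; have c2 := crR o2.
  have gen (N D a0 a1 a2 b0 b1 b2 m0 m1 m2 : R) : N * a0 = D * b0 ->
      N * a1 = D * b1 -> N * a2 = D * b2 ->
      N * (a0 * m0 + a1 * m1 + a2 * m2) = D * (b0 * m0 + b1 * m1 + b2 * m2).
    by rewrite !mulrDr !mulrA => -> -> ->.
  exact: gen c0 c1 c2.
have : 0 < ratr Dt * vol a x by rewrite -E mulr_gt0 ?ltr0q.
by rewrite pmulr_rgt0 ?ltr0q.
Qed.

Lemma basis_oriented a d be ga : basis_at a d be ga ->
  oriented_basis a (toQ be) (toQ ga).
Proof.
move=> B.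
have rf : row_free (col_mx (toQ be) (toQ ga)).
  apply: inj_row_free => v.
  rewrite -(hsubmxK (v : 'rV[rat]_(1 + 1))) mul_row_col.
  set s := lsubmx _; set t := rsubmx _ => E.
  have {}E i : s 0 0 * (be 0 i)%:~R + t 0 0 * (ga 0 i)%:~R = 0.
    have := congr1 (fun M : 'rV[rat]_3 => M 0 i) E.
    by rewrite !mxE !big_ord1 !mxE.
  have dE : (det3 d be ga)%:~R = 1 :> rat by rewrite (basis_det B).
  have s0 : s 0 0 = 0.
    have -> : s 0 0 = s 0 0 * (det3 d be ga)%:~R by rewrite dE mulr1.
    have -> : s 0 0 * (det3 d be ga)%:~R =
      (cross ga d o0)%:~R * (s 0 0 * (be 0 o0)%:~R + t 0 0 * (ga 0 o0)%:~R) +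
      (cross ga d o1)%:~R * (s 0 0 * (be 0 o1)%:~R + t 0 0 * (ga 0 o1)%:~R) +
      (cross ga d o2)%:~R * (s 0 0 * (be 0 o2)%:~R + t 0 0 * (ga 0 o2)%:~R).
      by rewrite /cross /det3 /= !(rmorphB, rmorphD, rmorphM) /=; ring.
    by rewrite !E; ring.
  have t0 : t 0 0 = 0.
    have -> : t 0 0 = t 0 0 * (det3 d be ga)%:~R by rewrite dE mulr1.
    have -> : t 0 0 * (det3 d be ga)%:~R =
      (cross d be o0)%:~R * (s 0 0 * (be 0 o0)%:~R + t 0 0 * (ga 0 o0)%:~R) +
      (cross d be o1)%:~R * (s 0 0 * (be 0 o1)%:~R + t 0 0 * (ga 0 o1)%:~R) +
      (cross d be o2)%:~R * (s 0 0 * (be 0 o2)%:~R + t 0 0 * (ga 0 o2)%:~R).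
      by rewrite /cross /det3 /= !(rmorphB, rmorphD, rmorphM) /=; ring.
    by rewrite !E; ring.
  apply/rowP => i; rewrite !mxE; case: splitP => j _; rewrite (ord1 j).
    by rewrite -[RHS]s0.
  by rewrite -[RHS]t0.
split => //.
- have sub : (col_mx (toQ be) (toQ ga) <= kermx (toQ a))%MS.
    apply/sub_kermxP; rewrite mul_col_mx !pairing_toQ (basis_be B) (basis_ga B).
    by rewrite !raddf0 col_mx0.
  rewrite -(mxrank_leqif_eq sub) eqn_leq mxrankS//= mxrank_ker.
  have -> : \rank (col_mx (toQ be) (toQ ga)) = 2 by move/eqP: rf.
  suff : (0 < \rank (toQ a))%N by case: (\rank _) => // n _; rewrite subSS leq_subr.
  rewrite lt0n mxrank_eq0; apply/eqP => a0.
  have := pairing_toQ d a; rewrite (basis_d B) a0 mulmx0 => /(congr1 (fun M : 'M[rat]_1 => M 0 0)).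
  by rewrite !mxE /= => /eqP; rewrite eq_sym oner_eq0.
- move=> w; rewrite det_col3 mulmx_row_col !mxE !(basis_atE B).
  rewrite /cross /det3 /= !mxE !(rmorphB, rmorphM) /= => h.
  by apply: (lt_le_trans h); rewrite le_eqVlt; apply/orP; left; apply/eqP; ring.
Qed.

Lemma Uplus_vol a x d be ga : basis_at a d be ga -> Uplus a x <-> 0 < vol a x.
Proof.
move=> B; split.
- move=> [al [bt [ob pos]]]; apply: (oriented_vol_gt0 _ ob pos).
  by exists d; exact: basis_d B.
- move=> v0; exists (toQ be), (toQ ga); split; first exact: basis_oriented B.
  by rewrite !evQ_toQ (vol_basis x B).
Qed.

(** Positivity of [vol] implies [Xcone]: if x is a complex multiple of a real vector, all Im(x_i
    conj(x_j)) vanish. *)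
Lemma Vcov_vol a (y : hpoint R) d be ga : basis_at a d be ga ->
  Vcov a y <-> 0 < vol a y.2.
Proof.
move=> B; rewrite /Vcov /=; split; first by move=> [_ /(Uplus_vol _ B)].
move=> v0; split; last exact/(Uplus_vol _ B).
move=> [l [t yE]]; move: v0; rewrite yE /vol /minor /= !mxE.
by case: l {yE} => p q; simpc => /=; set z := (X in 0 < X);
  have -> : z = 0 by [rewrite /z; ring]; rewrite ltxx.
Qed.

End Evaluation.

(** * Gamma functions and h_{a,b} in the coordinates of a frame *)

Section FrameFunctions.
Variable R : realType.
Local Notation C := R[i].
Local Notation e := (@cexp2pi R).

Lemma scale_intE (l : int) (ga : Dual) : l *: ga = ga *~ l.
Proof. by rewrite -{1}(intz l) scaler_int. Qed.

Lemma orbits_rep (ga mu : Dual) (A : set Dual) (c : set Dual) : orbits ga A c ->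
  exists2 mu, A mu & exists l : int, xget 0 c = mu + l *: ga /\
    c = [set mu + ga *~ k | k in [set: int]].
Proof.
move=> [nu An <-]; exists nu => //.
have : [set nu + ga *~ k | k in [set: int]] (xget 0 [set nu + ga *~ k | k in [set: int]]).
  by apply: xgetPex; exists nu, 0; rewrite ?mulr0z ?addr0.
move=> [l _ <-]; exists l; split => //.
by rewrite scale_intE.
Qed.

Lemma orbit_eq (ga mu : Dual) (l : int) :
  [set mu + l *: ga + ga *~ k | k in [set: int]] = [set mu + ga *~ k | k in [set: int]].
Proof.
rewrite scale_intE; apply/seteqP; split=> _ [k _ <-].
  by exists (l + k) => //; rewrite mulrzDr addrA.
by exists (k - l) => //; rewrite mulrzBr -addrA [ga *~ l + _]addrC subrK.
Qed.

Lemma h3_int (z t s : C) (l : int) : h3 (z + l%:~R) t s = h3 z t s.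
Proof.
rewrite !h3E ImD; have -> : Im (l%:~R : C) = 0 by rewrite intr_complex.
by rewrite addr0.
Qed.

Section Frame.
Variables (a b : Lam) (d be ga : Dual) (r s : int) (y : hpoint R).
Hypothesis F : frame a b d be ga r s.
Hypotheses (va : 0 < vol a y.2) (vb : 0 < vol b y.2).

Let B := frame_basis F.
Let x := y.2.
Let W := y.1 / ev ga x.
Let D := ev d x / ev ga x.
Let T := ev be x / ev ga x.

Let s0 : 0 < s. Proof. exact: frame_s0 F. Qed.
Let T0 : 0 < Im T. Proof. exact: frame_T0 F va. Qed.
Let A0 : Im (s%:~R * D - r%:~R * T) < 0. Proof. exact: frame_A0 F va vb. Qed.
Let g0 : ev ga x != 0. Proof. exact: frame_ga_neq0 F va. Qed.

Let pt (i : int * int) : Dual := i.1 *: d + i.2 *: be.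
Let orb (mu : Dual) : set Dual := [set mu + ga *~ k | k in [set: int]].

Let ptE (i : int * int) (l : int) : pt i + l *: ga = i.1 *: d + i.2 *: be + l *: ga.
Proof. by []. Qed.

Let pt_a (i : int * int) (l : int) : pairing (pt i + l *: ga) a = i.1.
Proof. exact: (frame_pairing_a F). Qed.

Let pt_b (i : int * int) (l : int) : pairing (pt i + l *: ga) b = npt r s i.
Proof. by rewrite (frame_pairing_b F); case: i. Qed.

Let coordk (mu : Dual) : int := \sum_i mu 0 i * cross ga d i.
Let idx (mu : Dual) : int * int := (pairing mu a, coordk mu).

Let idx_pt i l : idx (pt i + l *: ga) = i.
Proof.
have [k [l' E]] := basis_coord B (pt i + l *: ga).
rewrite /idx pt_a; case: i E => m k'; rewrite pt_a ptE /= => E.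
congr (_, _); rewrite /coordk big3 /=.
have h : k' = k' * det3 d be ga by rewrite (basis_det B) mulr1.
by rewrite [RHS]h /det3 /cross /= !mxE; ring.
Qed.

Let idxP mu : exists l, mu = pt (idx mu) + l *: ga.
Proof.
have [k [l E]] := basis_coord B mu; exists l.
have := idx_pt (pairing mu a, k) l; rewrite ptE /= -E => ->.
by rewrite ptE.
Qed.

Let ev_pt i l : ev (pt i + l *: ga) x / ev ga x = i.1%:~R * D + i.2%:~R * T + l%:~R.
Proof. by rewrite /pt !evD !evZ /D /T; field. Qed.

(** The sign covers numerator and denominator at once. In the numerator the cone is run through by -
    delta, its factors being 1 - e((w - delta(x)) / gamma(x)). *)
Lemma orbit_iprod (sg : int) (A : set Dual) (p q : int) (W' : C) : sg * sg = 1 ->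
  (forall mu, A mu <-> sg * pairing mu a < p /\ q <= sg * pairing mu b) ->
  iprod (orbits ga A)
    (fun c => 1 - e (W' + sg%:~R * (ev (xget 0 c) x / ev ga x))) =
  Gn r s p q W' D T.
Proof.
move=> sg2 AP; apply: uprod_iprod.
pose gg (c : set Dual) := idx (sg *: xget 0 c).
pose hh (i : int * int) := orb (sg *: pt i).
have sgK (mu : Dual) : sg *: (sg *: mu) = mu by rewrite scalerA sg2 scale1r.
have hhA i : cone r s p q i -> orbits ga A (hh i).
  move=> [h1 h2]; exists (sg *: pt i) => //; apply/AP.
  rewrite !pairingZl !mulrA sg2 !mul1r.
  have := pt_a i 0; have := pt_b i 0; rewrite scale0r addr0 => -> ->.
  by split.
have ggc c : orbits ga A c -> cone r s p q (gg c).
  move=> /(@orbits_rep _ 0)[mu /AP[h1 h2] [l [cE _]]].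
  rewrite /gg cE; have [l' E] := idxP (sg *: (mu + l *: ga)).
  have := pt_a (idx (sg *: (mu + l *: ga))) l'.
  have := pt_b (idx (sg *: (mu + l *: ga))) l'.
  rewrite -E !pairingZl !pairingDl !pairingZl (frame_gab F) (basis_ga B).
  by rewrite !mulr0 !addr0 => E2 E1; split; rewrite -?E1 -?E2.
have gh i : cone r s p q i -> gg (hh i) = i.
  move=> /hhA/(@orbits_rep _ 0)[mu _ [l [E1 E2]]].
  have : orb (sg *: pt i) mu.
    by rewrite -/(hh i) E2; exists 0; rewrite ?mulr0z ?addr0.
  move=> [k _ E3]; rewrite /gg E1 -E3 -scale_intE -addrA -scalerDl scalerDr sgK.
  by rewrite scalerA idx_pt.
have hg c : orbits ga A c -> hh (gg c) = c.
  move=> /(@orbits_rep _ 0)[mu _ [l [E1 E2]]].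
  have [l' E] := idxP (sg *: xget 0 c).
  rewrite /hh /gg; have -> : pt (idx (sg *: xget 0 c)) = sg *: xget 0 c - l' *: ga.
    by rewrite {2}E addrK.
  rewrite scalerBr sgK scalerA -scaleNr /orb orbit_eq E1 orbit_eq //.
have /(_ ggc hhA hg gh (uprod_Gn s0 T0 A0 p q W')) :=
  @uprod_reindex R (set Dual) (int * int)%type gg hh (orbits ga A) (cone r s p q)
    (fun i => 1 - e (zpt W' D T i)) (Gn r s p q W' D T).
apply: uprod_ext => c _; rewrite /gg.
have [l' E] := idxP (sg *: xget 0 c).
have := ev_pt (idx (sg *: xget 0 c)) l'; rewrite -E evZ => E'.
rewrite mulrA E' addrA cexp2piDint; congr (1 - e _).
by rewrite /zpt addrA.
Qed.

Lemma Gamma_num_frame : Gamma_num a b y = Gn r s 0 0 W D T.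
Proof.
rewrite -(@orbit_iprod (-1) (Lplus a `&` Lminus b)) //.
  rewrite /Gamma_num (frame_direction F); congr iprod.
  apply/funext => c; congr (1 - e _); rewrite /W rmorphN1; field.
  exact: g0.
by move=> mu; rewrite /Lplus /Lminus /=; split=> -[h1 h2]; split; lia.
Qed.

Lemma Gamma_den_frame : Gamma_den a b y = Gn r s 1 1 (- W) D T.
Proof.
rewrite -(@orbit_iprod 1 (Lminus a `&` Lplus b)) //.
  rewrite /Gamma_den (frame_direction F); congr iprod.
  apply/funext => c; congr (1 - e _); rewrite /W rmorph1; field.
  exact: g0.
by move=> mu; rewrite /Lplus /Lminus /=; split=> -[h1 h2]; split; lia.
Qed.

(** By Bezout for [r] and [s], alpha is [c] times [s *: d - r *: be] and beta is [c'] times [be],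
    both modulo Z gamma. A multiple of gamma adds an integer to the ratios, hence equality of
    imaginary parts only. *)
Lemma adapted_frame al bt : primitive b -> adapted a b al bt ->
  exists c c' : nat, [/\ (0 < c)%N, (0 < c')%N,
    pairing al a = s * c%:Z, pairing bt b = s * c'%:Z &
    Im (ev al x / ev ga x) = Im (c%:R * (s%:~R * D - r%:~R * T)) /\
    Im (ev bt x / ev ga x) = Im (c'%:R * T)].
Proof.
move=> pb [alb bta ala btb].
have [u [v uv]] := frame_bezout F pb.
have [l E] := idxP al; have [l' E'] := idxP bt.
set i := idx al in E; set j := idx bt in E'.
have ia : i.1 = pairing al a by [].
have ib : npt r s i = 0 by rewrite -(pt_b i l) -E.
have ja : j.1 = 0 by rewrite -bta.
have jb : npt r s j = pairing bt b by rewrite -(pt_b j l') -E'.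
have imint (z : C) (n : int) : Im (z + n%:~R) = Im z by rewrite ImD intr_complex addr0.
pose c := v * i.1 - u * i.2.
have i1 : i.1 = s * c.
  have -> : i.1 = (u * r + v * s) * i.1 by rewrite uv mul1r.
  have -> : (u * r + v * s) * i.1 = u * (npt r s i) + s * c by rewrite /npt /c; ring.
  by rewrite ib; ring.
have i2 : i.2 = - (r * c).
  have -> : i.2 = (u * r + v * s) * i.2 by rewrite uv mul1r.
  have -> : (u * r + v * s) * i.2 = v * (npt r s i) - r * c by rewrite /npt /c; ring.
  by rewrite ib; ring.
have c0 : 0 < c by move: ala; rewrite -ia i1 pmulr_rgt0.
have j2 : 0 < j.2 by move: btb; rewrite -jb /npt ja mulr0 add0r pmulr_rgt0.
exists (absz c), (absz j.2); split.
- by rewrite absz_gt0 gt_eqF.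
- by rewrite absz_gt0 gt_eqF.
- by rewrite gtz0_abs// -i1 ia.
- by rewrite gtz0_abs// -jb /npt ja; ring.
- have cR : (absz c)%:R = c%:~R :> C by rewrite -{2}(gtz0_abs c0).
  have jR : (absz j.2)%:R = j.2%:~R :> C by rewrite -{2}(gtz0_abs j2).
  rewrite cR jR E E' !ev_pt !imint i1 i2 ja; split; congr Im.
    by rewrite rmorphN !rmorphM /=; ring.
  by rewrite mul0r add0r.
Qed.

Lemma h_ab_frame al bt : primitive b -> adapted a b al bt ->
  h_ab a b al bt y = hbox r s 0 0 W D T.
Proof.
move=> pb ad.
have [c [c' [c0 c'0 alE btE [ImA ImB]]]] := adapted_frame pb ad.
rewrite -(hbox_mult s0 T0 A0 W c0 c'0) /h_ab (frame_direction F) -/x.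
pose hh (i : int * int) := orb (pt i).
have bij : set_bij (box r s (s * c%:Z) (s * c'%:Z) 0 0)
    (orbits ga (Fset a b al bt)) hh.
  have ptP i : Fset a b al bt (pt i) <-> box r s (s * c%:Z) (s * c'%:Z) 0 0 i.
    rewrite /Fset /box /=; have := pt_a i 0; have := pt_b i 0.
    by rewrite scale0r addr0 => -> ->; rewrite alE btE !add0r.
  split.
  - by move=> i /ptP Pi; exists (pt i).
  - move=> i j _ _ E.
    have : orb (pt j) (pt i) by rewrite -/(hh j) -E; exists 0; rewrite ?mulr0z ?addr0.
    move=> [k _ E']; have := idx_pt i 0; rewrite scale0r addr0 -E' -scale_intE.
    by rewrite idx_pt.
  - move=> _ [mu Fmu <-]; have [l E] := idxP mu; exists (idx mu); last first.
      by rewrite /hh /orb {2}E orbit_eq.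
    apply/ptP; rewrite /Fset /=; move: Fmu; rewrite /Fset /=.
    have := pt_a (idx mu) 0; have := pt_b (idx mu) 0.
    have := pt_a (idx mu) l; have := pt_b (idx mu) l.
    by rewrite -E scale0r addr0 => -> -> -> ->.
rewrite (reindex_fsbig _ _ _ _ bij); apply: eq_fsbigr => i _.
have : orb (pt i) (xget 0 (hh i)) by apply: xgetPex; exists (pt i), 0; rewrite ?mulr0z ?addr0.
move=> [l _ <-]; rewrite -scale_intE.
have -> : (y.1 + ev (pt i + l *: ga) x) / ev ga x = zpt W D T i + l%:~R.
  by rewrite mulrDl ev_pt /zpt /W; ring.
by rewrite h3_int !h3E ImA ImB.
Qed.

End Frame.
End FrameFunctions.

(** * Independence of the basis of H(a) *)

Section Generic.
Variable R : realType.
Local Notation C := R[i].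

Lemma continuous_shiftC (c : C) : continuous (fun w : C => w + c).
Proof.
move=> w Y /nbhs_normcP[d d0 dY]; apply/nbhs_normcP; exists d => // z h.
by apply: dY; rewrite opprD addrACA subrr addr0.
Qed.

(** If [f] and [g] differed at [w], they would differ on a short horizontal segment; it would embed
    in [S] and be countable, yet it has positive Lebesgue measure. *)
Lemma eq_off_countable (S : set C) (f g : C -> R) : countable S ->
  continuous f -> continuous g -> (forall w, ~ S w -> f w = g w) -> f =1 g.
Proof.
move=> /countable_injP[k kinj] cf cg fg w; apply/eqP; apply: contrapT => /negP ne.
have ch : continuous (fun z => f z + -1 * g z).
  by apply: continuous_addCR => //; apply: continuous_mulCR => //; exact: cst_continuous.
have h0 : f w + -1 * g w != 0 by rewrite mulN1r subr_eq0.
have /nbhs_normcP[d d0 H] : nbhs w [set z | f z + -1 * g z != 0].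
  apply: (ch w [set r | r != 0]); apply/nbhs_ballP.
  exists `|f w + -1 * g w|; first by rewrite /= normr_gt0.
  by move=> r /=; rewrite /ball /= => h; apply/eqP => r0; move: h; rewrite r0 subr0 ltxx.
pose A : set R := `]0, d[%classic.
have AS t : A t -> S (w + t%:C%C).
  rewrite /A /= in_itv /= => /andP[t0 td]; apply: contrapT => /fg E.
  have : f (w + t%:C%C) + -1 * g (w + t%:C%C) != 0.
    by apply: H; rewrite addrC addKr normc_real ger0_norm// ltW.
  by rewrite E mulN1r subrr eqxx.
have : countable A.
  apply/countable_injP; exists (fun t => k (w + t%:C%C)) => s t /set_mem As /set_mem At E.
  have := kinj _ _ (mem_set (AS _ As)) (mem_set (AS _ At)) E.
  by move/addrI => -[].
move=> /countable_lebesgue_measure0; rewrite /A lebesgue_measure_itv /= lte_fin d0.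
by rewrite sube0 => -[] /eqP; rewrite gt_eqF.
Qed.

Lemma countable_ex_notin (S : set C) : countable S -> exists w, ~ S w.
Proof.
move=> cS; apply: contrapT => no.
have := @eq_off_countable S (fun=> 0) (fun=> 1) cS.
move=> /(_ (@cst_continuous _ _ _) (@cst_continuous _ _ _)) H.
have /eqP : (0 : R) = 1.
  by apply: (H _ (0 : C)) => w Sw; exfalso; apply: no; exists w.
by rewrite eq_sym oner_eq0.
Qed.

(* The points [w] at which a theta or gamma factor with parameter [x] may vanish. *)
Definition lattice (x : 'cV[C]_3) : set C := [set ev mu x | mu in [set: Dual]].

Lemma lattice_countable x : countable (lattice x).
Proof. exact: sub_countable (card_image_le _ _) (countableP _). Qed.

Lemma lattice_shift x (mu : Dual) w : ~ lattice x w -> ~ lattice x (w + ev mu x).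
Proof.
move=> nw [nu _ E]; apply: nw; exists (nu - mu) => //.
by rewrite evD evN E addrK.
Qed.

Lemma generic_cexp2pi (x : 'cV[C]_3) (ga mu : Dual) w : ev ga x != 0 -> ~ lattice x w ->
  cexp2pi ((w + ev mu x) / ev ga x) != 1.
Proof.
move=> g0 nw; apply/eqP => /cexp2pi_eq1[n E]; apply: nw.
exists (n *: ga - mu) => //; rewrite evD evN evZ -E divfK//; ring.
Qed.

End Generic.

Section PlaneTheta.
Variable R : realType.
Local Notation C := R[i].
Implicit Types (y : hpoint R) (x : 'cV[C]_3) (w : C).

Definition plane_theta (be ga : Dual) x w : R := theta_norm (w / ev ga x) (ev be x / ev ga x).

Section Basis.
Variables (a : Lam) (d be ga : Dual) (x : 'cV[C]_3).
Hypotheses (B : basis_at a d be ga) (va : 0 < vol a x).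

Lemma basis_ga_neq0 : ev ga x != 0.
Proof. by apply: (@normc_Im_neq0 _ (ev be x)); rewrite (vol_basis x B) gt_eqF. Qed.

Lemma basis_T0 : 0 < Im (ev be x / ev ga x).
Proof.
rewrite Im_ratio (vol_basis x B) divr_gt0// exprn_gt0//.
exact/normc_gt0/basis_ga_neq0.
Qed.

Let g0 := basis_ga_neq0.

Lemma plane_theta_ga w (n : int) :
  plane_theta be ga x (w + n%:~R * ev ga x) = plane_theta be ga x w.
Proof. by rewrite /plane_theta mulrDl mulfK// theta_normDint//; exact: basis_T0. Qed.

Lemma plane_theta_be w (n : int) :
  plane_theta be ga x (w + n%:~R * ev be x) = plane_theta be ga x w.
Proof.
have := @periodic_int R R (plane_theta be ga x) (ev be x).
by apply => z; rewrite /plane_theta mulrDl theta_normDtau//; exact: basis_T0.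
Qed.

Lemma plane_theta_periodic (eta : Dual) w : pairing eta a = 0 ->
  plane_theta be ga x (w + ev eta x) = plane_theta be ga x w.
Proof.
have [k [l E]] := basis_coord B eta => h; rewrite E h scale0r add0r evD !evZ addrA.
by rewrite plane_theta_ga plane_theta_be.
Qed.

Lemma plane_theta_gt0 w : ~ lattice x w -> 0 < plane_theta be ga x w.
Proof.
move=> nw; apply: theta_norm_gt0; first exact: basis_T0.
move=> j; have -> : j%:~R * (ev be x / ev ga x) + w / ev ga x =
   (w + ev (j *: be) x) / ev ga x by rewrite evZ; ring.
exact: generic_cexp2pi.
Qed.

Lemma plane_theta_dist w :
  plane_theta be ga x w * plane_theta be ga x (w + ev ga x / 2) *
  (plane_theta be ga x (w + ev be x / 2) * plane_theta be ga x (w + (ev ga x + ev be x) / 2))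
  = plane_theta be ga x (2 * w).
Proof.
rewrite /plane_theta; have -> : 2 * w / ev ga x = 2 * (w / ev ga x) by ring.
rewrite -theta_norm_dist; last exact: basis_T0.
have e1 : (w + ev ga x / 2) / ev ga x = w / ev ga x + 1 / 2 by field.
have e2 : (w + ev be x / 2) / ev ga x = w / ev ga x + ev be x / ev ga x / 2 by field.
have e3 : (w + (ev ga x + ev be x) / 2) / ev ga x =
   w / ev ga x + (1 / 2 + ev be x / ev ga x / 2) by field.
by rewrite e1 e2 e3.
Qed.

Lemma plane_theta_half w (m n : int) :
  plane_theta be ga x (w + (m%:~R * ev ga x + n%:~R * ev be x) / 2) =
  plane_theta be ga x (w + ((m %% 2)%Z%:~R * ev ga x + (n %% 2)%Z%:~R * ev be x) / 2).
Proof.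
have h (k : int) : k%:~R = (k %/ 2)%Z%:~R * 2 + (k %% 2)%Z%:~R :> C.
  by rewrite {1}(divz_eq k 2) rmorphD rmorphM.
rewrite (h m) (h n) -[RHS](plane_theta_be _ (n %/ 2)%Z) -[RHS](plane_theta_ga _ (m %/ 2)%Z).
by congr plane_theta; field.
Qed.

Lemma h2_cubic : exists c d, cubic (fun w => - (2 * pi) *
   (Im (w / ev ga x) ^+ 2 / Im (ev be x / ev ga x) - Im (w / ev ga x)
     + Im (ev be x / ev ga x) / 6)) c d.
Proof.
set T := Im (ev be x / ev ga x).
have [c [e H]] := @cubic_poly R (ev ga x)^-1 0 (- (2 * pi) * (T / 6)) (2 * pi)
  (- (2 * pi) / T) 0.
exists c, e; apply: cubic_ext H => w /=.
by rewrite [_^-1 * w]mulrC; ring.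
Qed.

End Basis.
End PlaneTheta.

(** A matrix of determinant 1 permutes the three nonzero classes modulo 2, and [U] depends on
    parities only. *)
Lemma parity_prod (R : comNzRingType) (U : int -> int -> R) (p q p' q' : int) :
  (forall m n, U m n = U (m %% 2)%Z (n %% 2)%Z) -> p * q' - q * p' = 1 ->
  U 0 0 * U q' p' * (U q p * U (q + q') (p + p')) = U 0 0 * U 1 0 * (U 0 1 * U 1 1).
Proof.
move=> Umod.
have cases (z : int) : exists k, z = 2 * k \/ z = 2 * k + 1.
  by exists (z %/ 2)%Z; lia.
have E m n m' n' : (m %% 2)%Z = (m' %% 2)%Z -> (n %% 2)%Z = (n' %% 2)%Z -> U m n = U m' n'.
  by move=> h h'; rewrite Umod h h' -Umod.
have F i j : [\/ U i j = U 0 0 /\ exists k l, i = 2 * k /\ j = 2 * l, 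
  U i j = U 1 0 /\ exists k l, i = 2 * k + 1 /\ j = 2 * l,
  U i j = U 0 1 /\ exists k l, i = 2 * k /\ j = 2 * l + 1 |
  U i j = U 1 1 /\ exists k l, i = 2 * k + 1 /\ j = 2 * l + 1].
  have [k [ik|ik]] := cases i; have [l [jl|jl]] := cases j.
  - by constructor 1; split; [apply: E; lia | exists k, l].
  - by constructor 3; split; [apply: E; lia | exists k, l].
  - by constructor 2; split; [apply: E; lia | exists k, l].
  - by constructor 4; split; [apply: E; lia | exists k, l].
move=> det.
case: (F q' p') => -[-> [c [d [cE dE]]]]; case: (F q p) => -[-> [a [b [aE bE]]]];
  (try by exfalso; subst; lia);
  case: (F (q + q') (p + p')) => -[-> [? [? [? ?]]]]; (try by exfalso; lia); ring.
Qed.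

Section PlaneThetaIndependence.
Variable R : realType.
Local Notation C := R[i].
Implicit Types (y : hpoint R) (x : 'cV[C]_3) (w : C).

Lemma differentiable_w (F : hpoint R -> C) w x : differentiable F (w, x) ->
  derivable (fun u : C => F (u, x)) w 1.
Proof.
move=> dF; apply/derivable1_diffP.
apply: (@differentiable_comp _ _ _ _ (fun u : C => (u, x) : hpoint R) F) => //.
Qed.

Variables (f : Lam -> 'M[int]_3) (phi : cochain2 R).
Hypotheses (Hf : is_framing f) (Hphi : gamma_cocycle f phi).
Variables (a : Lam) (d be ga : Dual) (x : 'cV[C]_3).
Hypotheses (pa : primitive a) (B : basis_at a d be ga) (va : 0 < vol a x).

Let al2 := row 1 (f a).
Let al3 := row (2 : 'I_3) (f a).
Let BA : basis_at a (row 0 (f a)) al2 al3. Proof. exact: framing_basis. Qed.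

(** Take the inverse of the matrix with rows [d], [be], [ga], times [f a]. It fixes [a] because both
    bases take the values 1, 0, 0 on [a]. *)
Lemma framing_change : exists g : ISL3_pair, [/\ ISL3 g, g.2 = 0, g.1 *m a = a,
  al2 *m invmx g.1 = be & al3 *m invmx g.1 = ga].
Proof.
pose M : 'M[int]_3 := \matrix_(i, j) (if i == o0 then d else if i == o1 then be else ga) 0 j.
have rM0 : row o0 M = d by apply/rowP => j; rewrite !mxE.
have rM1 : row o1 M = be by apply/rowP => j; rewrite !mxE.
have rM2 : row o2 M = ga by apply/rowP => j; rewrite !mxE.
have dM : \det M = 1 by rewrite det_mx33 rM0 rM1 rM2 (basis_det B).
have uM : M \in unitmx by rewrite unitmxE dM unitr1.
have E0 : 0 = o0 :> 'I_3 by apply: val_inj.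
have E1 : 1 = o1 :> 'I_3 by apply: val_inj.
have E2 : 2 = o2 :> 'I_3 by apply: val_inj.
have [uf _ _ _ _] := Hf pa.
have df : \det (f a) = 1.
  by have := basis_det BA; rewrite /al2 /al3 [in row 0 _]E0 [in row 1 _]E1 [in row 2 _]E2 -det_mx33.
have ug : invmx M *m f a \in unitmx by rewrite unitmx_mul unitmx_inv uM uf.
have rows (i : 'I_3) : row i (f a) *m invmx (invmx M *m f a) = row i M.
  have -> : row i (f a) = row i M *m (invmx M *m f a) by rewrite -row_mul mulKVmx.
  by rewrite mulmxK.
exists (invmx M *m f a, 0); split => //=.
- by rewrite /ISL3 /= det_mulmx det_inv dM df invr1 mulr1.
- rewrite -mulmxA; apply: (canLR (mulKmx uM)); apply/colP => i.
  have P (N : 'M[int]_3) j : (N *m a) j 0 = pairing (row j N) a.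
    by rewrite /pairing -row_mul [RHS]mxE.
  rewrite !P; elim/ord3P: i; rewrite ?rM0 ?rM1 ?rM2.
  + by rewrite (basis_d B) -(basis_d BA) E0.
  + by rewrite (basis_be B) -(basis_be BA) /al2 [in RHS]E1.
  + by rewrite (basis_ga B) -(basis_ga BA) /al3 [in RHS]E2.
- by rewrite /al2 rows [in row 1 _]E1 rM1.
- by rewrite /al3 rows [in row 2 _]E2 rM2.
Qed.

(** The quotient is a value of the cocycle: for [g] from [framing_change] and the pure translation
    by the first framing form, the relation defining phi_a has a single theta function on each side
    and no denominators. This takes the place of the modular transformation of theta_0. *)
Lemma plane_theta_ratio : exists F : C -> C, [/\ forall w, derivable F w 1,
  forall w, F w != 0 &
  forall w, F w * theta0 (w / ev al3 x) (ev al2 x / ev al3 x) =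
    theta0 (w / ev ga x) (ev be x / ev ga x)].
Proof.
have [[g g2] [/= Hg g20 ga_a gal2 gal3]] := framing_change; subst g2.
pose mu := row 0 (f a).
have ug : g \in unitmx by rewrite unitmxE (Hg : \det g = 1) unitr1.
have h1 : ISL3 (1%:M, mu) by rewrite /ISL3 /= det1.
have V w : Vcov a (w, x) by apply/(Vcov_vol _ BA).
have [sc hol nz] := phi_a_hol Hphi pa Hg h1.
have g'a : ISL3_actL (ISL3_inv (g, 0)) a = a.
  by rewrite /ISL3_actL /= -{1}ga_a mulKmx.
have pmg : pairing (mu *m invmx g) a = 1.
  by rewrite pairing_mulmx -{1}ga_a mulKmx// (basis_d BA).
exists (fun w => phi_a phi a (g, 0) (1%:M, mu) (w, x)); split.
- by move=> w; apply: differentiable_w; exact: hol.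
- by move=> w; exact: nz.
move=> w; have := phi_aE Hphi pa Hg h1 (V w).
rewrite /= g'a /DeltaG_defined /DeltaG /Delta_defined /Delta /ISL3_shift /=.
rewrite !mulmx1 !mul0mx !addr0 pmg pairing0l invmx1 mulmx1 (basis_d BA).
rewrite /zprod /= !big_nat1 big_geq// !divr1 oner_eq0 mul1r.
move=> /(_ isT isT isT); rewrite /theta_factor /= !mul0r !addr0.
by rewrite -!ev_mulmx -/al2 -/al3 gal2 gal3 mul0mx oppr0 ev0 subr0.
Qed.

Lemma plane_theta_proportional : exists2 k : R, 0 < k &
  forall w, plane_theta be ga x w = k * plane_theta al2 al3 x w.
Proof.
have [F [dF nF FE]] := plane_theta_ratio.
have [c1 [e1 H1]] := h2_cubic be ga x; have [c2 [e2 H2]] := h2_cubic al2 al3 x.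
have HP := cubicD H1 (cubicZ (-1) H2).
set P := (fun w : C => _) in HP; set cc := _ + _ in HP; set ee := _ + _ in HP.
pose D w := normc (F w) ^+ 2 * expR (P w).
have DE w : plane_theta be ga x w = D w * plane_theta al2 al3 x w.
  have gen (n m p q : R) :
      (n * m) ^+ 2 * expR p = n ^+ 2 * expR (p + -1 * q) * (m ^+ 2 * expR q).
    by rewrite mulN1r expRD expRN; field; rewrite gt_eqF ?expR_gt0.
  by rewrite /plane_theta /theta_norm -FE normcM 2!h2E; exact: gen.
have cD : continuous D.
  apply: continuous_mulCR.
    have cn : continuous (fun w => normc (F w)).
      apply: continuous_compCR (@normc_continuous R) => w.
      exact: derivable_continuousC.
    by rewrite (_ : (fun w => normc (F w) ^+ 2) = (fun w => normc (F w) * normc (F w)));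
      [exact: continuous_mulCR|apply/funext => w; rewrite expr2].
  apply: continuous_compCR; [exact: cubic_continuous HP|exact: continuous_expR].
(* Both norms have these periods; they can be divided off the lattice, and [D] is continuous. *)
have per (eta : Dual) : pairing eta a = 0 -> forall w, D (w + ev eta x) = D w.
  move=> h; apply: (eq_off_countable (lattice_countable x)) => //.
    exact: continuous_compCR (@continuous_shiftC R _) cD.
  move=> w nw; apply: (mulIf (lt0r_neq0 (plane_theta_gt0 BA va nw))).
  by rewrite -{1}(plane_theta_periodic BA va w h) -!DE (plane_theta_periodic B va w h).
exists (D 0) => [|w]; first by rewrite mulr_gt0 ?expR_gt0// exprn_gt0// normc_gt0.
rewrite DE; congr (_ * _).
apply: (@doubly_periodic_constant R (ev al2 x) (ev al3 x) _ F P D cc ee) => //.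
- by rewrite (vol_basis x BA) gt_eqF.
- exact: per (basis_be BA).
- exact: per (basis_ga BA).
Qed.

(* The distribution relation over the 2-torsion points turns the factor [k] into
   a solution of [k ^ 4 = k]. *)
Lemma plane_theta_framing w : plane_theta be ga x w = plane_theta al2 al3 x w.
Proof.
have [k k0 kE] := plane_theta_proportional.
suff k1 : k = 1 by rewrite kE k1 mul1r.
(* The distribution relations are taken at [u = v / 2], so that their common value [t v], up to the
   factor [k], is nonzero and can be cancelled. *)
have [v nv] := countable_ex_notin (lattice_countable x).
pose t := plane_theta al2 al3 x; pose u := v / 2.
have tv : 0 < t v by exact: (plane_theta_gt0 BA va nv).
have vE : v = 2 * u by rewrite /u; field.
have DA := plane_theta_dist BA va u; have DB := plane_theta_dist B va u.
rewrite -vE in DA; rewrite -vE in DB.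
have {}kE z : plane_theta be ga x z = k * t z by exact: kE.
rewrite !{}kE in DB.
have half (m n : int) : t (u + (m%:~R * ev al3 x + n%:~R * ev al2 x) / 2) =
    t (u + ((m %% 2)%Z%:~R * ev al3 x + (n %% 2)%Z%:~R * ev al2 x) / 2).
  exact: (plane_theta_half BA va u m n).
change (t u * t (u + ev al3 x / 2) * (t (u + ev al2 x / 2) *
  t (u + (ev al3 x + ev al2 x) / 2)) = t v) in DA.
clearbody t.
have [p [q Eb]] := basis_coord BA be; have [p' [q' Eg]] := basis_coord BA ga.
rewrite (basis_be B) scale0r add0r in Eb; rewrite (basis_ga B) scale0r add0r in Eg.
have det1 : p * q' - q * p' = 1.
  rewrite -(basis_det B) Eb Eg.
  have [k1 [l1 Ed]] := basis_coord BA d.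
  rewrite (basis_d B) in Ed; rewrite Ed.
  have h (z : int) : z = z * det3 (row 0 (f a)) al2 al3 by rewrite (basis_det BA) mulr1.
  by rewrite [LHS]h /det3 !mxE; ring.
pose U (m n : int) := t (u + (m%:~R * ev al3 x + n%:~R * ev al2 x) / 2).
have Umod m n : U m n = U (m %% 2)%Z (n %% 2)%Z by exact: half.
have DA' : U 0 0 * U 1 0 * (U 0 1 * U 1 1) = t v.
  by rewrite -DA /U !mul0r !mul1r !addr0 !add0r mul0r addr0.
have DB' : k ^+ 4 * (U 0 0 * U q' p' * (U q p * U (q + q') (p + p'))) = k * t v.
  rewrite -DB /U; have -> : (0%:~R * ev al3 x + 0%:~R * ev al2 x) / 2 = 0 by ring.
  have -> : ((q + q')%:~R * ev al3 x + (p + p')%:~R * ev al2 x) / 2 = (ev ga x + ev be x) / 2.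
    by rewrite Eb Eg !evD !evZ !rmorphD /=; ring.
  have -> : (q%:~R * ev al3 x + p%:~R * ev al2 x) / 2 = ev be x / 2.
    by rewrite Eb !evD !evZ; ring.
  have -> : (q'%:~R * ev al3 x + p'%:~R * ev al2 x) / 2 = ev ga x / 2.
    by rewrite Eg !evD !evZ; ring.
  have K4 (x0 x1 x2 x3 : R) : k ^+ 4 * (x0 * x1 * (x2 * x3)) =
    k * x0 * (k * x1) * (k * x2 * (k * x3)) by ring.
  by rewrite addr0 K4.
have perm : U 0 0 * U q' p' * (U q p * U (q + q') (p + p')) = t v.
  by rewrite -DA'; exact: parity_prod.
rewrite perm in DB'.
have k4 : k ^+ 4 = k by apply: (mulIf (lt0r_neq0 tv)).
apply/eqP; rewrite -subr_eq0.
have : (k - 1) * (k * (k ^+ 2 + k + 1)) = 0.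
  have -> : (k - 1) * (k * (k ^+ 2 + k + 1)) = k ^+ 4 - k by ring.
  by rewrite k4 subrr.
move/eqP; rewrite mulf_eq0 => /orP[//|]; rewrite gt_eqF// mulr_gt0// !addr_gt0//.
by rewrite exprn_gt0.
Qed.

End PlaneThetaIndependence.

(** * Transformation laws *)

Section IntegerProductLemmas.
Variable K : fieldType.
Implicit Types (n m : int) (F G : int -> K).

Lemma zprod0 F : zprod 0 F = 1.
Proof. by rewrite /zprod /= big_geq// divr1. Qed.

Lemma zprod1 F : zprod 1 F = F 0.
Proof. by rewrite /zprod /= big_nat1 divr1. Qed.

(** For negative [n] the step removes the factor [F n] from the denominator, hence the
    hypothesis. *)
Lemma zprodS n F : F n != 0 -> zprod (n + 1) F = zprod n F * F n.
Proof.
case: n => n Fn.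
  by rewrite addrC -intS /zprod /= big_nat_recr//= !divr1.
case: n Fn => [|n] Fn.
  rewrite (_ : Negz 0 + 1 = 0)// zprod0 /zprod /= big_nat1 div1r mulVf//.
rewrite (_ : Negz n.+1 + 1 = Negz n); last by rewrite !NegzE; lia.
rewrite /zprod /= [in RHS]big_nat_recr//= !div1r invfM -mulrA.
by rewrite (_ : - n.+2%:Z = Negz n.+1)// mulVf ?mulr1.
Qed.

Lemma zprod_neq0 n F : (forall j, F j != 0) -> zprod n F != 0.
Proof.
move=> F0; rewrite /zprod mulf_neq0// ?invr_eq0; case: n => n /=; rewrite ?oner_neq0//;
  by rewrite prodf_seq_neq0; apply/allP => i _; exact: F0.
Qed.

Lemma zprod_ext n F G : F =1 G -> zprod n F = zprod n G.
Proof.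
move=> FG; rewrite /zprod; congr (_ / _); case: n => n //=; exact: eq_bigr.
Qed.

Lemma zprodM n F G : zprod n (fun j => F j * G j) = zprod n F * zprod n G.
Proof.
rewrite /zprod mulrACA -invfM; congr (_ / _); case: n => n //=;
  by rewrite ?mulr1// big_split.
Qed.

Lemma zprodD n m F : (forall j, F j != 0) ->
  zprod (n + m) F = zprod n F * zprod m (fun j => F (n + j)).
Proof.
move=> F0; elim: m => [|m IH|m IH].
- by rewrite addr0 zprod0 mulr1.
- by rewrite -[m.+1]addn1 PoszD addrA !zprodS// IH mulrA.
- rewrite -[m.+1]addn1 PoszD; set k := - (m%:Z + 1).
  have kE : k + 1 = - m%:Z by rewrite /k; ring.
  apply: (mulIf (F0 (n + k))); rewrite -zprodS// -mulrA.
  by rewrite -(@zprodS k (fun j => F (n + j)))// -addrA kE.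
Qed.

End IntegerProductLemmas.

Section ZprodNorm.
Variable R : realType.

Lemma normc_prod (I : Type) (s : seq I) (F : I -> R[i]) :
  normc (\prod_(j <- s) F j) = \prod_(j <- s) normc (F j).
Proof.
elim: s => [|i s IH]; first by rewrite !big_nil normc1.
by rewrite !big_cons normcM IH.
Qed.

Lemma zprod_normc n (F : int -> R[i]) : normc (zprod n F) = zprod n (fun j => normc (F j)).
Proof.
by rewrite /zprod normcM normcV; case: n => n; rewrite ?normc1 !normc_prod.
Qed.

Lemma zprod_gt0 n (F : int -> R) : (forall j, 0 < F j) -> 0 < zprod n F.
Proof.
move=> F0; rewrite /zprod divr_gt0//; case: n => n /=; rewrite ?ltr01//;
  by apply: prodr_gt0 => i _; exact: F0.
Qed.

End ZprodNorm.

Section Cocycle.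
Variable R : realType.
Local Notation C := R[i].
Implicit Types (y : hpoint R) (x : 'cV[C]_3) (w : C).
Variables (f : Lam -> 'M[int]_3) (phi : cochain2 R).
Hypotheses (Hf : is_framing f) (Hphi : gamma_cocycle f phi).

Let al1 a := row 0 (f a).
Let al2 a := row 1 (f a).
Let al3 a := row (2 : 'I_3) (f a).
Let BA a : primitive a -> basis_at a (al1 a) (al2 a) (al3 a).
Proof. exact: framing_basis. Qed.

Definition tnorm a x w : R := plane_theta (al2 a) (al3 a) x w.

Lemma Vcov_volE a y : primitive a -> Vcov a y <-> 0 < vol a y.2.
Proof. by move=> /BA; exact: Vcov_vol. Qed.

Lemma tnorm_gt0 a x w : primitive a -> 0 < vol a x -> ~ lattice x w -> 0 < tnorm a x w.
Proof. by move=> pa va; exact: (plane_theta_gt0 (BA pa) va). Qed.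

(** The difference of the two translations lies in H(a), which acts by periods. *)
Lemma tnorm_shift a x w (mu nu : Dual) : primitive a -> 0 < vol a x ->
  pairing mu a = pairing nu a -> tnorm a x (w + ev mu x) = tnorm a x (w + ev nu x).
Proof.
move=> pa va h; have h0 : pairing (mu - nu) a = 0 by rewrite pairingDl pairingNl h subrr.
rewrite -[RHS](plane_theta_periodic (BA pa) va _ h0) evD evN.
by congr plane_theta; ring.
Qed.

Lemma tnorm_basis a d be ga x w : primitive a -> 0 < vol a x -> basis_at a d be ga ->
  plane_theta be ga x w = tnorm a x w.
Proof. by move=> pa va B; exact: (plane_theta_framing Hf Hphi pa B va). Qed.

(** This is |Delta_a(mu)|^2 h_a(mu), which depends on mu only through [n], the value of mu on
    [a]. *)
Definition hDelta a (n : int) x w : R :=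
  zprod n (fun j : int => tnorm a x (w + j%:~R * ev (al1 a) x)).

Lemma hDeltaE a mu y :
  h_a f a mu y * normc (Delta f a mu y) ^+ 2 = hDelta a (pairing mu a) y.2 y.1.
Proof.
rewrite /h_a /Delta /hDelta zprod_normc expr2 -!zprodM; apply: zprod_ext => j /=.
by rewrite /tnorm /plane_theta /theta_norm -expr2 mulrC.
Qed.

Lemma hDelta1 a x w : hDelta a 1 x w = tnorm a x w.
Proof. by rewrite /hDelta zprod1 mul0r addr0. Qed.

Lemma hDelta_shift a x w (mu : Dual) n : primitive a -> 0 < vol a x ->
  hDelta a n x (w + ev mu x) =
  zprod n (fun j : int => tnorm a x (w + (pairing mu a + j)%:~R * ev (al1 a) x)).
Proof.
move=> pa va; apply: zprod_ext => j; rewrite -addrA -!evZ -evD.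
apply: tnorm_shift => //; rewrite pairingDl !pairingZl (basis_d (BA pa)); ring.
Qed.

Lemma tnorm_neq0 a x w (mu : Dual) : primitive a -> 0 < vol a x -> ~ lattice x w ->
  tnorm a x (w + ev mu x) != 0.
Proof. by move=> pa va nw; rewrite gt_eqF// tnorm_gt0//; exact: lattice_shift. Qed.

Lemma hDelta_neq0 a x w n : primitive a -> 0 < vol a x -> ~ lattice x w ->
  hDelta a n x w != 0.
Proof. by move=> pa va nw; apply: zprod_neq0 => j; rewrite -evZ tnorm_neq0. Qed.

Lemma hDelta_cocycle a x w (mu nu : Dual) : primitive a -> 0 < vol a x -> ~ lattice x w ->
  hDelta a (pairing (mu + nu) a) x w =
  hDelta a (pairing mu a) x w * hDelta a (pairing nu a) x (w + ev mu x).
Proof.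
move=> pa va nw; rewrite hDelta_shift// pairingDl; apply: zprodD => j.
by rewrite -evZ tnorm_neq0.
Qed.

Lemma primitive_mulmx (g : 'M[int]_3) a : \det g = 1 -> primitive a -> primitive (g *m a : Lam).
Proof.
move=> dg /primitive_colP[u hu]; apply/primitive_colP; exists (u *m invmx g).
by rewrite pairing_mulmx mulKmx// unitmxE dg unitr1.
Qed.

Lemma ev_mulmx_inv (g : 'M[int]_3) (mu : Dual) x : \det g = 1 ->
  ev (mu *m invmx g) (map_mx intr g *m x) = ev mu x.
Proof. by move=> dg; rewrite -ev_mulmx mulmxKV// unitmxE dg unitr1. Qed.

Lemma vol_mul (g : 'M[int]_3) a x : primitive a -> \det g = 1 ->
  vol (g *m a) (map_mx intr g *m x) = vol a x.
Proof. by move=> pa dg; exact: vol_mulmx dg (BA pa). Qed.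

(** The framing at [g *m a] need not be the image of the framing at [a]; independence of the basis
    of H(g a) makes up for it. *)
Lemma tnorm_mulmx (g : 'M[int]_3) a x w : primitive a -> \det g = 1 -> 0 < vol a x ->
  tnorm (g *m a) (map_mx intr g *m x) w = tnorm a x w.
Proof.
move=> pa dg va; rewrite -(tnorm_basis _ _ _ (basis_at_mulmx dg (BA pa))).
- by rewrite /plane_theta !ev_mulmx_inv.
- exact: primitive_mulmx.
- by rewrite vol_mul.
Qed.

Lemma hDelta_mulmx (g : 'M[int]_3) a x w n : primitive a -> \det g = 1 -> 0 < vol a x ->
  hDelta (g *m a) n (map_mx intr g *m x) w = hDelta a n x w.
Proof.
move=> pa dg va; apply: zprod_ext => j; rewrite tnorm_mulmx// -!evZ.
have gu : g \in unitmx by rewrite unitmxE dg unitr1.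
have -> : ev (j *: al1 (g *m a)) (map_mx intr g *m x) = ev (j *: al1 (g *m a) *m g) x.
  by rewrite ev_mulmx.
apply: tnorm_shift => //.
by rewrite pairing_mulmx !pairingZl (basis_d (BA pa)) (basis_d (BA (primitive_mulmx dg pa))).
Qed.

End Cocycle.

Section GammaNorm.
Variable R : realType.
Local Notation C := R[i].
Implicit Types (y : hpoint R) (x : 'cV[C]_3) (w : C).
Variables (f : Lam -> 'M[int]_3) (phi : cochain2 R).
Hypotheses (Hf : is_framing f) (Hphi : gamma_cocycle f phi).

Let BA a : primitive a ->
  basis_at a (row 0 (f a)) (row 1 (f a)) (row (2 : 'I_3) (f a)).
Proof. exact: framing_basis. Qed.

(** If all of H(a) vanishes on [b], then [b] is an integer multiple of [a]; [vol] being positive for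
    both, the factor is positive, and by primitivity it is 1. *)
Lemma equal_or_frame a b x : primitive a -> primitive b -> 0 < vol a x -> 0 < vol b x ->
  a = b \/ exists d be ga r s, frame a b d be ga r s.
Proof.
move=> pa pb va vb; have B := BA pa.
have [h|/nandP] := boolP ((pairing (row 1 (f a)) b == 0) && (pairing (row (2 : 'I_3) (f a)) b == 0)).
  left; move: h => /andP[/eqP b1 /eqP b2].
  set n := pairing (row 0 (f a)) b.
  have bE : b = n *: a.
    by apply/colP => i; rewrite !mxE (basis_atE B) (basis_expand B b) b1 b2 -/n; ring.
  have n0 : 0 < n by move: vb; rewrite bE volZ pmulr_lgt0// ltr0z.
  have /primitive_colP[u] := pb; rewrite bE /pairing -scalemxAr mxE => hu.
  have n1 : n = 1.
    have : (absz n %| 1)%N by rewrite -(dvdzE n 1); apply/dvdzP; exists ((u *m a) 0 0); rewrite -hu mulrC.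
    by rewrite dvdn1; lia.
  by rewrite n1 scale1r.
move=> h; right; have {}h : (pairing (row 1 (f a)) b != 0) || (pairing (row (2 : 'I_3) (f a)) b != 0) by apply/orP.
have [be' [ga' [s F]]] := frame_exists B h.
by exists (row 0 (f a)), be', ga', (pairing (row 0 (f a)) b), s.
Qed.

Definition frame_hgam (r s p q : int) (d be ga : Dual) x w : R :=
  hgam r s p q (w / ev ga x) (ev d x / ev ga x) (ev be x / ev ga x).

Section OneFrame.
Variables (a b : Lam) (d be ga : Dual) (r s : int) (x : 'cV[C]_3) (w : C).
Hypotheses (F : frame a b d be ga r s) (pa : primitive a).
Hypotheses (va : 0 < vol a x) (vb : 0 < vol b x) (nw : ~ lattice x w).

Lemma frame_generic : generic_pt (ev d x / ev ga x) (ev be x / ev ga x) (w / ev ga x).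
Proof.
move=> i; have g0 := frame_ga_neq0 F va.
have -> : zpt (w / ev ga x) (ev d x / ev ga x) (ev be x / ev ga x) i =
   (w + ev (i.1 *: d + i.2 *: be) x) / ev ga x by rewrite /zpt evD !evZ; field.
exact: generic_cexp2pi.
Qed.

Lemma frame_hgam_neq0 p q : frame_hgam r s p q d be ga x w != 0.
Proof.
exact: (hgam_neq0 (frame_s0 F) (frame_T0 F va) (frame_A0 F va vb) p q frame_generic).
Qed.

Lemma frame_hgam_reflect :
  frame_hgam r s 0 0 d be ga x (- w) * frame_hgam r s 1 1 d be ga x w = 1.
Proof.
have E := hgam_reflect (frame_s0 F) (frame_T0 F va) (frame_A0 F va vb) 1 1 frame_generic.
rewrite subrr -mulNr in E.
exact: etrans (congr1 (fun z => z * _) E) (mulVf (frame_hgam_neq0 1 1)).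
Qed.

(** Each step of the first wall contributes the norm of theta at some w + mu(x) with mu(a) = p', in
    the basis [be], [ga] of H(a). [tnorm_basis] and [tnorm_shift] replace it by the factor of
    [hDelta] belonging to the framing. *)
Lemma frame_hgam_pstep p q :
  frame_hgam r s p q d be ga x w = frame_hgam r s 0 q d be ga x w * hDelta f a p x w.
Proof.
have g0 := frame_ga_neq0 F va.
have st p' : frame_hgam r s (p' + 1) q d be ga x w = frame_hgam r s p' q d be ga x w *
    tnorm f a x (w + p'%:~R * ev (row 0 (f a)) x).
  have E := hgam_step (frame_s0 F) (frame_T0 F va) (frame_A0 F va vb) p' q frame_generic.
  apply: etrans E _; congr (_ * _); set k := col_start _ _ _ _.
  have -> : zpt (w / ev ga x) (ev d x / ev ga x) (ev be x / ev ga x) (p', k) =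
    (w + ev (p' *: d + k *: be) x) / ev ga x by rewrite /zpt evD !evZ /=; field.
  rewrite -[LHS]/(plane_theta be ga x (w + ev (p' *: d + k *: be) x)).
  rewrite (tnorm_basis Hf Hphi _ pa va (frame_basis F)) -evZ.
  apply: tnorm_shift => //; rewrite pairingDl !pairingZl (basis_d (frame_basis F)).
  by rewrite (basis_be (frame_basis F)) (basis_d (BA pa)); ring.
have nz j : tnorm f a x (w + j%:~R * ev (row 0 (f a)) x) != 0.
  by rewrite -evZ; apply: tnorm_neq0.
elim: p => [|m IH|m IH].
- by rewrite /hDelta zprod0 mulr1.
- rewrite -[m.+1]addn1 PoszD st IH /hDelta zprodS//; exact: esym (mulrA _ _ _).
- rewrite -[m.+1]addn1 PoszD; set k := - (m%:Z + 1).
  have kE : k + 1 = - m%:Z by rewrite /k; ring.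
  apply: (mulIf (nz k)); rewrite -st kE IH /hDelta -kE.
  by rewrite zprodS//; exact: mulrA.
Qed.

End OneFrame.

Lemma swap_coordinates a b d be ga (r s u v : int) x w : frame a b d be ga r s ->
  0 < vol a x ->
  [/\ w / ev (- ga) x = - (w / ev ga x),
    ev (u *: d + v *: be) x / ev (- ga) x =
      - (u%:~R * (ev d x / ev ga x) + v%:~R * (ev be x / ev ga x)) &
    ev (s *: d - r *: be) x / ev (- ga) x =
      - (s%:~R * (ev d x / ev ga x) - r%:~R * (ev be x / ev ga x))].
Proof.
move=> F va; have g0 := frame_ga_neq0 F va.
by split; rewrite ?evD !evN ?evZ; field.
Qed.

Lemma frame_hgam_swap a b d be ga (r s u v : int) x w p q : frame a b d be ga r s ->
  0 < vol a x -> 0 < vol b x -> u * r + v * s = 1 ->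
  frame_hgam u s q p (u *: d + v *: be) (s *: d - r *: be) (- ga) x w =
  (frame_hgam r s p q d be ga x w)^-1.
Proof.
move=> F va vb uv; have [e1 e2 e3] := swap_coordinates u v w F va.
rewrite /frame_hgam e1 e2 e3.
exact: (hgam_swap (frame_s0 F) (frame_T0 F va) (frame_A0 F va vb) uv).
Qed.

(** The second wall is moved by [frame_hgam_pstep] for the swapped frame of (b, a). There [hgam] is
    inverted, so the factor for [b] appears on the left. *)
Lemma frame_hgam_step a b d be ga r s x w p q : frame a b d be ga r s ->
  primitive a -> primitive b -> 0 < vol a x -> 0 < vol b x -> ~ lattice x w ->
  frame_hgam r s p q d be ga x w * hDelta f b q x w =
  frame_hgam r s 0 0 d be ga x w * hDelta f a p x w.
Proof.
move=> F pa pb va vb nw; have [u [v uv]] := frame_bezout F pb.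
have F' := frame_swap F uv.
have sw p' q' := frame_hgam_swap w p' q' F va vb uv.
have := frame_hgam_pstep F' pb vb va nw q 0; rewrite !sw => E.
have hn : hDelta f b q x w != 0 by apply: hDelta_neq0.
have n1 p' q' : frame_hgam r s p' q' d be ga x w != 0.
  exact: frame_hgam_neq0 F va vb nw _ _.
rewrite (frame_hgam_pstep F pa va vb nw p q) mulrAC; congr (_ * _).
apply: (mulfI (invr_neq0 (n1 0 q))); rewrite mulKf// E.
by rewrite mulrAC mulVf// mul1r.
Qed.

Lemma frame_hgam_shift a b d be ga r s x w (mu : Dual) : frame a b d be ga r s ->
  0 < vol a x -> 0 < vol b x ->
  frame_hgam r s (pairing mu a) (pairing mu b) d be ga x w =
  frame_hgam r s 0 0 d be ga x (w + ev mu x).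
Proof.
move=> F va vb; have [k [l [E <-]]] := frame_coord F mu.
have g0 := frame_ga_neq0 F va.
rewrite /frame_hgam (hgam_shift (frame_s0 F) (frame_T0 F va) (frame_A0 F va vb)).
have -> : (w + ev mu x) / ev ga x = w / ev ga x +
   (pairing mu a)%:~R * (ev d x / ev ga x) + k%:~R * (ev be x / ev ga x) + l%:~R.
  by rewrite {1}E !evD !evZ; field.
by rewrite hgam_int.
Qed.

Variables (al be : Lam -> Lam -> Dual).
Hypothesis Had : forall a b : Lam, primitive a -> primitive b -> lin_indep a b ->
     adapted a b (al a b) (be a b).

Definition hGamma a b x w : R :=
  h01 al be a b (w, x) * normc (Gamma a b (w, x)) ^+ 2.

Lemma frame_neq a b d e ga r s : frame a b d e ga r s -> a == b = false.
Proof.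
move=> F; apply/eqP => ab; have := frame_s0 F.
by rewrite -(frame_beb F) -ab (basis_be (frame_basis F)) ltxx.
Qed.

Lemma h01_frame a b d e ga r s x w : primitive a -> primitive b ->
  frame a b d e ga r s -> 0 < vol a x -> 0 < vol b x ->
  h01 al be a b (w, x) = hbox r s 0 0 (w / ev ga x) (ev d x / ev ga x) (ev e x / ev ga x).
Proof.
move=> pa pb F va vb; rewrite /h01 (frame_neq F).
by rewrite (@h_ab_frame R a b d e ga r s (w, x) F)//; apply: Had => //; exact: frame_lin_indep F.
Qed.

Lemma hGamma_frame a b d e ga r s x w : primitive a -> primitive b ->
  frame a b d e ga r s -> 0 < vol a x -> 0 < vol b x ->
  hGamma a b x w = frame_hgam r s 0 0 d e ga x w.
Proof.
move=> pa pb F va vb; rewrite /hGamma (h01_frame _ pa pb F va vb) /Gamma (frame_neq F).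
rewrite (@Gamma_num_frame R a b d e ga r s (w, x) F)//.
by rewrite (@Gamma_den_frame R a b d e ga r s (w, x) F)// /frame_hgam /hgam !subr0.
Qed.

Lemma hGammaxx a x w : hGamma a a x w = 1.
Proof. by rewrite /hGamma /h01 /Gamma eqxx normc1 expr1n mulr1. Qed.

(** Translating [w] by mu(x) moves the vertex of the cone to (mu(a), mu(b)), and [frame_hgam_step]
    compares that with the vertex at the origin. *)
Lemma hGamma_shift a b x w (mu : Dual) : primitive a -> primitive b ->
  0 < vol a x -> 0 < vol b x -> ~ lattice x w ->
  hGamma a b x (w + ev mu x) * hDelta f b (pairing mu b) x w =
  hGamma a b x w * hDelta f a (pairing mu a) x w.
Proof.
move=> pa pb va vb nw.
have [->|[d [e [ga [r [s F]]]]]] := equal_or_frame pa pb va vb.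
  by rewrite !hGammaxx.
rewrite !(hGamma_frame _ pa pb F va vb) -(frame_hgam_shift _ _ F va vb).
exact: frame_hgam_step.
Qed.

Lemma frame_mulmx (g : 'M[int]_3) a b d e ga r s : \det g = 1 -> frame a b d e ga r s ->
  frame (g *m a) (g *m b) (d *m invmx g) (e *m invmx g) (ga *m invmx g) r s.
Proof.
move=> dg F; have gu : g \in unitmx by rewrite unitmxE dg unitr1.
split; rewrite ?pairing_mulmx ?mulKmx//; try by case: F.
exact: basis_at_mulmx dg (frame_basis F).
Qed.

Lemma hGamma_mulmx (g : 'M[int]_3) a b x w : \det g = 1 -> primitive a -> primitive b ->
  0 < vol a x -> 0 < vol b x ->
  hGamma (g *m a) (g *m b) (map_mx intr g *m x) w = hGamma a b x w.
Proof.
move=> dg pa pb va vb.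
have [<-|[d [e [ga [r [s F]]]]]] := equal_or_frame pa pb va vb.
  by rewrite !hGammaxx.
rewrite (hGamma_frame _ pa pb F va vb).
rewrite (hGamma_frame _ _ _ (frame_mulmx dg F)) ?(vol_mul Hf)//; try exact: primitive_mulmx.
by rewrite /frame_hgam !ev_mulmx_inv.
Qed.

Lemma hGamma_neq0 a b x w : primitive a -> primitive b ->
  0 < vol a x -> 0 < vol b x -> ~ lattice x w -> hGamma a b x w != 0.
Proof.
move=> pa pb va vb nw.
have [->|[d [e [ga [r [s F]]]]]] := equal_or_frame pa pb va vb.
  by rewrite hGammaxx oner_neq0.
rewrite (hGamma_frame _ pa pb F va vb).
exact: frame_hgam_neq0 F va vb nw _ _.
Qed.

(** Reflection inverts the value with vertex (0, 0) at [- w] into the one with vertex (1, 1) at [w].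
    Returning to (0, 0) takes one step of each wall, at the cost of one [tnorm] for [a] and one for
    [b]. *)
Lemma hGamma_reflect a b x w : primitive a -> primitive b ->
  0 < vol a x -> 0 < vol b x -> ~ lattice x w ->
  hGamma a b x (- w) * hGamma a b x w * tnorm f a x w = tnorm f b x w.
Proof.
move=> pa pb va vb nw.
have [->|[d [e [ga [r [s F]]]]]] := equal_or_frame pa pb va vb.
  by rewrite !hGammaxx !mul1r.
have st := frame_hgam_step 1 1 F pa pb va vb nw.
rewrite 2!hDelta1 in st.
rewrite !(hGamma_frame _ pa pb F va vb) -mulrA -st mulrA.
by rewrite (frame_hgam_reflect F va vb nw) mul1r.
Qed.

Lemma h01_inv a b x w : primitive a -> primitive b -> 0 < vol a x -> 0 < vol b x ->
  h01 al be a b (w, x) * h01 al be b a (w, x) = 1.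
Proof.
move=> pa pb va vb.
have [->|[d [e [ga [r [s F]]]]]] := equal_or_frame pa pb va vb.
  by rewrite /h01 eqxx mulr1.
have [u [v uv]] := frame_bezout F pb; have F' := frame_swap F uv.
have [e1 e2 e3] := swap_coordinates u v w F va.
rewrite (h01_frame _ pa pb F va vb) (h01_frame _ pb pa F' vb va) e1 e2 e3.
rewrite (hbox_swap (frame_s0 F) (frame_T0 F va) (frame_A0 F va vb) uv) mulfV//.
exact: hbox_neq0 (frame_s0 F) _ _ _.
Qed.

Lemma Gamma_defined_generic a b x w : primitive a -> primitive b ->
  0 < vol a x -> 0 < vol b x -> ~ lattice x w -> Gamma_defined a b (w, x).
Proof.
move=> pa pb va vb nw /negP ab.
have [|[d [e [ga [r [s F]]]]]] := equal_or_frame pa pb va vb; first by move/eqP.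
rewrite (@Gamma_den_frame R a b d e ga r s (w, x) F)//.
apply: (Gn_neq0 (frame_s0 F) (frame_T0 F va) (frame_A0 F va vb)).
by apply: generic_ptN; exact: frame_generic F va nw.
Qed.

Lemma Delta_defined_generic a x w (mu nu : Dual) : primitive a -> 0 < vol a x ->
  ~ lattice x w -> Delta_defined f a mu (w, x).
Proof.
move=> pa va nw; rewrite /Delta_defined.
have nz j : theta_factor f a (w, x) j != 0.
  have := tnorm_neq0 Hf (j *: row 0 (f a)) pa va nw.
  by rewrite /tnorm /plane_theta /theta_norm mulf_eq0 negb_or sqrf_eq0 evZ => /andP[/eqP h _];
    apply/eqP => h'; apply: h; rewrite /theta_factor /= in h'; rewrite h' normc0.
rewrite /zprod_den; case: (pairing _ _) => n; rewrite ?oner_neq0//.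
by rewrite prodf_seq_neq0; apply/allP => j _; exact: nz.
Qed.

End GammaNorm.

(** * Smooth functions *)

Section Smooth.
Variable R : realType.
Local Notation C := R[i].
Local Notation H := (hpoint R).
Implicit Types (y v : H) (F G : H -> R) (O : set H).

Lemma line_continuous y v : continuous (fun t : R => y + t%:C%C *: v).
Proof.
move=> t; apply: cvgD; first exact: cvg_cst.
by apply: cvgZr_tmp; exact: real_complex_continuous.
Qed.

Lemma near_line O y v : open O -> O y -> \forall t \near (0 : R), O (y + t%:C%C *: v).
Proof.
move=> oO Oy; apply: (@line_continuous y v 0 O).
by rewrite scale0r addr0; apply: open_nbhs_nbhs.
Qed.

Lemma along_eq_near O F G y v : open O -> O y -> (forall z, O z -> F z = G z) ->
  {near (0 : R), along F y v =1 along G y v}.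
Proof. by move=> oO Oy FG; apply: filterS (near_line v oO Oy) => t /FG. Qed.

Lemma class_C_ext k O F G : open O -> (forall y, O y -> F y = G y) ->
  class_C k O F -> class_C k O G.
Proof.
move=> oO; elim: k F G => [|k IH] F G FG [cF dF].
  split => // y Oy; rewrite /prop_for /continuous_at -(FG y Oy).
  apply: cvg_trans (cF y Oy); apply: near_eq_cvg.
  by apply: filterS (open_nbhs_nbhs (conj oO Oy)) => z /FG.
split.
  move=> y Oy; rewrite /prop_for /continuous_at -(FG y Oy).
  apply: cvg_trans (cF y Oy); apply: near_eq_cvg.
  by apply: filterS (open_nbhs_nbhs (conj oO Oy)) => z /FG.
move=> v; have [dv cv] := dF v; split.
  move=> y Oy; apply: near_eq_derivable (dv y Oy).
  exact: along_eq_near oO Oy FG.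
apply: IH cv => y Oy; rewrite !derive1E; apply: near_eq_derive.
exact: along_eq_near oO Oy FG.
Qed.

(** With explicit directional derivatives on [O], the closure properties below follow by induction
    on [k]; the undifferentiated factors in the product rule are handled by [class_C_le]. *)
Lemma class_C_intro k O F (DF : H -> H -> R) : open O ->
  (forall y, O y -> {for y, continuous F}) ->
  (forall v y, O y -> is_derive (0 : R) 1 (along F y v) (DF v y)) ->
  (forall v, class_C k O (DF v)) -> class_C k.+1 O F.
Proof.
move=> oO cF dF cD; split => // v; split; first by move=> y Oy; have [] := dF v y Oy.
apply: class_C_ext (cD v) => // y Oy; have [_ E] := dF v y Oy.
by rewrite derive1E E.
Qed.

Lemma class_C_elim k O F : class_C k.+1 O F -> forall v y, O y ->
  is_derive (0 : R) 1 (along F y v) ((fun z => derive1 (along F z v) 0) y).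
Proof.
move=> [_ dF] v y Oy; have [dv _] := dF v; split; first exact: dv.
by rewrite derive1E.
Qed.

Lemma class_C_cont k O F : class_C k O F -> forall y, O y -> {for y, continuous F}.
Proof. by case: k => [|k] []. Qed.

Lemma class_C_le k O F : class_C k.+1 O F -> class_C k O F.
Proof.
elim: k F => [|k IH] F [cF dF]; first by split.
by split => // v; have [dv cv] := dF v; split => //; exact: IH.
Qed.

Lemma class_C_cst k O (c : R) : open O -> class_C k O (fun=> c).
Proof.
move=> oO; elim: k c => [|k IH] c; first by split => // y _; exact: cvg_cst.
apply: (class_C_intro (DF := fun _ _ => 0)) => //.
- by move=> y _; exact: cvg_cst.
- by move=> v y _; exact: is_derive_cst.
Qed.

Lemma class_C_add k O F G : open O -> class_C k O F -> class_C k O G ->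
  class_C k O (fun y => F y + G y).
Proof.
move=> oO; elim: k F G => [|k IH] F G CF CG.
  split => // y Oy; apply: cvgD; [exact: class_C_cont CF y Oy|exact: class_C_cont CG y Oy].
apply: (class_C_intro (DF := fun v y => derive1 (along F y v) 0 + derive1 (along G y v) 0)) => //.
- by move=> y Oy; apply: cvgD; [exact: class_C_cont CF y Oy|exact: class_C_cont CG y Oy].
- move=> v y Oy; exact: is_deriveD (class_C_elim CF v Oy) (class_C_elim CG v Oy).
- move=> v; apply: IH; [by have [_ /(_ v)[]] := CF|by have [_ /(_ v)[]] := CG].
Qed.

Lemma class_C_mul k O F G : open O -> class_C k O F -> class_C k O G ->
  class_C k O (fun y => F y * G y).
Proof.
move=> oO; elim: k F G => [|k IH] F G CF CG.
  split => // y Oy; apply: cvgM; [exact: class_C_cont CF y Oy|exact: class_C_cont CG y Oy].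
apply: (class_C_intro (DF := fun v y => F y * derive1 (along G y v) 0 +
   G y * derive1 (along F y v) 0)) => //.
- by move=> y Oy; apply: cvgM; [exact: class_C_cont CF y Oy|exact: class_C_cont CG y Oy].
- move=> v y Oy; have E (K : H -> R) : K y = along K y v 0 by rewrite /along scale0r addr0.
  rewrite [F y in X in is_derive _ _ _ X]E [G y in X in is_derive _ _ _ X]E.
  exact: is_deriveM (class_C_elim CF v Oy) (class_C_elim CG v Oy).
- move=> v; apply: class_C_add => //; apply: IH => //; try exact: class_C_le.
    by have [_ /(_ v)[]] := CG.
  by have [_ /(_ v)[]] := CF.
Qed.

Lemma class_C_inv k O F : open O -> (forall y, O y -> F y != 0) -> class_C k O F ->
  class_C k O (fun y => (F y)^-1).
Proof.
move=> oO nF; elim: k => [|k IH] CF.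
  by split => // y Oy; apply: cvgV; [exact: nF|exact: class_C_cont CF y Oy].
have CI := IH (class_C_le CF).
apply: (class_C_intro (DF := fun v y => -1 * ((F y)^-1 * (F y)^-1) * derive1 (along F y v) 0)) => //.
- by move=> y Oy; apply: cvgV; [exact: nF|exact: class_C_cont CF y Oy].
- move=> v y Oy; have E : F y = along F y v 0 by rewrite /along scale0r addr0.
  have n0 : along F y v 0 != 0 by rewrite -E nF.
  have D := is_deriveV n0 (class_C_elim CF v Oy).
  by apply: is_derive_eq D _; rewrite -E /GRing.scale /=; field; exact: nF.
- move=> v; apply: class_C_mul => //; last by have [_ /(_ v)[]] := CF.
  by apply: class_C_mul => //; [exact: class_C_cst|exact: class_C_mul].
Qed.

Lemma class_C_expR k O F : open O -> class_C k O F -> class_C k O (fun y => expR (F y)).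
Proof.
move=> oO; elim: k => [|k IH] CF.
  split => // y Oy; apply: (continuous_comp (f := F)); [exact: class_C_cont CF y Oy|exact: continuous_expR].
have CI := IH (class_C_le CF).
apply: (class_C_intro (DF := fun v y => derive1 (along F y v) 0 * expR (F y))) => //.
- move=> y Oy; apply: (continuous_comp (f := F)); [exact: class_C_cont CF y Oy|exact: continuous_expR].
- move=> v y Oy; have E : F y = along F y v 0 by rewrite /along scale0r addr0.
  have D := @is_derive1_comp R expR (along F y v) 0 _ _ (is_derive_expR _) (class_C_elim CF v Oy).
  by apply: is_derive_eq D _; rewrite E mulrC.
- by move=> v; apply: class_C_mul => //; have [_ /(_ v)[]] := CF.
Qed.

Lemma class_C_linear k O F : open O -> continuous F ->
  (forall y v (t : R), F (y + t%:C%C *: v) = F y + t * F v) -> class_C k O F.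
Proof.
move=> oO cF lF; case: k => [|k]; first by split => // y _; exact: cF.
apply: (class_C_intro (DF := fun v y => F v)) => //; last by move=> v; exact: class_C_cst.
  by move=> y _; exact: cF.
move=> v y Oy; have -> : along F y v = (fun t : R => F y + t * F v).
  by apply/funext => t; exact: lF.
have D := is_deriveD (is_derive_cst (F y) (0 : R) 1)
  (is_deriveM (is_derive_id (0 : R) 1) (is_derive_cst (F v) (0 : R) 1)).
by apply: is_derive_eq D _; rewrite /GRing.scale /=; ring.
Qed.

Definition smooth O F := forall k, class_C k O F.

Section SmoothOn.
Variable O : set H.
Hypothesis oO : open O.

Lemma smooth_ext F G : (forall y, O y -> F y = G y) -> smooth O F -> smooth O G.
Proof. by move=> FG sF k; exact: class_C_ext (sF k). Qed.

Lemma smooth_cst c : smooth O (fun=> c).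
Proof. by move=> k; exact: class_C_cst. Qed.

Lemma smooth_add F G : smooth O F -> smooth O G -> smooth O (fun y => F y + G y).
Proof. by move=> sF sG k; exact: class_C_add. Qed.

Lemma smooth_mul F G : smooth O F -> smooth O G -> smooth O (fun y => F y * G y).
Proof. by move=> sF sG k; exact: class_C_mul. Qed.

Lemma smooth_inv F : (forall y, O y -> F y != 0) -> smooth O F -> smooth O (fun y => (F y)^-1).
Proof. by move=> nF sF k; exact: class_C_inv. Qed.

Lemma smooth_expR F : smooth O F -> smooth O (fun y => expR (F y)).
Proof. by move=> sF k; exact: class_C_expR. Qed.

Lemma smooth_opp F : smooth O F -> smooth O (fun y => - F y).
Proof.
move=> sF; apply: smooth_ext (smooth_mul (smooth_cst (-1)) sF) => y _.
by rewrite mulN1r.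
Qed.

Lemma smooth_exp F n : smooth O F -> smooth O (fun y => F y ^+ n).
Proof.
move=> sF; elim: n => [|n IH]; first exact: smooth_cst.
by apply: smooth_ext (smooth_mul sF IH) => y _; rewrite exprS.
Qed.

Lemma smooth_prod (I : Type) (s : seq I) (F : I -> H -> R) : (forall i, smooth O (F i)) ->
  smooth O (fun y => \prod_(i <- s) F i y).
Proof.
move=> sF; elim: s => [|i s IH].
  by apply: smooth_ext (smooth_cst 1) => y _; rewrite big_nil.
by apply: smooth_ext (smooth_mul (sF i) IH) => y _; rewrite big_cons.
Qed.

Lemma smooth_zprod n (F : int -> H -> R) : (forall j, smooth O (F j)) ->
  (forall j y, O y -> F j y != 0) -> smooth O (fun y => zprod n (fun j => F j y)).
Proof.
move=> sF nF; apply: smooth_mul.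
  by case: n => n; [apply: smooth_prod => j; exact: sF|exact: smooth_cst].
apply: smooth_inv; last first.
  by case: n => n; [exact: smooth_cst|apply: smooth_prod => j; exact: sF].
move=> y Oy; case: n => n; first exact: oner_neq0.
by rewrite prodf_seq_neq0; apply/allP => j _; exact: nF.
Qed.

Definition csmooth (F : H -> C) := smooth O (fun y => Re (F y)) /\ smooth O (fun y => Im (F y)).

Lemma csmooth_w : csmooth (fun y => y.1).
Proof.
split=> k; apply: class_C_linear => //.
- by move=> y; apply: continuous_comp; [exact: cvg_fst|exact: Re_continuous].
- by move=> y v t /=; case: (y.1) (v.1) => [a b] [c d]; rewrite /GRing.scale /=; simpc.
- by move=> y; apply: continuous_comp; [exact: cvg_fst|exact: Im_continuous].
- by move=> y v t /=; case: (y.1) (v.1) => [a b] [c d]; rewrite /GRing.scale /=; simpc.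
Qed.

Lemma csmooth_coord i : csmooth (fun y => y.2 i 0).
Proof.
have c y : {for y, continuous (fun y : H => y.2 i 0)}.
  have c1 : {for y, continuous (fun y : H => y.2)} by exact: cvg_snd.
  exact: (continuous_comp c1 (@coord_continuous _ _ _ i 0 y.2)).
split=> k; apply: class_C_linear => //.
- by move=> y; apply: (continuous_comp (f := fun y : H => y.2 i 0)); [exact: c|exact: Re_continuous].
- by move=> y v t /=; rewrite !mxE; case: (y.2 i 0) (v.2 i 0) => [a b] [p d]; simpc.
- by move=> y; apply: (continuous_comp (f := fun y : H => y.2 i 0)); [exact: c|exact: Im_continuous].
- by move=> y v t /=; rewrite !mxE; case: (y.2 i 0) (v.2 i 0) => [a b] [p d]; simpc.
Qed.

Lemma csmooth_ext (F G : H -> C) : (forall y, F y = G y) -> csmooth F -> csmooth G.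
Proof. by move=> FG; have -> : F = G by exact/funext. Qed.

Lemma csmooth_add (F G : H -> C) : csmooth F -> csmooth G -> csmooth (fun y => F y + G y).
Proof.
move=> [F1 F2] [G1 G2]; split.
  by apply: smooth_ext (smooth_add F1 G1) => y _; case: (F y) (G y) => [a b] [c d].
by apply: smooth_ext (smooth_add F2 G2) => y _; case: (F y) (G y) => [a b] [c d].
Qed.

Lemma csmooth_intr (n : int) (F : H -> C) : csmooth F -> csmooth (fun y => n%:~R * F y).
Proof.
move=> [F1 F2]; split.
  apply: smooth_ext (smooth_mul (smooth_cst n%:~R) F1) => y _.
  by rewrite (intr_complex R n); case: (F y) => a b; simpc.
apply: smooth_ext (smooth_mul (smooth_cst n%:~R) F2) => y _.
by rewrite (intr_complex R n); case: (F y) => a b; simpc.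
Qed.

Lemma csmooth_ev (mu : Dual) : csmooth (fun y => ev mu y.2).
Proof.
apply: csmooth_ext (csmooth_add (csmooth_add (csmooth_intr (mu 0 o0) (csmooth_coord o0))
  (csmooth_intr (mu 0 o1) (csmooth_coord o1))) (csmooth_intr (mu 0 o2) (csmooth_coord o2))) => y.
by rewrite evE.
Qed.

Lemma smooth_Im_conj (F G : H -> C) : csmooth F -> csmooth G ->
  smooth O (fun y => Im (F y * (G y)^*%C)).
Proof.
move=> [F1 F2] [G1 G2].
apply: smooth_ext (smooth_add (smooth_mul F2 G1) (smooth_opp (smooth_mul F1 G2))) => y _.
by case: (F y) (G y) => [a b] [c d]; simpc => /=; ring.
Qed.

Lemma smooth_Im_ratio (F G : H -> C) : (forall y, O y -> G y != 0) -> csmooth F -> csmooth G ->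
  smooth O (fun y => Im (F y / G y)).
Proof.
move=> nG sF sG.
have sN : smooth O (fun y => normc (G y) ^+ 2).
  have [G1 G2] := sG.
  apply: smooth_ext (smooth_add (smooth_exp 2 G1) (smooth_exp 2 G2)) => y _.
  by rewrite normc_sqr.
apply: smooth_ext (smooth_mul (smooth_Im_conj sF sG) (smooth_inv _ sN)) => y Oy.
  by rewrite Im_ratio.
by rewrite expf_neq0// gt_eqF// normc_gt0// nG.
Qed.

Lemma smooth_minor i : smooth O (fun y => minor y.2 i).
Proof.
by elim/ord3P: i; apply: smooth_Im_conj; exact: csmooth_coord.
Qed.

Lemma smooth_vol (a : Lam) : smooth O (fun y => vol a y.2).
Proof.
by rewrite /vol; apply: smooth_add; [apply: smooth_add|]; apply: smooth_mul;
  try exact: smooth_cst; exact: smooth_minor.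
Qed.

Lemma smooth_h2 (F G : H -> C) : smooth O (fun y => Im (F y)) -> smooth O (fun y => Im (G y)) ->
  (forall y, O y -> Im (G y) != 0) -> smooth O (fun y => h2 (F y) (G y)).
Proof.
move=> sF sG nG.
have S := smooth_expR (smooth_mul (smooth_cst (- (2 * pi)))
  (smooth_add (smooth_add (smooth_mul (smooth_exp 2 sF) (smooth_inv nG sG)) (smooth_opp sF))
    (smooth_mul sG (smooth_cst 6^-1)))).
by apply: smooth_ext S => y _; rewrite h2E.
Qed.

Lemma smooth_h3 (F G K : H -> C) : smooth O (fun y => Im (F y)) ->
  smooth O (fun y => Im (G y)) -> smooth O (fun y => Im (K y)) ->
  (forall y, O y -> Im (G y) != 0) -> (forall y, O y -> Im (K y) != 0) ->
  smooth O (fun y => h3 (F y) (G y) (K y)).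
Proof.
move=> sF sG sK nG nK; have vG := smooth_inv nG sG; have vK := smooth_inv nK sK.
have c q := smooth_cst q.
have S := smooth_expR (smooth_mul (c (- (2 * pi / 3)))
  (smooth_add (smooth_add (smooth_add
      (smooth_mul (smooth_exp 3 sF) (smooth_mul vG vK))
      (smooth_mul (smooth_mul (c (- (3 / 2))) (smooth_add vG vK)) (smooth_exp 2 sF)))
    (smooth_mul (smooth_add (smooth_add (smooth_mul (c 2^-1) (smooth_mul sG vK))
        (smooth_mul (c 2^-1) (smooth_mul sK vG))) (c (3 / 2))) sF))
    (smooth_mul (c (- 4^-1)) (smooth_add sG sK)))).
apply: smooth_ext S => y Oy; rewrite /h3 /R3; congr expR; congr (_ * _).
by field; rewrite nG ?nK.
Qed.

End SmoothOn.

Lemma open_vol_gt0 (a : Lam) : open [set y : H | 0 < vol a y.2].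
Proof.
have c : continuous (fun y : H => vol a y.2).
  by move=> y; have := smooth_vol (@openT H) a 0; case => /(_ y I).
by apply: (open_comp (f := fun y : H => vol a y.2)) (@open_gt R 0) => y _; exact: c.
Qed.

Lemma smooth_continuous O F y : smooth O F -> O y -> {for y, continuous F}.
Proof. by move=> sF Oy; exact: class_C_cont (sF 0%N) y Oy. Qed.

End Smooth.

(** * Hermitian structure *)

Section SquaredNorm.
Variable R : realType.
Implicit Types u v s t : R[i].

Lemma normc_sqr_eq2 u v s t : u * v = s * t -> (normc u * normc v) ^+ 2 = (normc s * normc t) ^+ 2.
Proof. by rewrite -!normcM => ->. Qed.

Lemma normc_sqr_eq3 u v s t (z : R[i]) : u * v * z = s * t ->
  (normc u * normc v * normc z) ^+ 2 = (normc s * normc t) ^+ 2.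
Proof. by rewrite -!normcM => ->. Qed.

Lemma normc_sqrE u : `|u| ^+ 2 = (normc u ^+ 2)%:C%C.
Proof.
have E (r : R) : r%:C%C ^+ 2 = (r ^+ 2)%:C%C by rewrite rmorphXn.
exact: E.
Qed.

End SquaredNorm.

Section Cancellation.
Variable K : fieldType.

(** The squared modulus of the relation defining the cocycle is divided out of the multiplicative
    law for the products h |Gamma|^2 and h |Delta|^2, which leaves a law for the h alone. The next
    lemma does the same for phi_a. *)
Lemma cancel_equivariance (h' hb h ha p G' G Da Db : K) :
  h' * G' ^+ 2 * (hb * Db ^+ 2) = h * G ^+ 2 * (ha * Da ^+ 2) ->
  h' * G' ^+ 2 != 0 -> hb * Db ^+ 2 != 0 -> (p * G' * Db) ^+ 2 = (Da * G) ^+ 2 ->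
  h' * hb = p ^+ 2 * (ha * h).
Proof.
move=> S nG nD E; have n : G' ^+ 2 * Db ^+ 2 != 0.
  by move: nG nD; rewrite !mulf_eq0 !negb_or => /andP[_ ->] /andP[_ ->].
apply: (mulIf n).
have -> : h' * hb * (G' ^+ 2 * Db ^+ 2) = h' * G' ^+ 2 * (hb * Db ^+ 2) by ring.
rewrite S.
have -> : p ^+ 2 * (ha * h) * (G' ^+ 2 * Db ^+ 2) = ha * h * (p * G' * Db) ^+ 2 by ring.
by rewrite E; ring.
Qed.

Lemma cancel_cocycle (h1 h2 h3 p D1 D2 D3 : K) :
  h1 * D1 ^+ 2 = h2 * D2 ^+ 2 * (h3 * D3 ^+ 2) -> h1 * D1 ^+ 2 != 0 ->
  (p * D1) ^+ 2 = (D2 * D3) ^+ 2 -> h1 = p ^+ 2 * (h2 * h3).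
Proof.
move=> S nD E; have n : D1 ^+ 2 != 0 by move: nD; rewrite mulf_eq0 negb_or => /andP[].
apply: (mulIf n); rewrite S.
have -> : p ^+ 2 * (h2 * h3) * D1 ^+ 2 = h2 * h3 * (p * D1) ^+ 2 by ring.
by rewrite E; ring.
Qed.

Lemma cancel_triple (hab hbc hca hac p Gab Gbc Gac : K) : hca * hac = 1 ->
  (p * Gac) ^+ 2 = (Gab * Gbc) ^+ 2 ->
  p ^+ 2 * (hab * hbc * hca) * (hac * Gac ^+ 2) = hab * Gab ^+ 2 * (hbc * Gbc ^+ 2).
Proof.
move=> I E.
have -> : p ^+ 2 * (hab * hbc * hca) * (hac * Gac ^+ 2) =
  hab * hbc * (hca * hac) * (p * Gac) ^+ 2 by ring.
by rewrite I E; ring.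
Qed.

Lemma cancel_period (D' D Hab' Hbc' Hac' Hab Hbc Hac da db dc : K) :
  Hab' * db = Hab * da -> Hbc' * dc = Hbc * db -> Hac' * dc = Hac * da ->
  D' * Hac' = Hab' * Hbc' -> D * Hac = Hab * Hbc ->
  Hac != 0 -> da != 0 -> db != 0 -> D' = D.
Proof.
move=> S1 S2 S3 E' E n1 n2 n3; apply: (mulIf (mulf_neq0 n1 (mulf_neq0 n2 n3))).
have -> : D' * (Hac * (da * db)) = D' * (Hac * da) * db by ring.
rewrite -S3 mulrA E'.
have -> : Hab' * Hbc' * dc * db = (Hab' * db) * (Hbc' * dc) by ring.
have -> : D * (Hac * (da * db)) = D * Hac * (da * db) by ring.
by rewrite S1 S2 E; ring.
Qed.

(** The reflection factors telescope: tb / ta times tc / tb is tc / ta. *)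
Lemma cancel_reflect (D' D Hab' Hbc' Hac' Hab Hbc Hac ta tb tc : K) :
  Hab' * Hab * ta = tb -> Hbc' * Hbc * tb = tc -> Hac' * Hac * ta = tc ->
  D' * Hac' = Hab' * Hbc' -> D * Hac = Hab * Hbc -> tc != 0 -> D' * D = 1.
Proof.
move=> R1 R2 R3 E' E n; apply: (mulIf n); rewrite mul1r -{1}R3.
have -> : D' * D * (Hac' * Hac * ta) = (D' * Hac') * (D * Hac) * ta by ring.
by rewrite E E' -[RHS]R2 -R1; ring.
Qed.

End Cancellation.

Section Gaussian.
Variable R : realType.
Local Notation C := R[i].

Definition gaussian (F : C -> R) : Prop :=
  exists P c d, cubic P c d /\ forall w, F w = expR (P w).

Lemma gaussian1 : gaussian (fun=> 1).
Proof. by exists (fun=> 0), 0, 0; split; [exact: cubic_cst|rewrite expR0]. Qed.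

Lemma gaussianM (F G : C -> R) : gaussian F -> gaussian G -> gaussian (fun w => F w * G w).
Proof.
move=> [P [c [d [HP FE]]]] [Q [c' [d' [HQ GE]]]].
exists (fun w => P w + Q w), (c + c'), (d + d'); split; first exact: cubicD.
by move=> w; rewrite FE GE expRD.
Qed.

Lemma gaussian_prod (I : Type) (s : seq I) (F : I -> C -> R) : (forall i, gaussian (F i)) ->
  gaussian (fun w => \prod_(i <- s) F i w).
Proof.
move=> gF; elim: s => [|i s IH].
  by rewrite (_ : (fun _ => _) = fun=> 1); [exact: gaussian1|apply/funext => w; rewrite big_nil].
rewrite (_ : (fun _ => _) = fun w => F i w * \prod_(j <- s) F j w); first exact: gaussianM.
by apply/funext => w; rewrite big_cons.
Qed.

Lemma gaussian_h3 (g k t s : C) : gaussian (fun w => h3 (w / g + k) t s).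
Proof.
pose T := Im t; pose S := Im s; pose m := - (2 * pi / 3) : R.
have [c [d HP]] := @cubic_poly R g^-1 (Im k) (m * (- (T + S) / 4))
  (m * (T / (2 * S) + S / (2 * T) + 3 / 2)) (m * (- (3 / 2 * (T^-1 + S^-1)))) (m / (T * S)).
eexists; exists c, d; split; first exact: HP.
move=> w /=; rewrite /h3 /R3 ImD [w / g]mulrC -/T -/S -/m; congr expR.
by set u := Im (_ * _) + Im k; ring.
Qed.

Lemma hbox_prodE (r s p q : int) (W D T : C) : 0 < s -> hbox r s p q W D T =
  \prod_(0 <= i < absz s) \prod_(0 <= j < 1)
    h3 (zpt W D T (p + i%:Z, col_start r s q (p + i%:Z) + j%:Z)) (s%:~R * D - r%:~R * T) T.
Proof.
move=> s0.
rewrite -(@box_prod R r s (absz s) 1 p q (fun i => h3 (zpt W D T i) _ _) s0) /hbox mulr1.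
by have -> : box r s s s p q = box r s (absz s) s p q by rewrite gez0_abs// ltW.
Qed.

Lemma gaussian_hbox (r s p q : int) (g D T : C) : 0 < s ->
  gaussian (fun w => hbox r s p q (w / g) D T).
Proof.
move=> s0; rewrite (_ : (fun _ => _) = fun w => \prod_(0 <= i < absz s) \prod_(0 <= j < 1)
    h3 (w / g + ((p + i%:Z)%:~R * D + (col_start r s q (p + i%:Z) + j%:Z)%:~R * T))
       (s%:~R * D - r%:~R * T) T).
  by apply: gaussian_prod => i; apply: gaussian_prod => j; exact: gaussian_h3.
apply/funext => w; rewrite hbox_prodE//; apply: eq_bigr => i _; apply: eq_bigr => j _.
by rewrite /zpt addrA.
Qed.

End Gaussian.

Section Hermitian.
Variable R : realType.
Local Notation C := R[i].
Implicit Types (y : hpoint R) (x : 'cV[C]_3) (w : C).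
Variables (f : Lam -> 'M[int]_3) (al be : Lam -> Lam -> Dual) (phi : cochain2 R).
Hypotheses (Hf : is_framing f)
  (Had : forall a b : Lam, primitive a -> primitive b -> lin_indep a b ->
     adapted a b (al a b) (be a b))
  (Hphi : gamma_cocycle f phi).

Let BA a : primitive a ->
  basis_at a (row 0 (f a)) (row 1 (f a)) (row (2 : 'I_3) (f a)).
Proof. exact: framing_basis. Qed.

Lemma Vcov_open a : primitive a -> open (Vcov (R := R) a).
Proof.
move=> pa; have -> : Vcov (R := R) a = [set y : hpoint R | 0 < vol a y.2].
  by apply/seteqP; split => y /=; rewrite (Vcov_vol y (BA pa)).
exact: open_vol_gt0.
Qed.

Lemma h01_smooth a b : primitive a -> primitive b ->
  smooth (Vcov (R := R) a `&` Vcov b) (h01 al be a b).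
Proof.
move=> pa pb; have oO : open (Vcov (R := R) a `&` Vcov b) by apply: openI; exact: Vcov_open.
(* When the intersection is empty, as for [b = - a], there need not be a frame, but every function
   is smooth on it. *)
have [[y0 [/(Vcov_volE Hf _ pa) va /(Vcov_volE Hf _ pb) vb]]|nO] :=
    pselect (exists y, (Vcov (R := R) a `&` Vcov b) y); last first.
  by apply: smooth_ext (smooth_cst oO 1) => // y Oy; exfalso; apply: nO; exists y.
have [ab|[d [e [ga [r [s F]]]]]] := equal_or_frame Hf pa pb va vb.
  by apply: smooth_ext (smooth_cst oO 1) => // y _; rewrite /h01 ab eqxx.
have g0 y : (Vcov a `&` Vcov b) y -> ev ga y.2 != 0.
  by move=> [/(Vcov_volE Hf _ pa) v _]; exact: frame_ga_neq0 F v.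
have sI mu : smooth (Vcov a `&` Vcov b) (fun y => Im (ev mu y.2 / ev ga y.2)).
  by apply: smooth_Im_ratio => //; exact: csmooth_ev.
have tE y : s%:~R * (ev d y.2 / ev ga y.2) - r%:~R * (ev e y.2 / ev ga y.2) =
    ev (s *: d - r *: e) y.2 / ev ga y.2.
  by rewrite evD evN !evZ mulrBl !mulrA.
apply: smooth_ext (_ : smooth _ (fun y => \prod_(0 <= i < absz s) \prod_(0 <= j < 1)
    h3 ((y.1 + ev (i%:Z *: d + (col_start r s 0 i%:Z + j%:Z) *: e) y.2) / ev ga y.2)
       (ev (s *: d - r *: e) y.2 / ev ga y.2) (ev e y.2 / ev ga y.2))) => //.
  move=> [w x] [/(Vcov_volE Hf _ pa) vax /(Vcov_volE Hf _ pb) vbx].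
  rewrite (h01_frame Had _ pa pb F vax vbx) hbox_prodE ?(frame_s0 F)//.
  apply: eq_bigr => i _; apply: eq_bigr => j _; rewrite tE add0r /=.
  set k := col_start _ _ _ _ + _.
  have -> : zpt (w / ev ga x) (ev d x / ev ga x) (ev e x / ev ga x) (i%:Z, k) =
    (w + ev (i%:Z *: d + k *: e) x) / ev ga x by rewrite /zpt evD !evZ /=; ring.
  by [].
apply: smooth_prod => // i; apply: smooth_prod => // j; apply: smooth_h3 => //.
- apply: smooth_Im_ratio => //; last exact: csmooth_ev.
  by apply: csmooth_add => //; [exact: csmooth_w|exact: csmooth_ev].
- move=> y [/(Vcov_volE Hf _ pa) vay /(Vcov_volE Hf _ pb) vby].
  by rewrite -tE lt_eqF// (frame_A0 F vay vby).
- by move=> y [/(Vcov_volE Hf _ pa) vay _]; rewrite gt_eqF// (frame_T0 F vay).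
Qed.

Lemma h01_gaussian a b x : primitive a -> primitive b -> 0 < vol a x -> 0 < vol b x ->
  gaussian (fun w => h01 al be a b (w, x)).
Proof.
move=> pa pb va vb.
have [ab|[d [e [ga [r [s F]]]]]] := equal_or_frame Hf pa pb va vb.
  rewrite (_ : (fun _ => _) = fun=> 1); first exact: gaussian1.
  by apply/funext => w; rewrite /h01 ab eqxx.
rewrite (_ : (fun _ => _) = fun w => hbox r s 0 0 (w / ev ga x) (ev d x / ev ga x) (ev e x / ev ga x)).
  exact: gaussian_hbox (frame_s0 F).
by apply/funext => w; exact: (h01_frame Had w pa pb F va vb).
Qed.

Lemma h01_gt0 a b x w : primitive a -> primitive b -> 0 < vol a x -> 0 < vol b x ->
  0 < h01 al be a b (w, x).
Proof.
by move=> pa pb va vb; have [P [c [d [_ ->]]]] := h01_gaussian pa pb va vb; exact: expR_gt0.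
Qed.

Lemma h01_positive_smooth a b : primitive a -> primitive b ->
  positive_smooth (Vcov (R := R) a `&` Vcov b) (h01 al be a b).
Proof.
move=> pa pb; split.
- move=> l y l0 _; rewrite /h01; case: eqP => // _; rewrite /h_ab /=.
  have sc (u v : C) : (l * u) / (l * v) = u / v by rewrite invfM mulrACA mulfV// mul1r.
  apply: eq_fsbigr => c _; rewrite !ev_scale !sc.
  by rewrite -[l *: y.1]/(l * y.1) -mulrDr sc.
- exact: h01_smooth.
- by move=> [w x] [/(Vcov_volE Hf _ pa) va /(Vcov_volE Hf _ pb) vb]; exact: h01_gt0.
Qed.

Lemma h_a_smooth a mu : primitive a -> smooth (Vcov (R := R) a) (h_a f a mu).
Proof.
move=> pa; have oO := Vcov_open pa.
have v y : Vcov a y -> 0 < vol a y.2 by move/(Vcov_volE Hf _ pa).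
have g0 y : Vcov a y -> ev (row (2 : 'I_3) (f a)) y.2 != 0.
  by move=> /v; exact: basis_ga_neq0 (BA pa).
apply: smooth_zprod => // j; last by move=> y _; rewrite gt_eqF ?expR_gt0.
apply: smooth_h2 => //.
- apply: smooth_Im_ratio => //; last exact: csmooth_ev.
  apply: csmooth_add => //; first exact: csmooth_w.
  by apply: csmooth_intr => //; exact: csmooth_ev.
- by apply: smooth_Im_ratio => //; exact: csmooth_ev.
- by move=> y /v va; rewrite gt_eqF//; exact: (basis_T0 (BA pa) va).
Qed.

Lemma h10_positive_smooth a g : primitive a -> positive_smooth (Vcov (R := R) a) (h10 f a g).
Proof.
move=> pa; split.
- move=> l y l0 _; rewrite /h10 /h_a; apply: zprod_ext => j /=.
  have sc (u v : C) : (l * u) / (l * v) = u / v by rewrite invfM mulrACA mulfV// mul1r.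
  rewrite !ev_scale sc /= -[l *: y.1]/(l * y.1).
  have -> : l * y.1 + j%:~R * (l * ev (row 0 (f a)) y.2) =
    l * (y.1 + j%:~R * ev (row 0 (f a)) y.2) by ring.
  by rewrite sc.
- exact: h_a_smooth.
- by move=> y _; apply: zprod_gt0 => j; exact: expR_gt0.
Qed.

Lemma smooth_slice (O : set (hpoint R)) F x : smooth O F -> (forall w, O (w, x)) ->
  continuous (fun w => F (w, x)).
Proof.
move=> sF Ox w; apply: (continuous_comp (f := fun u : C => (u, x) : hpoint R)).
  exact: (cvg_pair (@cvg_id _ (nbhs w)) (cvg_cst x)).
exact: smooth_continuous sF (Ox w).
Qed.

Lemma continuous_normc_sqr (F : C -> C) : (forall w, derivable F w 1) ->
  continuous (fun w => normc (F w) ^+ 2).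
Proof.
move=> dF; have cn : continuous (fun w => normc (F w)).
  by apply: continuous_compCR (@normc_continuous R) => w; exact: derivable_continuousC.
exact: (continuous_mulCR cn cn).
Qed.

Lemma lattice_mulmx (g : 'M[int]_3) x w : lattice (map_mx intr g *m x) w -> lattice x w.
Proof. by move=> [mu _ <-]; exists (mu *m g); rewrite // ev_mulmx. Qed.

Section Group.
Variables (g : ISL3_pair) (x : 'cV[C]_3).
Hypothesis Hg : ISL3 g.
Let g' := invmx g.1.
Let x' := map_mx intr g' *m x.
Let dg' : \det g' = 1. Proof. by rewrite det_inv (Hg : \det g.1 = 1) invr1. Qed.

Lemma ISL3_act_inv w : ISL3_act (ISL3_inv g) (w, x) = (w + ev (ISL3_shift g) x, x').
Proof. by rewrite /ISL3_act /ISL3_inv /= evN opprK. Qed.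

Lemma generic_act w : ~ lattice x w -> ~ lattice x' (w + ev (ISL3_shift g) x).
Proof. by move=> nw /lattice_mulmx; exact: lattice_shift. Qed.

(** The inverse of [g] acts on x linearly and translates w by the value of the shift at x:
    [hGamma_mulmx] accounts for the former, [hGamma_shift] for the latter. Off the lattice all gamma
    and theta factors are defined and can be cancelled. *)
Lemma h01_equivariant_generic a b w : primitive a -> primitive b -> 0 < vol a x -> 0 < vol b x ->
  ~ lattice x w ->
  h01 al be (g' *m a) (g' *m b) (w + ev (ISL3_shift g) x, x') * h10 f b g (w, x) =
  normc (phi_ab phi a b g (w, x)) ^+ 2 * (h10 f a g (w, x) * h01 al be a b (w, x)).
Proof.
move=> pa pb va vb nw; set mu := ISL3_shift g.
have pa' : primitive (g' *m a) by exact: primitive_mulmx.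
have pb' : primitive (g' *m b) by exact: primitive_mulmx.
have va' : 0 < vol (g' *m a) x' by rewrite (vol_mul Hf).
have vb' : 0 < vol (g' *m b) x' by rewrite (vol_mul Hf).
have Vab : (Vcov a `&` Vcov b) (w, x) by split; exact/(Vcov_volE Hf).
have := phi_abE Hphi pa pb Hg Vab; cbv zeta; rewrite ISL3_act_inv /ISL3_actL /=.
rewrite -/g' -/mu => /(_ (Gamma_defined_generic Hf pa' pb' va' vb' (generic_act nw))).
move=> /(_ (Delta_defined_generic Hf mu 0 pb vb nw)).
move=> /(_ (Delta_defined_generic Hf mu 0 pa va nw)).
move=> /(_ (Gamma_defined_generic Hf pa pb va vb nw)).
rewrite /DeltaG -/mu => /normc_sqr_eq3.
have S := hGamma_shift Hf Hphi Had mu pa pb va vb nw.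
rewrite -(hGamma_mulmx Hf Had _ dg' pa pb va vb) -/x' in S.
have nG := hGamma_neq0 Hf Had pa' pb' va' vb' (generic_act nw).
have nD := hDelta_neq0 Hf (pairing mu b) pb vb nw.
rewrite -!(hDeltaE f _ mu (w, x)) /= in S nD.
exact: (cancel_equivariance S nG nD).
Qed.

Lemma h10_cocycle_generic a (k : ISL3_pair) w : ISL3 k -> primitive a -> 0 < vol a x ->
  ~ lattice x w ->
  h10 f a (ISL3_mul g k) (w, x) = normc (phi_a phi a g k (w, x)) ^+ 2 *
    (h10 f a g (w, x) * h10 f (g' *m a) k (w + ev (ISL3_shift g) x, x')).
Proof.
move=> Hk pa va nw; set mu := ISL3_shift g; set nu := ISL3_shift k.
have pa' : primitive (g' *m a) by exact: primitive_mulmx.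
have va' : 0 < vol (g' *m a) x' by rewrite (vol_mul Hf).
have Va : Vcov a (w, x) by exact/(Vcov_volE Hf).
have ug : g.1 \in unitmx by rewrite unitmxE (Hg : \det g.1 = 1) unitr1.
have uk : k.1 \in unitmx by rewrite unitmxE (Hk : \det k.1 = 1) unitr1.
(* The shift is a crossed homomorphism, so [hDelta_cocycle] applies to [mu] and [nu *m g']. *)
have sh : ISL3_shift (ISL3_mul g k) = mu + nu *m g'.
  have iM : invmx (g.1 *m k.1) = invmx k.1 *m g'.
    apply: (can_inj (mulmxK (_ : g.1 *m k.1 \in unitmx))); first by rewrite unitmx_mul ug.
    rewrite mulVmx ?unitmx_mul ?ug// mulmxA -(mulmxA (invmx k.1)) mulVmx// mulmx1.
    by rewrite mulVmx.
  rewrite /ISL3_shift /= iM mulmxDl addrC mulmxA -mulmxA mulmxA.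
  by rewrite /mu /nu /ISL3_shift; congr (_ + _); rewrite -!mulmxA; congr (_ *m _); rewrite mulKVmx.
have := phi_aE Hphi pa Hg Hk Va; cbv zeta; rewrite ISL3_act_inv /ISL3_actL /=.
rewrite -/g' -/mu.
move=> /(_ (Delta_defined_generic Hf (ISL3_shift (ISL3_mul g k)) 0 pa va nw)).
move=> /(_ (Delta_defined_generic Hf mu 0 pa va nw)).
move=> /(_ (Delta_defined_generic Hf nu 0 pa' va' (generic_act nw))).
rewrite /DeltaG -/mu -/nu => /normc_sqr_eq2.
have S := hDelta_cocycle Hf mu (nu *m g') pa va nw.
have nD := hDelta_neq0 Hf (pairing (mu + nu *m g') a) pa va nw.
rewrite -(hDelta_mulmx Hf Hphi (w + ev mu x) (pairing (nu *m g') a) pa dg' va) in S.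
rewrite [pairing (nu *m g') a]pairing_mulmx -/x' in S.
rewrite -(hDeltaE f (g' *m a) nu (w + ev mu x, x')) in S.
rewrite -!(hDeltaE f a _ (w, x)) -sh in S nD.
exact: (cancel_cocycle S nD).
Qed.

End Group.

Section Triple.
Variables (a b c : Lam) (x : 'cV[C]_3).
Hypotheses (pa : primitive a) (pb : primitive b) (pc : primitive c).
Hypotheses (va : 0 < vol a x) (vb : 0 < vol b x) (vc : 0 < vol c x).

Let D w := normc (phi_abc phi a b c (w, x)) ^+ 2 *
  (h01 al be a b (w, x) * h01 al be b c (w, x) * h01 al be c a (w, x)).

Let Vabc w : (Vcov a `&` Vcov b `&` Vcov c) (w, x).
Proof. by split; [split|]; exact/(Vcov_volE Hf). Qed.

(** As h_{c,a} is the inverse of h_{a,c}, [D] is the analogue of Gamma_{a,b} Gamma_{b,c} /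
    Gamma_{a,c} for the normalized squared moduli. *)
Let DE w : ~ lattice x w -> D w * hGamma al be a c x w = hGamma al be a b x w * hGamma al be b c x w.
Proof.
move=> nw; have E := phi_abcE Hphi pa pb pc (Vabc w)
  (Gamma_defined_generic Hf pa pc va vc nw) (Gamma_defined_generic Hf pa pb va vb nw)
  (Gamma_defined_generic Hf pb pc vb vc nw).
have {E} := normc_sqr_eq2 E.
have I := h01_inv Hf Had w pc pa vc va.
exact: (cancel_triple _ _ I).
Qed.

Let D_gaussian : exists P u v, cubic P u v /\
  forall w, D w = normc (phi_abc phi a b c (w, x)) ^+ 2 * expR (P w).
Proof.
have [P [u [v [HP E]]]] := gaussianM (gaussianM (h01_gaussian pa pb va vb)
  (h01_gaussian pb pc vb vc)) (h01_gaussian pc pa vc va).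
by exists P, u, v; split => // w; rewrite /D E.
Qed.

Let phi_derivable w : derivable (fun w => phi_abc phi a b c (w, x)) w 1.
Proof. by apply: differentiable_w; have [_ + _] := phi_abc_hol Hphi pa pb pc; apply; exact: Vabc. Qed.

Let D_continuous : continuous D.
Proof.
have [P [u [v [HP E]]]] := D_gaussian; have -> : D = (fun w => normc (phi_abc phi a b c (w, x)) ^+ 2 * expR (P w)).
  by apply/funext; exact: E.
apply: continuous_mulCR; first exact: continuous_normc_sqr phi_derivable.
exact: continuous_compCR (cubic_continuous HP) (@continuous_expR R).
Qed.

Let D_periodic (mu : Dual) w : D (w + ev mu x) = D w.
Proof.
apply: (eq_off_countable (lattice_countable x)
  (f := fun w => D (w + ev mu x)) (g := D)).
- exact: continuous_compCR (@continuous_shiftC R _) D_continuous.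
- exact: D_continuous.
move=> {}w nw; have nw' := @lattice_shift R x mu w nw.
have S1 := hGamma_shift Hf Hphi Had mu pa pb va vb nw.
have S2 := hGamma_shift Hf Hphi Had mu pb pc vb vc nw.
have S3 := hGamma_shift Hf Hphi Had mu pa pc va vc nw.
have E := DE nw; have E' := DE nw'.
have n1 := hGamma_neq0 Hf Had pa pc va vc nw.
have n2 := hDelta_neq0 Hf (pairing mu a) pa va nw.
have n3 := hDelta_neq0 Hf (pairing mu b) pb vb nw.
exact: cancel_period S1 S2 S3 E' E n1 n2 n3.
Qed.

Let D_reflect w : ~ lattice x w -> D (- w) * D w = 1.
Proof.
move=> nw; have nw' : ~ lattice x (- w).
  by move=> [mu _ E]; apply: nw; exists (- mu); rewrite // evN E opprK.
have R1 := hGamma_reflect Hf Hphi Had pa pb va vb nw.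
have R2 := hGamma_reflect Hf Hphi Had pb pc vb vc nw.
have R3 := hGamma_reflect Hf Hphi Had pa pc va vc nw.
have E := DE nw; have E' := DE nw'.
have tc : tnorm f c x w != 0 by exact: lt0r_neq0 (tnorm_gt0 Hf pc vc nw).
exact: cancel_reflect R1 R2 R3 E' E tc.
Qed.

Lemma h01_triple w : normc (phi_abc phi a b c (w, x)) ^+ 2 *
  (h01 al be a b (w, x) * h01 al be b c (w, x) * h01 al be c a (w, x)) = 1.
Proof.
have [P [u [v [HP E]]]] := D_gaussian.
have om : Im (ev (row 1 (f a)) x * (ev (row (2 : 'I_3) (f a)) x)^*%C) != 0.
  by rewrite (vol_basis x (BA pa)) gt_eqF.
have nz w' : phi_abc phi a b c (w', x) != 0.
  by have [_ _ h] := phi_abc_hol Hphi pa pb pc; exact: h (Vabc w').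
have K := doubly_periodic_constant om phi_derivable nz HP E (D_periodic _) (D_periodic _).
have [v0 nv0] := countable_ex_notin (lattice_countable x).
(* By constancy the reflection formula reads D(0)^2 = 1, and positivity excludes -1. *)
have := D_reflect nv0; rewrite K (K v0) -expr2 => /eqP; rewrite sqrf_eq1 => /orP[|] /eqP D0.
  by rewrite -/(D w) K D0.
have : 0 < D 0 by rewrite E mulr_gt0 ?expR_gt0// exprn_gt0// normc_gt0.
by rewrite D0 oppr_gt0 ltNge ler01.
Qed.

End Triple.

Theorem hermitian_structure : equivariant_hermitian_structure phi (h01 al be) (h10 f).
Proof.
split.
- exact: h01_positive_smooth.
- by move=> a g pa _; exact: h10_positive_smooth.
- move=> a b pa pb [w x] [/(Vcov_volE Hf _ pa) va /(Vcov_volE Hf _ pb) vb].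
  exact: (h01_inv Hf Had w pa pb va vb).
- move=> a b c pa pb pc [w x] [[/(Vcov_volE Hf _ pa) va /(Vcov_volE Hf _ pb) vb] /(Vcov_volE Hf _ pc) vc].
  have E := h01_triple pa pb pc va vb vc w.
  rewrite normc_sqrE -fmorphV; congr (_%:C%C).
  have n : normc (phi_abc phi a b c (w, x)) ^+ 2 != 0.
    by apply/eqP => z; move/eqP: E; rewrite z mul0r eq_sym oner_eq0.
  by apply: (mulfI n); rewrite E mulfV.
- move=> a b g pa pb Hg [w x] [Va Vb] g1.
  have /(Vcov_volE Hf _ pa) /= va := Va; have /(Vcov_volE Hf _ pb) /= vb := Vb.
  rewrite normc_sqrE -rmorphM; congr (_%:C%C).
  rewrite /g1 ISL3_act_inv /ISL3_actL /=.
  set x' := _ *m x; set a' := _ *m a; set b' := _ *m b.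
  have dg : \det (invmx g.1) = 1 by rewrite det_inv (Hg : \det g.1 = 1) invr1.
  have pa' : primitive (a' : Lam) by exact: primitive_mulmx.
  have pb' : primitive (b' : Lam) by exact: primitive_mulmx.
  have va' : 0 < vol a' x' by rewrite (vol_mul Hf).
  have vb' : 0 < vol b' x' by rewrite (vol_mul Hf).
  apply: (eq_off_countable (lattice_countable x)
    (f := fun w => h01 al be a' b' (w + ev (ISL3_shift g) x, x') * h10 f b g (w, x))
    (g := fun w => normc (phi_ab phi a b g (w, x)) ^+ 2 * (h10 f a g (w, x) * h01 al be a b (w, x)))).
  + apply: continuous_mulCR.
      apply: (continuous_compCR (@continuous_shiftC R _) (f := fun w => h01 al be a' b' (w, x'))).
      by apply: smooth_slice (h01_smooth pa' pb') _ => u; split; exact/(Vcov_volE Hf).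
    by apply: smooth_slice (h_a_smooth _ pb) _ => u; exact/(Vcov_volE Hf).
  + apply: continuous_mulCR.
      apply: continuous_normc_sqr => u; apply: differentiable_w.
      by have [_ + _] := phi_ab_hol Hphi pa pb Hg; apply; split; exact/(Vcov_volE Hf).
    apply: continuous_mulCR.
      by apply: smooth_slice (h_a_smooth _ pa) _ => u; exact/(Vcov_volE Hf).
    by apply: smooth_slice (h01_smooth pa pb) _ => u; split; exact/(Vcov_volE Hf).
  + by move=> u nu; exact: h01_equivariant_generic.
- move=> a g k pa Hg Hk [w x] Va g1.
  have /(Vcov_volE Hf _ pa) /= va := Va.
  rewrite normc_sqrE -rmorphM; congr (_%:C%C).
  rewrite /g1 ISL3_act_inv /ISL3_actL /=.
  set x' := _ *m x; set a' := _ *m a.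
  have dg : \det (invmx g.1) = 1 by rewrite det_inv (Hg : \det g.1 = 1) invr1.
  have pa' : primitive (a' : Lam) by exact: primitive_mulmx.
  have va' : 0 < vol a' x' by rewrite (vol_mul Hf).
  apply: (eq_off_countable (lattice_countable x)
    (f := fun w => h10 f a (ISL3_mul g k) (w, x))
    (g := fun w => normc (phi_a phi a g k (w, x)) ^+ 2 *
      (h10 f a g (w, x) * h10 f a' k (w + ev (ISL3_shift g) x, x')))).
  + by apply: smooth_slice (h_a_smooth _ pa) _ => u; exact/(Vcov_volE Hf).
  + apply: continuous_mulCR.
      apply: continuous_normc_sqr => u; apply: differentiable_w.
      by have [_ + _] := phi_a_hol Hphi pa Hg Hk; apply; exact/(Vcov_volE Hf).
    apply: continuous_mulCR.
      by apply: smooth_slice (h_a_smooth _ pa) _ => u; exact/(Vcov_volE Hf).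
    apply: (continuous_compCR (@continuous_shiftC R _) (f := fun w => h10 f a' k (w, x'))).
    by apply: smooth_slice (h_a_smooth _ pa') _ => u; exact/(Vcov_volE Hf).
  + by move=> u nu; exact: h10_cocycle_generic.
Qed.

End Hermitian.

Theorem theorem8p6 (R : realType) (f : Lam -> 'M[int]_3)
    (al be : Lam -> Lam -> Dual) (phi : cochain2 R) :
  is_framing f ->
  (forall a b : Lam, primitive a -> primitive b -> lin_indep a b ->
     adapted a b (al a b) (be a b)) ->
  gamma_cocycle f phi ->
  equivariant_hermitian_structure phi (h01 al be) (h10 f).
Proof. by move=> Hf Had Hphi; exact: hermitian_structure. Qed.
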